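(* Let $n=1$, let $f:\mathbb{R}\to\mathbb{R}$ and $\phi:\mathbb{R}\to\mathbb{R}$ satisfy the standard assumptions (see context), and let $f(0)\neq 0$. Assume that $f'(0)=f''(0)=\cdots=f^{(s-1)}(0)=0$ and $f^{(s)}(0)\neq 0$ for some integer $s\ge 2$. Let $I(\tau)=\int_{\mathbb{R}}e^{i\tau f(x)}\phi(x)\,dx$, $X=\operatorname{Re} I$, $Y=\operatorname{Im} I$, and let $\Gamma$ be the plane curve parametrized by $\tau\mapsto (X(\tau),Y(\tau))$ for $\tau$ near $+\infty$ (i.e. near the origin of the plane). Then: (i) The oscillatory dimension of both $X$ and $Y$ is equal to $d'=\frac{3s-1}{2s}$, and the associated graphs (of $x(t)=X(1/t)$ and $y(t)=Y(1/t)$ near $t=0$) are Minkowski nondegenerate. (ii) The curve dimension of $I$ is $d=\frac{2s}{s+1}$, the curve $\Gamma$ is Minkowski measurable, and its $d$-dimensional Minkowski content is $$\mathcal{M}^d(\Gamma)=|C_1|^{\frac{2s}{s+1}}\cdot\pi\cdot\left(\frac{\pi}{s\cdot |f(0)|}\right)^{-\frac{2}{s+1}}\cdot\frac{s+1}{s-1},$$ where the constant $C_1\in\mathbb{C}$ (the leading coefficient in the asymptotic expansion of $I$, see context) depends on the phase function $f$ and on the value $\phi(0)$ of the amplitude at the origin.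
   Context: Standard assumptions. The amplitude $\phi:\mathbb{R}^n\to\mathbb{R}$ is of class $C^\infty$, is non-negative with compact support, and $0$ is contained in the interior of the support of $\phi$. The phase $f:\mathbb{R}^n\to\mathbb{R}$ has $0$ as a critical point (all first partial derivatives vanish), is real analytic in a neighborhood of $0$, and $0$ is the only critical point of $f$ in the interior of the support of $\phi$. (Here $n=1$.) Minkowski content and box dimension. For bounded $A\subset\mathbb{R}^N$ let $A_\varepsilon=\{y\in\mathbb{R}^N: d(y,A)<\varepsilon\}$ and, for $s\ge 0$, let $\mathcal{M}_*^s(A)=\liminf_{\varepsilon\to0}|A_\varepsilon|/\varepsilon^{N-s}$ and $\mathcal{M}^{*s}(A)=\limsup_{\varepsilon\to0}|A_\varepsilon|/\varepsilon^{N-s}$ ($|\cdot|$ is Lebesgue measure). If they coincide, the common value is the $s$-dimensional Minkowski content $\mathcal{M}^s(A)$. The lower and upper box dimensions are $\underline{\dim}_BA=\inf\{s\ge0:\mathcal{M}_*^s(A)=0\}$ and $\overline{\dim}_BA=\inf\{s\ge0:\mathcal{M}^{*s}(A)=0\}$; if they coincide the common value is the box dimension $\dim_B A$. $A$ is Minkowski nondegenerate if $0<\mathcal{M}_*^d(A)\le\mathcal{M}^{*d}(A)<\infty$ for some $d$ (then $d=\dim_BA$). $A$ is Minkowski measurable if for some $d$ the content $\mathcal{M}^d(A)$ exists and lies in $(0,\infty)$. Oscillatory and curve dimension. The oscillatory dimension of $X$ (near $\tau=\infty$) is the box dimension of the graph of $x(t)=X(1/t)$ near $t=0$ (i.e.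 over $(0,t_0]$ with $t_0>0$ small); similarly for $Y$ and $y(t)=Y(1/t)$. The curve dimension of $I$ is the box dimension of the curve $\Gamma=\{I(\tau):\tau\ge\tau_0\}\subset\mathbb{C}\cong\mathbb{R}^2$, with $\tau_0$ large. Constant $C_1$. Under the hypotheses, $I(\tau)\sim e^{i\tau f(0)}\sum_{j=1}^\infty C_j\tau^{-j/s}$ as $\tau\to\infty$, with $C_j\in\mathbb{C}$; $C_1$ is the coefficient of $\tau^{-1/s}$.
   Formalization: Assumptions added, since the claim fails without them: φ(0)>0; f is C^∞ on all of ℝ, not only analytic near 0; and at every point of the support of φ some derivative of f of order ≥1 is nonzero (a restriction only at boundary points of the support). *)

(* Defs.v *)
From HB Require Import structures.
From mathcomp Require Export all_boot all_order all_algebra.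
From mathcomp Require Export all_classical all_reals all_analysis.
From mathcomp Require Export complex.
Export numFieldNormedType.Exports.
Set Implicit Arguments.
Unset Strict Implicit.
Unset Printing Implicit Defensive.
Import Order.TTheory GRing.Theory Num.Theory.
Local Open Scope complex_scope.
Local Open Scope ring_scope.
Local Open Scope classical_set_scope.

(* MathComp-Analysis; R : realType is the field of real numbers and R[i] the
   field of complex numbers. *)

Section Plane.
Variable R : realType.
Implicit Types (A : set (R * R)%type) (p q : (R * R)%type) (s d : R).

(* Euclidean; the canonical norm on a product type is the max norm. *)
Definition edist p q : R :=
  Num.sqrt ((p.1 - q.1) ^+ 2 + (p.2 - q.2) ^+ 2).

(* d(y, A) < eps holds iff some point of A is at distance < eps of y. *)
Definition tube A (eps : R) : set (R * R)%type :=
  [set y | exists2 a, A a & edist y a < eps].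

Definition area A : \bar R :=
  ((@lebesgue_measure R) \x (@lebesgue_measure R))%E A.

(* The ambient dimension is N = 2. *)
Definition content_ratio s A (eps : R) : \bar R :=
  (area (tube A eps) * ((eps `^ (2 - s))^-1)%:E)%E.

Definition lower_content s A : \bar R := limf_einf (content_ratio s A) 0^'+.
Definition upper_content s A : \bar R := limf_esup (content_ratio s A) 0^'+.

Definition has_content s A (c : \bar R) :=
  lower_content s A = c /\ upper_content s A = c.

Definition lower_box_dim A : \bar R :=
  ereal_inf [set s%:E | s in [set s | 0 <= s /\ lower_content s A = 0%E]].
Definition upper_box_dim A : \bar R :=
  ereal_inf [set s%:E | s in [set s | 0 <= s /\ upper_content s A = 0%E]].

Definition has_box_dim A d :=
  lower_box_dim A = d%:E /\ upper_box_dim A = d%:E.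

Definition minkowski_nondegenerate A :=
  exists d, 0 <= d /\ (0 < lower_content d A)%E /\
    (lower_content d A <= upper_content d A)%E /\
    (upper_content d A < +oo)%E.

Definition minkowski_measurable A :=
  exists d c, 0 <= d /\ has_content d A c /\ (0 < c)%E /\ (c < +oo)%E.

(* The graph of t |-> X (1/t) over (0, t0]. *)
Definition inv_graph (X : R -> R) (t0 : R) : set (R * R)%type :=
  [set p | 0 < p.1 /\ p.1 <= t0 /\ p.2 = X (p.1)^-1].

Definition has_oscillatory_dim (X : R -> R) d :=
  \forall t0 \near 0^'+, has_box_dim (inv_graph X t0) d.

Definition curve_tail (J : R -> R[i]) (tau0 : R) : set (R * R)%type :=
  [set (complex.Re (J tau), complex.Im (J tau)) |
     tau in [set tau | tau0 <= tau]].

Definition has_curve_dim (J : R -> R[i]) d :=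
  \forall tau0 \near +oo, has_box_dim (curve_tail J tau0) d.

End Plane.

Section OscillatoryIntegral.
Variable R : realType.
Implicit Types (f phi : R -> R).

Definition smooth f := forall (k : nat) (x : R), derivable (f^`(k)) x 1.

Definition analytic_at f (x0 : R) :=
  exists (a : nat -> R) (r : R), 0 < r /\
    forall x, `|x - x0| < r ->
      series (fun k => a k * (x - x0) ^+ k) @ \oo --> f x.

Definition critical_point f (x : R) := derivable f x 1 /\ f^`() x = 0.

Definition supp phi : set R := closure [set x | phi x != 0].

Definition standard_amplitude phi :=
  [/\ smooth phi, (forall x, 0 <= phi x), compact (supp phi)
    & (supp phi)° 0].

Definition standard_phase f phi :=
  [/\ critical_point f 0, (\forall x \near (0 : R), analytic_at f x)
    & forall x, (supp phi)° x -> critical_point f x -> x = 0].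

(* f has no flat point in K. For f a smooth phase with a single critical point,
   of finite order, in the interior of supp phi, this constrains only the
   boundary points of supp phi. It always holds when f is analytic near
   supp phi. Without it the claim fails: a flat critical point of f on the
   boundary of supp phi can contribute terms that decay like 1 / log tau. *)
Definition finite_order_on (K : set R) f :=
  forall x, K x -> exists2 k : nat, (0 < k)%N & f^`(k) x != 0.

Definition cis (theta : R) : R[i] := cos theta +i* sin theta.

Definition Cintegral (g : R -> R[i]) : R[i] :=
  (\int[lebesgue_measure]_(x in [set: R]) complex.Re (g x))%R +i*
  (\int[lebesgue_measure]_(x in [set: R]) complex.Im (g x))%R.

Definition osc_integral f phi (tau : R) : R[i] :=
  Cintegral (fun x => cis (tau * f x) * (phi x)%:C).

(* J(tau) ~ e^(i tau f0) \sum_(j >= 1) C_j tau^(-j/s) as tau -> +oo, in the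
   sense of Poincare: for every N the error of the N-th partial sum is
   o(tau^(-N/s)). This determines C j for all j >= 1; C 0 plays no role. *)
Definition asymptotic_expansion (J : R -> R[i]) (f0 : R) (s : nat)
    (C : nat -> R[i]) :=
  forall N : nat,
    (Normc.normc (J tau - cis (tau * f0) *
        \sum_(1 <= j < N.+1) C j * (tau `^ (- (j%:R / s%:R)))%:C)
      * tau `^ (N%:R / s%:R)) @[tau --> +oo] --> (0 : R).

End OscillatoryIntegral.

(* Main.v *)
From HB Require Import structures.
From mathcomp Require Import zify lra ring measurable_realfun.
Require Import Defs.
Set Implicit Arguments.
Unset Strict Implicit.
Unset Printing Implicit Defensive.
Import Order.TTheory GRing.Theory Num.Theory.
Local Open Scope complex_scope.
Local Open Scope ring_scope.
Local Open Scope classical_set_scope.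

(** Write w = f 0, g = f - w and p = 1/s.  The integral is
    e^(i w t) (A t + i B t), where A = osc g phi 0 and B = osc g phi (- pi / 2)
    are the integrals of cos (t g) phi and of sin (t g) phi.

    The phase factors as g x = x^s h x and g' x = x^(s-1) q x, with h and q not
    vanishing at 0.  Because of this, one integration by parts shows that
    F = osc g (x^m a) th solves an Euler equation t F' + ((m+1)/s) F = E, where
    E is an integral of the same kind with m + 1 instead of m (osc_ode).  Its
    solutions are C t^(-(m+1)/s) up to an error as small as E (decaying_ode), so
    going down from a large m gives expansions to all orders (osc_expansion),
    as well as the behaviour of F'.  The integration by parts divides the
    amplitude by q, which may vanish at critical points of f on the boundary of
    the support; there phi is flat and f has finite order, so the quotient is
    smooth (flat_quotient), and the class of admissible amplitudes is closed
    under all the operations used.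

    The coefficient C_1 depends only on phi 0: an amplitude that vanishes at 0
    is x times an admissible one, and gains a factor t^(-1/s) (osc_lead0).  Its
    real part is positive: the sum of A (j - k) over j, k < n is the integral of
    phi |\sum_(k < n) e^(i k g)|^2, which is at least of order n^(2 - 1/s)
    because |g| <= 1/n on an interval of length of order n^(-1/s); faster decay
    or a negative leading term would make this sum smaller (osc_lead_gt0).

    X and Y therefore oscillate with amplitude of order t^(-p) and with
    frequency close to |w|.  Over x < sqrt eps, one oscillation of the graph of
    X (1/x) is shorter than eps and the tube fills the region under the envelope
    x^p; over x > sqrt eps its vertical sections have length of order
    eps (1 + x^(p-2)).  Both parts have area of order eps^((1+p)/2)
    (chirp_tube_order), which gives the dimension 2 - (1+p)/2 of (i).

    For (ii), A + i B turns slowly compared with e^(i w t), so the curve is a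
    spiral r = R theta with R theta equivalent to c theta^(-p), c = |C_1| |w|^p,
    and with consecutive turns at distance equivalent to
    2 pi p c theta^(-p-1) (polar_decaying).  Let T be the angle at which this
    distance is 2 eps.  On a ray from the origin, the turns before T cut
    disjoint intervals of length 2 eps, and those after T cover a segment of
    length c T^(-p).  Integrating r dr along the ray gives
    (c T^(-p))^2 / 2 * (1+p) / (1-p) to leading order, uniformly in the
    direction (spiral_ray_ge, spiral_ray_le), and the area follows by
    integrating over directions (spiral_tube_asymptotic). *)

(** * Mean values, powers and angles *)

Section MeanValue.
Variable R : realType.
Implicit Types (f df : R -> R) (a b : R).

Lemma mean_value f df a b : a <= b ->
  (forall x, a <= x <= b -> is_derive x 1 f (df x)) ->
  exists2 c, a <= c <= b & f b - f a = df c * (b - a).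
Proof.
rewrite le_eqVlt => /predU1P[<- _|ab dfE].
  by exists a; rewrite ?lexx// !subrr mulr0.
have d x : x \in `]a, b[%R -> is_derive x 1 f (df x).
  by rewrite in_itv/= => /andP[ax xb]; apply: dfE; rewrite !ltW.
have [|c] := MVT ab d.
  apply: derivable_within_continuous => x; rewrite in_itv/= => xab.
  by have := dfE x xab => ?; exact: ex_derive.
rewrite in_itv/= => /andP[ac cb] E.
by exists c => //; rewrite !ltW.
Qed.

Lemma nondecreasing_derive_ge0 f df a b : a <= b ->
  (forall x, a <= x <= b -> is_derive x 1 f (df x)) ->
  (forall x, a <= x <= b -> 0 <= df x) -> f a <= f b.
Proof.
move=> ab dfE df0; have [c cab E] := mean_value ab dfE.
by rewrite -subr_ge0 E mulr_ge0 ?df0 ?subr_ge0.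
Qed.

End MeanValue.

Section Powers.
Variable R : realType.
Implicit Types (x y h p al : R).

Lemma is_derive_powR p x : 0 < x ->
  is_derive x 1 (fun x => x `^ p) (p * x `^ (p - 1)).
Proof.
move=> x0; apply: DeriveDef; first by apply: derivable_powR; rewrite in_itv/= x0.
by rewrite -derive1E powR_derive1// in_itv/= x0.
Qed.

Lemma powRN_ge x y p : 0 < x -> x <= y -> 0 <= p -> y `^ (- p) <= x `^ (- p).
Proof.
move=> x0 xy p0; rewrite !powRN lef_pV2 ?posrE ?powR_gt0 ?(lt_le_trans x0)//.
by apply: ge0_ler_powR => //; rewrite nnegrE ?ltW// (lt_le_trans x0).
Qed.

(** Sums of k^(-al) are compared with telescoping sums of x^(1 - al). *)
Lemma sub_powR_bounds al x h : 0 < al < 1 -> 0 < x -> 0 <= h ->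
  (1 - al) * h * (x + h) `^ (- al) <= (x + h) `^ (1 - al) - x `^ (1 - al) /\
  (x + h) `^ (1 - al) - x `^ (1 - al) <= (1 - al) * h * x `^ (- al).
Proof.
move=> /andP[al0 al1] x0 h0.
have [||c /andP[xc ch] ->] := @mean_value R (fun y => y `^ (1 - al)) (fun y => (1 - al) * y `^ (1 - al - 1)) x (x + h).
- by rewrite lerDl.
- by move=> y /andP[xy _]; apply: is_derive_powR; rewrite (lt_le_trans x0).
have -> : 1 - al - 1 = - al by ring.
have -> : x + h - x = h by ring.
rewrite (mulrAC _ _ h).
have k0 : 0 <= (1 - al) * h by rewrite mulr_ge0// subr_ge0 ltW.
split; apply: (ler_wpM2l k0); apply: powRN_ge => //; rewrite ?(ltW al0)//.
exact: lt_le_trans xc.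
Qed.

Lemma sum_powR_ge al x h n : 0 < al < 1 -> 0 < x -> 0 <= h ->
  (x + h * n%:R) `^ (1 - al) - x `^ (1 - al) <=
  (1 - al) * h * \sum_(k < n) (x + h * k%:R) `^ (- al).
Proof.
move=> al01 x0 h0; elim: n => [|n IHn]; first by rewrite big_ord0 !mulr0 addr0 subrr.
rewrite big_ord_recr/= mulrDr.
have xn : 0 < x + h * n%:R by rewrite ltr_pwDl// mulr_ge0.
have [_] := sub_powR_bounds al01 xn h0.
have -> : x + h * n.+1%:R = x + h * n%:R + h by rewrite -natr1; ring.
lra.
Qed.

Lemma sum_powR_le al x h n : 0 < al < 1 -> 0 < x -> 0 <= h ->
  (1 - al) * h * \sum_(k < n.+1) (x + h * k%:R) `^ (- al) <=
  (1 - al) * h * x `^ (- al) + ((x + h * n%:R) `^ (1 - al) - x `^ (1 - al)).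
Proof.
move=> al01 x0 h0; elim: n => [|n IHn].
  by rewrite big_ord1 !mulr0 addr0 subrr addr0.
rewrite big_ord_recr/= mulrDr.
have xn : 0 < x + h * n%:R by rewrite ltr_pwDl// mulr_ge0.
have [+ _] := sub_powR_bounds al01 xn h0.
have -> : x + h * n.+1%:R = x + h * n%:R + h by rewrite -natr1; ring.
lra.
Qed.

(** Locates y among the successive turns of an angle x, with h = 2 pi. *)
Lemma progression_floor x h y : 0 < h -> x <= y ->
  exists n : nat, x + h * n%:R <= y < x + h * n.+1%:R.
Proof.
move=> h0 xy; have : 0 <= (y - x) / h by rewrite divr_ge0 ?subr_ge0// ltW.
move=> /truncn_itv; rewrite ler_pdivlMr// ltr_pdivrMr// => /andP[n1 n2].
exists (Num.truncn ((y - x) / h)).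
by rewrite mulrC -lerBrDl n1 mulrC -ltrBlDl.
Qed.

End Powers.

Section Angles.
Variable R : realType.
Implicit Types (x t a : R).

Lemma cosD2piMn x n : cos (x + 2 * pi * n%:R) = cos x.
Proof.
have -> : x + 2 * pi * n%:R = x + (pi *+ 2) *+ n.
  by rewrite -mulrnA -[in RHS]mulr_natr natrM; ring.
by rewrite periodicn//; exact: cosD2pi.
Qed.

Lemma sinD2piMn x n : sin (x + 2 * pi * n%:R) = sin x.
Proof.
have -> : x + 2 * pi * n%:R = x + (pi *+ 2) *+ n.
  by rewrite -mulrnA -[in RHS]mulr_natr natrM; ring.
by rewrite periodicn//; exact: sinD2pi.
Qed.

Lemma unit_angle (e1 e2 : R) : e1 ^+ 2 + e2 ^+ 2 = 1 ->
  exists2 t, 0 <= t <= 2 * pi & e1 = cos t /\ e2 = sin t.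
Proof.
move=> e12.
have e1b : -1 <= e1 <= 1.
  by rewrite -ler_norml -(@ler_pXn2r _ 2)// ?nnegrE// expr1n real_normK ?num_real// -e12 lerDl sqr_ge0.
have c1 : cos (acos e1) = e1 by rewrite acosK// in_itv.
have s1 : sin (acos e1) = `|e2|.
  by rewrite sin_acos// -e12 addrC addKr sqrtr_sqr.
have p0 := acos_ge0 e1b; have p1 := acos_lepi e1b.
have [e20|e20] := leP 0 e2.
  exists (acos e1); first by lra.
  by rewrite c1 s1 ger0_norm.
exists (2 * pi - acos e1); first by lra.
have -> : 2 * pi - acos e1 = - acos e1 + 2 * pi * 1%:R by ring.
rewrite cosD2piMn sinD2piMn cosN sinN c1 s1 ltr0_norm//.
by rewrite opprK.
Qed.

Lemma unit_angle_after (e1 e2 a : R) : e1 ^+ 2 + e2 ^+ 2 = 1 -> 2 * pi <= a ->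
  exists2 t, a < t <= a + 2 * pi & e1 = cos t /\ e2 = sin t.
Proof.
move=> /unit_angle[t /andP[t0 t1] [-> ->]] a2.
have pi0 := pi_gt0 R.
have [||n /andP[n1 n2]] := @progression_floor _ t (2 * pi) a; [lra|lra|].
exists (t + 2 * pi * n.+1%:R); last by rewrite cosD2piMn sinD2piMn.
by rewrite n2/= -natr1; lra.
Qed.

Lemma mulr_cos_le_sin x : 0 <= x <= pi -> x * cos x <= sin x.
Proof.
move=> /andP[x0 xpi].
rewrite -subr_ge0.
have := @nondecreasing_derive_ge0 R (fun y => sin y - y * cos y) (fun y => y * sin y) 0 x x0.
rewrite sin0 mul0r subrr; apply.
  move=> y _; apply: is_derive_eq.
  by rewrite /GRing.scale/=; ring.
move=> y /andP[y0 yx]; rewrite mulr_ge0// sin_ge0_pi// y0/=.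
exact: le_trans xpi.
Qed.

(** Converts a short chord of the unit circle into a small angle. *)
Lemma sqr_le_1Bcos x : `|x| <= pi -> 1 / 2 <= cos x -> x ^+ 2 <= 8 * (1 - cos x).
Proof.
rewrite -(cos_norm x) -(real_normK (num_real x)); move: `|x| (normr_ge0 x) => {}x x0 xpi cx.
have := @mulr_cos_le_sin x; rewrite x0 xpi => /(_ isT) xs.
have s2 := cos2Dsin2 x.
have c1 : cos x <= 1 by exact: cos_le1.
have xs2 : x <= 2 * sin x by nra.
have : x ^+ 2 <= (2 * sin x) ^+ 2 by rewrite ler_pXn2r// nnegrE// (le_trans x0).
nra.
Qed.

End Angles.

(** * Area in polar coordinates *)

Section Scaling.
Variable R : realType.
Local Notation mu := (@lebesgue_measure R).
Local Open Scope ereal_scope.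

(** The scaled pushforward of the Lebesgue measure gives intervals their length,
    hence is the Lebesgue measure. *)
Lemma lebesgue_measure_preimage_mul (c : R) (A : set R) : (c != 0)%R ->
  measurable A -> mu A = `|c|%:E * mu ((fun x => c * x)%R @^-1` A).
Proof.
move=> c0 mA.
have mc : measurable_fun [set: measurableTypeR R]
  (fun x : measurableTypeR R => c * x : measurableTypeR R)%R.
  exact: measurable_funM.
pose nu : {measure set _ -> \bar R} := mscale (NngNum (normr_ge0 c))
  (measure_function_pushforward__canonical__measure_function_Measure mu mc).
transitivity (nu A); last by [].
apply: lebesgue_measure_unique mA => _ [[a b]] _ <-.
rewrite /nu /= /mscale/= /pushforward /=.
have [ab|ba] := ltP a b; last first.
  by rewrite set_itv_ge ?bnd_simp -?leNgt// preimage_set0 !measure0 mule0.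
have [cp|cn] : (0 < c \/ c < 0)%R by case: (ltgtP 0%R c) c0 => //; [left|right].
- rewrite (_ : _ @^-1` _ = `](a / c)%R, (b / c)%R]%classic); last first.
    apply/seteqP; split => x /=; rewrite !in_itv/=;
      by rewrite ltr_pdivrMr// ler_pdivlMr// (mulrC c).
  rewrite !lebesgue_measure_itv/= !lte_fin ab ltr_pM2r ?invr_gt0// ab.
  rewrite -!EFinB -EFinM gtr0_norm//; congr EFin; field; exact: lt0r_neq0.
- rewrite (_ : _ @^-1` _ = `[(b / c)%R, (a / c)%R[%classic); last first.
    apply/seteqP; split => x /=; rewrite !in_itv/=;
      by rewrite ltr_ndivlMr// ler_ndivrMr// (mulrC c) andbC.
  rewrite !lebesgue_measure_itv/= !lte_fin ab ltr_nM2r ?invr_lt0// ab.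
  rewrite -!EFinB -EFinM ltr0_norm//; congr EFin; field; exact: c0.
Qed.

Lemma ge0_integral_scale (c : R) (F : R -> \bar R) : (c != 0)%R ->
  measurable_fun setT F -> (forall x, 0 <= F x) ->
  \int[mu]_x F x = `|c|%:E * \int[mu]_x F (c * x)%R.
Proof.
move=> c0 mF F0.
have mc : measurable_fun [set: measurableTypeR R]
  (fun x : measurableTypeR R => c * x : measurableTypeR R)%R.
  exact: measurable_funM.
pose nu : {measure set _ -> \bar R} := mscale (NngNum (normr_ge0 c))
  (measure_function_pushforward__canonical__measure_function_Measure mu mc).
rewrite (eq_measure_integral nu); last first.
  by move=> A mA _; exact: lebesgue_measure_preimage_mul.
rewrite /nu ge0_integral_mscale//=; congr (_ * _).
by rewrite ge0_integral_pushforward.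
Qed.

Lemma integral_inv_oneDsqr :
  \int[mu]_(x in setT) (oneDsqr x)^-1%:E = (pi : R)%:E.
Proof.
rewrite ge0_symfun_integralT.
- rewrite (_ : [set x | _] = `[0%R, +oo[%classic); last first.
    by apply/seteqP; split => x /=; rewrite in_itv/= andbT.
  rewrite integral0y_oneDsqr -EFinM; by rewrite mulrC divfK.
- by move=> x; rewrite invr_ge0 /oneDsqr addr_ge0 ?sqr_ge0.
- exact: continuous_oneDsqrV.
- by move=> x /=; rewrite /oneDsqr sqrrN.
Qed.
End Scaling.

Section Polar.
Variable R : realType.
Local Notation mu := (@lebesgue_measure R).
Implicit Types (E : set (R * R)%type) (e : (R * R)%type).

(** The integral of r dr over the part of the ray of direction e that lies in E;
    Num.max r 0 cuts the line down to the ray. *)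
Definition ray_weight E e : \bar R :=
  (\int[mu]_r (Num.max r 0 * \1_E (r * e.1, r * e.2))%:E)%E.

Lemma measurable_line_pair (a b : R) :
  measurable_fun [set: R] (fun r : R => (r * a, r * b)).
Proof.
by apply: measurable_fun_pair; exact: measurable_funM.
Qed.

Lemma measurable_indic_line E e : measurable E ->
  measurable_fun [set: R] (fun r : R => \1_E (r * e.1, r * e.2) : R).
Proof.
move=> mE.
apply: (@measurableT_comp _ _ _ _ _ _ (\1_E : R * R -> R)) => //.
exact: measurable_line_pair.
Qed.

Lemma measurable_ray_integrand E e : measurable E ->
  measurable_fun setT (fun r : R => (Num.max r 0 * \1_E (r * e.1, r * e.2))%:E).
Proof.
move=> mE; apply/measurable_EFinP; apply: measurable_funM.
  exact: measurable_maxr.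
exact: measurable_indic_line.
Qed.

(** The line of slope u is made of two opposite rays; rescaling it to unit speed
    produces the Cauchy density in u. *)
Lemma line_integralE E (u : R) : measurable E ->
  let w := Num.sqrt (oneDsqr u) in
  (\int[mu]_x (`|x| * \1_E (x, x * u))%:E =
  (oneDsqr u)^-1%:E *
    (ray_weight E (w^-1, u / w)%R + ray_weight E (- w^-1, - (u / w))%R))%E.
Proof.
move=> mE w.
have u0 : 0 < oneDsqr u by rewrite (lt_le_trans ltr01)// oneDsqr_ge1.
have w0 : 0 < w by rewrite sqrtr_gt0.
have w2 : w ^+ 2 = oneDsqr u by rewrite sqr_sqrtr// ltW.
have mF : measurable_fun setT (fun x : R => (`|x| * \1_E (x, x * u))%:E).
  apply/measurable_EFinP; apply: measurable_funM; first exact: normr_measurable.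
  apply: (@measurableT_comp _ _ _ _ _ _ (\1_E : R * R -> R)) => //.
  by apply: measurable_fun_pair => //; exact: measurable_funM.
rewrite (@ge0_integral_scale _ (w^-1)%R)//; last by rewrite invr_eq0 gt_eqF.
rewrite gtr0_norm ?invr_gt0//.
rewrite (_ : ray_weight E (- w^-1, _)%R =
   \int[mu]_r (Num.max (- r) 0 * \1_E (r * w^-1, r * (u / w)))%:E)%E; last first.
  rewrite /ray_weight (@ge0_integral_scale _ (-1)%R)//; last 2 first.
  - exact: measurable_ray_integrand.
  - by move=> x; rewrite lee_fin mulr_ge0// ?le_max ?lexx ?orbT// indicE ler0n.
  rewrite normrN1 mul1e; apply: eq_integral => x _ /=.
  by rewrite !mulN1r !mulrNN.
rewrite /ray_weight -ge0_integralD//=; last 4 first.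
- by move=> x _; rewrite lee_fin mulr_ge0// ?le_max ?lexx ?orbT// indicE ler0n.
- exact: (@measurable_ray_integrand E (w^-1, u / w) mE).
- by move=> x _; rewrite lee_fin mulr_ge0// ?le_max ?lexx ?orbT// indicE ler0n.
- apply/measurable_EFinP; apply: measurable_funM.
    by apply: measurable_maxr => //; exact: oppr_measurable.
  exact: (@measurable_indic_line E (w^-1, u / w) mE).
rewrite -w2 expr2 invfM EFinM -muleA; congr (_ * _)%E.
rewrite -ge0_integralZl_EFin//; last 3 first.
- move=> x _; rewrite -EFinD lee_fin addr_ge0//;
  by rewrite mulr_ge0// ?le_max ?lexx ?orbT// indicE ler0n.
- apply: emeasurable_funD.
    exact: (@measurable_ray_integrand E (w^-1, u / w) mE).
  apply/measurable_EFinP; apply: measurable_funM.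
    by apply: measurable_maxr => //; exact: oppr_measurable.
  exact: (@measurable_indic_line E (w^-1, u / w) mE).
- by rewrite invr_ge0 ltW.
apply: eq_integral => x _; rewrite -EFinD -EFinM; congr EFin.
have -> : w^-1 * x * u = x * (u / w) by rewrite mulrC [RHS]mulrC -mulrA.
rewrite normrM gtr0_norm ?invr_gt0// (mulrC w^-1 x) -mulrDl -!mulrA; congr (_ * _).
congr (_ * _).
have [x0|x0|->] := ltrgt0P x; last by rewrite oppr0 maxxx addr0.
- by rewrite max_r ?addr0// oppr_le0 ltW.
- by rewrite max_l ?add0r// oppr_ge0 ltW.
Qed.

Definition slope_integrand E : R * R -> \bar R :=
  fun z => (`|z.1| * \1_E (z.1, z.1 * z.2))%:E.

Lemma slope_integrand_ge0 E z : (0 <= slope_integrand E z)%E.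
Proof. by rewrite lee_fin mulr_ge0// indicE ler0n. Qed.

Lemma measurable_slope_integrand E : measurable E ->
  measurable_fun setT (slope_integrand E).
Proof.
move=> mE; apply/measurable_EFinP; apply: measurable_funM.
  exact: measurableT_comp.
apply: (@measurableT_comp _ _ _ _ _ _ (\1_E : R * R -> R)) => //.
apply: measurable_fun_pair; first exact: measurable_fst.
by apply: measurable_funM; [exact: measurable_fst|exact: measurable_snd].
Qed.

Definition slope_weight E (u : R) : \bar R :=
  let w := Num.sqrt (oneDsqr u) in
  ((oneDsqr u)^-1%:E *
    (ray_weight E (w^-1, u / w)%R + ray_weight E (- w^-1, - (u / w))%R))%E.

Lemma slope_weightE E : measurable E ->
  slope_weight E = (fun u => \int[mu]_x slope_integrand E (x, u))%E.
Proof. by move=> mE; apply/funext => u; rewrite /slope_weight -line_integralE. Qed.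

Lemma measurable_slope_weight E : measurable E ->
  measurable_fun setT (slope_weight E).
Proof.
move=> mE; rewrite slope_weightE//.
apply: (@measurable_fun_fubini_tonelli_G _ _ _ _ _ mu (slope_integrand E)).
- exact: measurable_slope_integrand.
- by move=> z; exact: slope_integrand_ge0.
Qed.

(** Fubini in the coordinates (x, u) with y = x u. The slope u plays the role of
    the angle, and the vertical line that it misses is negligible. *)
Lemma area_polar E : measurable E ->
  (area E = \int[mu]_u slope_weight E u)%E.
Proof.
move=> mE.
have mG := measurable_slope_integrand mE.
have G0 := slope_integrand_ge0 E.
rewrite slope_weightE//.
transitivity (\int[mu]_x \int[mu]_u slope_integrand E (x, u))%E; last first.
  exact: (@fubini_tonelli _ _ _ _ _ mu mu (slope_integrand E)).
rewrite /area /product_measure1.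
apply: ae_eq_integral => //.
- exact: measurable_fun_xsection.
- exact: (@measurable_fun_fubini_tonelli_F _ _ _ _ _ mu (slope_integrand E)).
exists [set 0%R]; split; [exact: measurable_set1|exact: lebesgue_measure_set1|].
move=> x /=; apply: contra_notP => /eqP x0 _.
rewrite (@lebesgue_measure_preimage_mul _ x)//; last exact: measurable_xsection.
have mx : measurable_fun [set: R] (fun u : R => x * u) by exact: measurable_funM.
rewrite -[X in (_ * mu X)%E]setIT -integral_indic//; last first.
  by rewrite -[X in measurable X]setTI; apply: mx => //; exact: measurable_xsection.
rewrite -ge0_integralZl_EFin//; last first.
  apply/measurable_EFinP; apply: measurable_indic.
  by rewrite -[X in measurable X]setTI; apply: mx => //; exact: measurable_xsection.
apply: eq_integral => u _; rewrite /slope_integrand /= EFinM; congr (_ * _%:E)%E.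
by rewrite !indicE; congr ((_ : bool)%:R); apply/idP/idP; rewrite !inE /xsection/= ?inE.
Qed.

Lemma ray_weight_ge0 E e : (0 <= ray_weight E e)%E.
Proof.
apply: integral_ge0 => r _.
by rewrite lee_fin mulr_ge0// ?indicE ?ler0n// le_max lexx orbT.
Qed.

Lemma slope_unit (u : R) :
  (Num.sqrt (oneDsqr u))^-1 ^+ 2 + (u / Num.sqrt (oneDsqr u)) ^+ 2 = 1.
Proof.
have u0 : 0 < oneDsqr u by rewrite (lt_le_trans ltr01)// oneDsqr_ge1.
rewrite exprMn -[X in X + _]mul1r -mulrDl exprVn sqr_sqrtr ?ltW//.
by rewrite -[X in X / _]/(oneDsqr u) divff// gt_eqF.
Qed.

Lemma integral_cauchy_density (m : R) : 0 <= m ->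
  (\int[mu]_u ((oneDsqr u)^-1 * m)%:E = (pi * m)%:E)%E.
Proof.
move=> m0.
under eq_integral do rewrite EFinM.
rewrite ge0_integralZr//=; first by rewrite integral_inv_oneDsqr.
apply/measurable_EFinP; apply: continuous_measurable_fun.
exact: continuous_oneDsqrV.
Qed.

Lemma oneDsqrV_ge0 (u : R) : 0 <= (oneDsqr u)^-1.
Proof. by rewrite invr_ge0 (le_trans ler01)// oneDsqr_ge1. Qed.

(** The Cauchy density has total mass pi, so a bound shared by all the rays
    reaches the area with the factor 2 pi of polar coordinates. *)
Lemma area_le_rays E (m : R) : measurable E ->
  (forall e, e.1 ^+ 2 + e.2 ^+ 2 = 1 -> (ray_weight E e <= m%:E)%E) ->
  (area E <= (2 * pi * m)%:E)%E.
Proof.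
move=> mE h.
have m0 : 0 <= m.
  have := h (1, 0) => /= /(_ _)/(le_trans (ray_weight_ge0 _ _)).
  by rewrite lee_fin; apply; rewrite expr1n expr0n addr0.
have -> : 2 * pi * m = pi * (m + m) by ring.
rewrite area_polar// -integral_cauchy_density ?addr_ge0//.
apply: ge0_le_integral => //.
- move=> u _; rewrite /slope_weight mule_ge0 ?lee_fin ?oneDsqrV_ge0//.
  by rewrite adde_ge0// ray_weight_ge0.
- exact: measurable_slope_weight.
- apply/measurable_EFinP; apply: measurable_funM => //.
  apply: continuous_measurable_fun; exact: continuous_oneDsqrV.
- move=> u _; rewrite /slope_weight EFinM; apply: lee_wpmul2l.
    by rewrite lee_fin oneDsqrV_ge0.
  by rewrite EFinD leeD// h//= ?sqrrN slope_unit.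
Qed.

Lemma area_ge_rays E (m : R) : measurable E -> 0 <= m ->
  (forall e, e.1 ^+ 2 + e.2 ^+ 2 = 1 -> (m%:E <= ray_weight E e)%E) ->
  ((2 * pi * m)%:E <= area E)%E.
Proof.
move=> mE m0 h.
have -> : 2 * pi * m = pi * (m + m) by ring.
rewrite area_polar// -integral_cauchy_density ?addr_ge0//.
apply: ge0_le_integral => //.
- by move=> u _; rewrite lee_fin mulr_ge0 ?addr_ge0 ?oneDsqrV_ge0.
- apply/measurable_EFinP; apply: measurable_funM => //.
  apply: continuous_measurable_fun; exact: continuous_oneDsqrV.
- exact: measurable_slope_weight.
- move=> u _; rewrite /slope_weight EFinM; apply: lee_wpmul2l.
    by rewrite lee_fin oneDsqrV_ge0.
  by rewrite EFinD leeD// h//= ?sqrrN slope_unit.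
Qed.

End Polar.

(** * Tubes, Minkowski contents and box dimension *)

Section Tube.
Variable R : realType.
Implicit Types (A : set (R * R)%type) (p q : (R * R)%type) (eps : R).

Lemma edist_ltP p q eps : 0 < eps ->
  (edist p q < eps) = ((p.1 - q.1) ^+ 2 + (p.2 - q.2) ^+ 2 < eps ^+ 2).
Proof.
move=> e0; rewrite /edist -[in RHS](@ltr_sqrt _ _ (eps ^+ 2)) ?exprn_gt0//.
by rewrite sqrtr_sqr gtr0_norm.
Qed.

(** Measurability in the plane refers to the product sigma-algebra; rectangles
    with rational vertices exhibit an open set as a countable union of products. *)
Lemma measurable_locally_square (O : set (R * R)) :
  (forall y, O y -> exists2 d : R, 0 < d &
    forall z, `|z.1 - y.1| < d -> `|z.2 - y.2| < d -> O z) ->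
  measurable O.
Proof.
move=> oO.
pose rect (q : (rat * rat) * (rat * rat)) : set (R * R) :=
  `]ratr q.1.1, ratr q.1.2[ `*` `]ratr q.2.1, ratr q.2.2[.
have -> : O = \bigcup_q [set z | rect q `<=` O /\ rect q z].
  apply/seteqP; split => [y Oy|y [q _ [qO qy]]]; last exact: qO.
  have [d d0 dO] := oO _ Oy.
  have [a1 /andP[ha1 ha1']] : exists q : rat, y.1 - d < ratr q < y.1.
    have [|q] := @rat_in_itvoo R (y.1 - d) (y.1); first lra.
    by rewrite in_itv/=; exists q.
  have [b1 /andP[hb1 hb1']] : exists q : rat, y.1 < ratr q < y.1 + d.
    have [|q] := @rat_in_itvoo R (y.1) (y.1 + d); first lra.
    by rewrite in_itv/=; exists q.
  have [a2 /andP[ha2 ha2']] : exists q : rat, y.2 - d < ratr q < y.2.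
    have [|q] := @rat_in_itvoo R (y.2 - d) (y.2); first lra.
    by rewrite in_itv/=; exists q.
  have [b2 /andP[hb2 hb2']] : exists q : rat, y.2 < ratr q < y.2 + d.
    have [|q] := @rat_in_itvoo R (y.2) (y.2 + d); first lra.
    by rewrite in_itv/=; exists q.
  exists ((a1, b1), (a2, b2)) => //; split; last first.
    by split; rewrite /= in_itv/=; apply/andP.
  move=> z [] /=; rewrite !in_itv/= => /andP[za1 zb1] /andP[za2 zb2].
  apply: dO; rewrite ltr_norml; apply/andP; split.
  - by rewrite ltrBrDr addrC (lt_trans _ za1)//.
  - by rewrite ltrBlDr addrC (lt_trans zb1)//.
  - by rewrite ltrBrDr addrC (lt_trans _ za2)//.
  - by rewrite ltrBlDr addrC (lt_trans zb2)//.
apply: countable_bigcupT_measurable => [|q]; first exact: countableP.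
have [qO|nqO] := pselect (rect q `<=` O).
  rewrite (_ : [set z | _] = rect q); last by apply/seteqP; split => [z []|z].
  by apply: measurableX; exact: measurable_itv.
rewrite (_ : [set z | _] = set0)//.
by apply/seteqP; split => [z []|z].
Qed.

Lemma measurable_tube A eps : 0 < eps -> measurable (tube A eps).
Proof.
move=> e0; apply: measurable_locally_square => y [a Aa].
set d := edist y a => de.
have d0 : 0 <= d by exact: sqrtr_ge0.
have d2 : (y.1 - a.1) ^+ 2 + (y.2 - a.2) ^+ 2 = d ^+ 2.
  by rewrite sqr_sqrtr// addr_ge0 ?sqr_ge0.
exists ((eps - d) / 2); first by rewrite divr_gt0// subr_gt0.
move=> z; rewrite !ltr_norml => /andP[z1 z1'] /andP[z2 z2']; exists a => //.
rewrite edist_ltP//.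
have u1 : `|y.1 - a.1| <= d by rewrite -ler_sqr ?nnegrE// real_normK ?num_real// -d2 lerDl sqr_ge0.
have u2 : `|y.2 - a.2| <= d by rewrite -ler_sqr ?nnegrE// real_normK ?num_real// -d2 lerDr sqr_ge0.
move: u1 u2; rewrite !ler_norml => /andP[u1 u1'] /andP[u2 u2'].
have -> : z.1 - a.1 = (y.1 - a.1) + (z.1 - y.1) by lra.
have -> : z.2 - a.2 = (y.2 - a.2) + (z.2 - y.2) by lra.
move: (y.1 - a.1) (y.2 - a.2) (z.1 - y.1) (z.2 - y.2) d2 z1 z1' z2 z2' u1 u1' u2 u2' => p1 p2 h1 h2 d2 z1 z1' z2 z2' u1 u1' u2 u2'.
set t := (eps - d) / 2 in z1 z1' z2 z2'.
have -> : eps = d + 2 * t by rewrite /t; lra.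
have t0 : 0 < t by rewrite /t; lra.
have hh1 : h1 ^+ 2 < t ^+ 2 by rewrite -ltr_sqrt ?exprn_gt0// !sqrtr_sqr ltr_norml gtr0_norm//; apply/andP.
have hh2 : h2 ^+ 2 < t ^+ 2 by rewrite -ltr_sqrt ?exprn_gt0// !sqrtr_sqr ltr_norml gtr0_norm//; apply/andP.
have ph1 : p1 * h1 <= d * t by nra.
have ph2 : p2 * h2 <= d * t by nra.
nra.
Qed.

Lemma le_area (A B : set (R * R)) : measurable A -> measurable B -> A `<=` B ->
  (area A <= area B)%E.
Proof. by move=> mA mB AB; rewrite /area; apply: (@le_measure _ _ _ (lebesgue_measure \x lebesgue_measure)%E); rewrite ?inE. Qed.

End Tube.

Section Content.
Variable R : realType.
Implicit Types (A : set (R * R)%type) (s d c : R).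

Lemma lower_content_ge s A (l : \bar R) :
  (\forall eps \near 0^'+, (l <= content_ratio s A eps)%E) ->
  (l <= lower_content s A)%E.
Proof.
move=> h; rewrite /lower_content limf_einfE.
apply: ereal_sup_ge; exists (ereal_inf (content_ratio s A @` [set eps | (l <= content_ratio s A eps)%E])).
  by exists [set eps | (l <= content_ratio s A eps)%E].
by apply: le_ereal_inf_tmp => _ [eps /= + <-].
Qed.

Lemma upper_content_le s A (l : \bar R) :
  (\forall eps \near 0^'+, (content_ratio s A eps <= l)%E) ->
  (upper_content s A <= l)%E.
Proof.
move=> h; rewrite /upper_content limf_esupE.
apply: ereal_inf_le; exists (ereal_sup (content_ratio s A @` [set eps | (content_ratio s A eps <= l)%E])).
  by exists [set eps | (content_ratio s A eps <= l)%E].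
by apply: ge_ereal_sup => _ [eps /= + <-].
Qed.

Lemma lower_le_upper_content s A : (lower_content s A <= upper_content s A)%E.
Proof.
rewrite /lower_content /upper_content limf_einfE limf_esupE.
apply: ge_ereal_sup => _ [V nV <-]; apply: le_ereal_inf_tmp => _ [W nW <-].
have [e [Ve We]] : (V `&` W) !=set0.
  by apply: (@filter_ex _ (0^'+ : set_system R)); exact: filterI.
apply: (@le_trans _ _ (content_ratio s A e)).
  by apply: ge_ereal_inf; exists (content_ratio s A e) => //; exists e.
by apply: ereal_sup_ubound; exists e.
Qed.

Lemma area_ge0 A : (0 <= area A)%E.
Proof. by rewrite /area; apply: (measure_ge0 (lebesgue_measure \x lebesgue_measure)%E). Qed.

Lemma content_ratio_ge0 s A eps : (0 <= content_ratio s A eps)%E.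
Proof. by rewrite mule_ge0 ?area_ge0// lee_fin invr_ge0 powR_ge0. Qed.

Lemma lower_content_ge0 s A : (0 <= lower_content s A)%E.
Proof. by apply: lower_content_ge; apply: nearW => e; exact: content_ratio_ge0. Qed.

Lemma content_ratio_le s A eps c : 0 < eps ->
  (area (tube A eps) <= (c * eps `^ (2 - s))%:E)%E ->
  (content_ratio s A eps <= c%:E)%E.
Proof.
move=> e0 h; have p0 : 0 < eps `^ (2 - s) by exact: powR_gt0.
rewrite /content_ratio.
apply: (@le_trans _ _ ((c * eps `^ (2 - s))%:E * ((eps `^ (2 - s))^-1)%:E)%E).
  by apply: lee_wpmul2r => //; rewrite lee_fin invr_ge0 ltW.
by rewrite -EFinM mulfK ?gt_eqF.
Qed.

Lemma content_ratio_ge s A eps c : 0 < eps ->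
  ((c * eps `^ (2 - s))%:E <= area (tube A eps))%E ->
  (c%:E <= content_ratio s A eps)%E.
Proof.
move=> e0 h; have p0 : 0 < eps `^ (2 - s) by exact: powR_gt0.
rewrite /content_ratio.
apply: (@le_trans _ _ ((c * eps `^ (2 - s))%:E * ((eps `^ (2 - s))^-1)%:E)%E).
  by rewrite -EFinM mulfK ?gt_eqF.
by apply: lee_wpmul2r => //; rewrite lee_fin invr_ge0 ltW.
Qed.

Lemma near0r_powR_le (p e : R) : 0 < p -> 0 < e ->
  \forall eps \near 0^'+, eps `^ p <= e.
Proof.
move=> p0 e0; near=> eps.
have eps0 : 0 < eps by near: eps; exact: nbhs_right_gt.
have le : eps <= e `^ p^-1.
  by near: eps; apply: nbhs_right_le; rewrite powR_gt0.
have -> : e = (e `^ p^-1) `^ p by rewrite -powRrM mulVf ?gt_eqF// powRr1 ?ltW.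
by apply: ge0_ler_powR => //; rewrite ?nnegrE ?powR_ge0// ltW.
Unshelve. all: by end_near. Qed.

Definition tube_order A (d : R) := exists c1 c2 : R, [/\ 0 < c1, 0 < c2 &
  \forall eps \near 0^'+, ((c1 * eps `^ (2 - d))%:E <= area (tube A eps))%E /\
    (area (tube A eps) <= (c2 * eps `^ (2 - d))%:E)%E].

Lemma tube_order_lower A d s : tube_order A d -> s <= d ->
  (0 < lower_content s A)%E.
Proof.
move=> [c1 [c2 [c10 c20 h]]] sd.
apply: (@lt_le_trans _ _ c1%:E); first by rewrite lte_fin.
apply: lower_content_ge; near=> eps.
have eps0 : 0 < eps by near: eps; exact: nbhs_right_gt.
have eps1 : eps <= 1 by near: eps; exact: nbhs_right_le.
have [hl _] : ((c1 * eps `^ (2 - d))%:E <= area (tube A eps))%E /\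
    (area (tube A eps) <= (c2 * eps `^ (2 - d))%:E)%E by near: eps.
apply: content_ratio_ge => //; apply: le_trans hl.
rewrite lee_fin (ler_wpM2l (ltW c10))//; apply: ger_powR; first by rewrite eps0.
by rewrite lerB.
Unshelve. all: by end_near. Qed.

Lemma tube_order_upper A d s : tube_order A d -> d < s -> upper_content s A = 0%E.
Proof.
move=> [c1 [c2 [c10 c20 h]]] ds.
apply/eqP; rewrite eq_le; apply/andP; split; last first.
  exact: le_trans (lower_content_ge0 s A) (lower_le_upper_content s A).
apply/lee_addgt0Pr => e e0; rewrite add0e.
apply: upper_content_le; near=> eps.
have eps0 : 0 < eps by near: eps; exact: nbhs_right_gt.
have [_ hu] : ((c1 * eps `^ (2 - d))%:E <= area (tube A eps))%E /\
    (area (tube A eps) <= (c2 * eps `^ (2 - d))%:E)%E by near: eps.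
apply: content_ratio_le => //; apply: (le_trans hu).
have -> : 2 - d = (s - d) + (2 - s) by ring.
rewrite powRD; last by rewrite (gt_eqF eps0) implybT.
rewrite lee_fin mulrA ler_wpM2r ?powR_ge0// mulrC -ler_pdivlMr//.
by near: eps; apply: near0r_powR_le; rewrite ?subr_gt0// divr_gt0.
Unshelve. all: by end_near. Qed.

Lemma tube_order_upper_fin A d : tube_order A d -> (upper_content d A < +oo)%E.
Proof.
move=> [c1 [c2 [c10 c20 h]]].
apply: (@le_lt_trans _ _ c2%:E); last by rewrite ltry.
apply: upper_content_le; near=> eps.
have eps0 : 0 < eps by near: eps; exact: nbhs_right_gt.
apply: content_ratio_le => //.
have [_ //] : ((c1 * eps `^ (2 - d))%:E <= area (tube A eps))%E /\
    (area (tube A eps) <= (c2 * eps `^ (2 - d))%:E)%E by near: eps.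
Unshelve. all: by end_near. Qed.

Lemma ereal_inf_ray (P : R -> Prop) d : 0 <= d -> (forall s, d < s -> P s) ->
  (forall s, s <= d -> ~ P s) ->
  ereal_inf [set s%:E | s in [set s | 0 <= s /\ P s]] = d%:E.
Proof.
move=> d0 hP hN; apply/eqP; rewrite eq_le; apply/andP; split.
  apply/lee_addgt0Pr => e e0; apply: ge_ereal_inf; exists (d + e)%:E => //.
  have de : d < d + e by rewrite ltrDl.
  by exists (d + e) => //; split; [rewrite (le_trans d0)// ltW|exact: hP].
apply: le_ereal_inf_tmp => _ [s [s0 Ps] <-]; rewrite lee_fin leNgt.
by apply/negP => /ltW /hN.
Qed.

(** Since eps^(2-d) = eps^(s-d) eps^(2-s), the contents of order s vanish above
    d and are positive up to d. *)
Lemma tube_order_box_dim A d : 0 <= d -> tube_order A d -> has_box_dim A d.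
Proof.
move=> d0 h; split; apply: ereal_inf_ray => // s.
- move=> ds; apply/eqP; rewrite eq_le lower_content_ge0 andbT.
  by rewrite -(tube_order_upper h ds) lower_le_upper_content.
- by move=> sd E; have := tube_order_lower h sd; rewrite E ltxx.
- by move=> ds; exact: tube_order_upper h ds.
- move=> sd E; have := lt_le_trans (tube_order_lower h sd) (lower_le_upper_content s A).
  by rewrite E ltxx.
Qed.

Lemma tube_order_nondegenerate A d : 0 <= d -> tube_order A d ->
  minkowski_nondegenerate A.
Proof.
move=> d0 h; exists d; split => //; split; first exact: tube_order_lower h _.
by split; [exact: lower_le_upper_content|exact: tube_order_upper_fin h].
Qed.

Definition tube_asymptotic A d c := forall e, 0 < e ->
  \forall eps \near 0^'+, (((c - e) * eps `^ (2 - d))%:E <= area (tube A eps))%E /\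
    (area (tube A eps) <= ((c + e) * eps `^ (2 - d))%:E)%E.

Lemma tube_asymptotic_content A d c : tube_asymptotic A d c -> has_content d A c%:E.
Proof.
move=> h.
have lo : (c%:E <= lower_content d A)%E.
  apply/lee_subgt0Pr => e e0; apply: lower_content_ge; near=> eps.
  have eps0 : 0 < eps by near: eps; exact: nbhs_right_gt.
  apply: content_ratio_ge => //.
  by have [//] : (((c - e) * eps `^ (2 - d))%:E <= area (tube A eps))%E /\
    (area (tube A eps) <= ((c + e) * eps `^ (2 - d))%:E)%E by near: eps; exact: h.
have up : (upper_content d A <= c%:E)%E.
  apply/lee_addgt0Pr => e e0; apply: upper_content_le; near=> eps.
  have eps0 : 0 < eps by near: eps; exact: nbhs_right_gt.
  apply: content_ratio_le => //.
  by have [//] : (((c - e) * eps `^ (2 - d))%:E <= area (tube A eps))%E /\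
    (area (tube A eps) <= ((c + e) * eps `^ (2 - d))%:E)%E by near: eps; exact: h.
have lu := lower_le_upper_content d A.
split; apply/eqP; rewrite eq_le.
  by rewrite lo andbT (le_trans lu).
by rewrite up (le_trans lo).
Unshelve. all: by end_near. Qed.

Lemma tube_asymptotic_order A d c : 0 < c -> tube_asymptotic A d c -> tube_order A d.
Proof.
move=> c0 /(_ (c / 2)) h; exists (c - c / 2), (c + c / 2); split; [lra|lra|].
by apply: h; lra.
Qed.

End Content.

(** * Tubes of spirals *)

Section RayBounds.
Variable R : realType.
Local Notation mu := (@lebesgue_measure R).
Implicit Types (E : set (R * R)%type) (e : (R * R)%type).

Lemma integral_id_indic (rho : R) : 0 <= rho ->
  (\int[mu]_r (Num.max r 0 * \1_`[0%R, rho] r)%:E = (rho ^+ 2 / 2)%:E)%E.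
Proof.
move=> rho0.
rewrite (_ : (fun r => _) = (fun r => (id r)%:E) \_ `[0%R, rho]); last first.
  apply/funext => r; rewrite /patch indicE; case: ifPn => [|_]; last by rewrite mulr0.
  by rewrite inE/= in_itv/= => /andP[r0 _]; rewrite max_l// mulr1.
rewrite -integral_mkcond.
have [->|rho1] := eqVneq rho 0.
  by rewrite set_itv1 integral_set1 expr0n mul0r.
have rho2 : 0 < rho by rewrite lt_neqAle eq_sym rho1.
rewrite (@continuous_FTC2 _ id (fun r => r ^+ 2 / 2))//.
- by rewrite expr0n /= mul0r sube0.
- by apply: continuous_subspaceT => x; exact: cvg_id.
- split.
  + by move=> x _; exact: ex_derive.
  + apply: cvg_at_right_filter; apply: cvgM; last exact: cvg_cst.
    exact: exprn_continuous.
  + apply: cvg_at_left_filter; apply: cvgM; last exact: cvg_cst.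
    exact: exprn_continuous.
- move=> x _; rewrite derive1E derive_val /= ?scaler0 ?addr0 ?add0r.
  by rewrite /GRing.scale/= ; field.
Qed.

Lemma integral_step (c a b : R) : 0 <= c -> 0 <= b ->
  (\int[mu]_r (c * \1_`]a - b, (a + b)[ r)%:E = (2 * b * c)%:E)%E.
Proof.
move=> c0 b0; under eq_integral do rewrite EFinM.
rewrite ge0_integralZl_EFin//=; last first.
  by apply/measurable_EFinP; apply: measurable_indic; exact: measurable_itv.
rewrite integral_indic// setIT [X in (_ * X)%E](_ : _ = (2 * b)%:E); last first.
  rewrite [LHS](@lebesgue_measure_itv R) /= lte_fin.
  case: ifPn => [ab|]; first by rewrite -EFinB; congr EFin; ring.
  by rewrite -leNgt => ab; congr EFin; lra.
by rewrite -EFinM mulrC.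
Qed.

Lemma integral_step_sum n (c a b : nat -> R) :
  (forall k, (k < n)%N -> 0 <= c k) -> (forall k, (k < n)%N -> 0 <= b k) ->
  (\int[mu]_r (\sum_(k < n) c k * \1_`](a k - b k)%R, (a k + b k)%R[ r)%:E =
   (\sum_(k < n) 2 * b k * c k)%:E)%E.
Proof.
move=> c0 b0; under eq_integral do rewrite -sumEFin.
rewrite ge0_integral_sum//=.
- rewrite -sumEFin; apply: eq_bigr => k _; rewrite integral_step//.
  + exact: c0.
  + exact: b0.
- move=> k; apply/measurable_EFinP; apply: measurable_funM => //.
- by move=> k x _; rewrite lee_fin mulr_ge0 ?c0// indicE ler0n.
Qed.

(** On a ray, the tube of a spiral consists of a segment at the origin and of
    short intervals around the crossings a k. *)
Lemma ray_weight_le E e (rho : R) n (a b : nat -> R) : measurable E -> 0 <= rho ->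
  (forall k, (k < n)%N -> 0 <= a k) -> (forall k, (k < n)%N -> 0 <= b k) ->
  (forall r, 0 < r -> E (r * e.1, r * e.2) ->
     r <= rho \/ exists2 k, (k < n)%N & `|r - a k| < b k) ->
  (ray_weight E e <= (rho ^+ 2 / 2 + \sum_(k < n) 2 * b k * (a k + b k))%:E)%E.
Proof.
move=> mE rho0 a0 b0 cover.
rewrite EFinD -integral_id_indic// -(@integral_step_sum n (a \+ b) a b)//; last first.
  by move=> k kn /=; rewrite addr_ge0 ?a0 ?b0.
have m1 : measurable_fun setT (fun r : R => (Num.max r 0 * \1_`[0%R, rho] r)%:E).
  apply/measurable_EFinP; apply: measurable_funM; first exact: measurable_maxr.
  by apply: measurable_indic; exact: measurable_itv.
have m2 : measurable_fun setT (fun r : R => (\sum_(k < n) (a \+ b) k * \1_`](a k - b k)%R, (a k + b k)%R[ r)%:E).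
  apply/measurable_EFinP; apply: measurable_sum => k; exact: measurable_funM.
have p1 (r : R) : 0 <= Num.max r 0 * \1_`[0%R, rho] r.
  by rewrite mulr_ge0 ?indicE ?ler0n// le_max lexx orbT.
have p2k (r : R) (k : 'I_n) : 0 <= (a \+ b) k * \1_`](a k - b k)%R, (a k + b k)%R[ r.
  by rewrite mulr_ge0 ?indicE ?ler0n// addr_ge0 ?a0 ?b0.
have p2 (r : R) : 0 <= \sum_(k < n) (a \+ b) k * \1_`](a k - b k)%R, (a k + b k)%R[ r.
  by apply: sumr_ge0 => k _; exact: p2k.
rewrite -ge0_integralD//; [|by move=> r _; rewrite lee_fin p1|by move=> r _; rewrite lee_fin p2].
apply: ge0_le_integral => //.
- by move=> r _; rewrite lee_fin mulr_ge0 ?indicE ?ler0n// le_max lexx orbT.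
- exact: measurable_ray_integrand.
- exact: emeasurable_funD.
move=> r _; rewrite -EFinD lee_fin.
have [r0|r0] := leP r 0; first by rewrite mul0r addr_ge0.
rewrite [\1_E _]indicE.
case: (boolP (_ \in E)) => [|_]; last by rewrite mulr0 addr_ge0 ?p2// mulr_ge0 ?(ltW r0) ?indicE ?ler0n.
rewrite inE mulr1 => /(cover _ r0)[rrho|[k kn rk]].
  rewrite indicE mem_set ?mulr1 ?lerDl ?p2//.
  by rewrite /= in_itv/= rrho ltW.
apply: (@le_trans _ _ (\sum_(k < n) (a \+ b) k * \1_`](a k - b k)%R, (a k + b k)%R[ r)); last first.
  by rewrite lerDr mulr_ge0 ?(ltW r0) ?indicE ?ler0n.
rewrite (bigD1 (Ordinal kn))//= indicE mem_set ?mulr1; last first.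
  by move: rk; rewrite ltr_norml /= in_itv/=; lra.
have : r <= a k + b k by move: rk; rewrite ltr_norml; lra.
move/le_trans; apply; rewrite lerDl; apply: sumr_ge0 => i _; exact: p2k.
Qed.

Lemma ray_weight_ge E e (rho : R) n (a : nat -> R) b : measurable E ->
  0 <= rho -> 0 <= b ->
  (forall r, 0 < r -> r <= rho -> E (r * e.1, r * e.2)) ->
  (forall r k, 0 < r -> (k < n)%N -> `|r - a k| < b -> E (r * e.1, r * e.2)) ->
  (forall k, (k < n)%N -> rho <= a k - b) ->
  (forall j k, (j < k < n)%N -> a k + b <= a j - b) ->
  ((rho ^+ 2 / 2 + \sum_(k < n) 2 * b * (a k - b))%:E <= ray_weight E e)%E.
Proof.
move=> mE rho0 b0 E0 Ek rhoa dis.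
have c0 k : (k < n)%N -> 0 <= a k - b by move=> kn; rewrite (le_trans rho0)// rhoa.
rewrite EFinD -integral_id_indic// -(@integral_step_sum n (fun k => a k - b) a (fun=> b))//.
have m1 : measurable_fun setT (fun r : R => (Num.max r 0 * \1_`[0%R, rho] r)%:E).
  apply/measurable_EFinP; apply: measurable_funM; first exact: measurable_maxr.
  by apply: measurable_indic; exact: measurable_itv.
have m2 : measurable_fun setT (fun r : R => (\sum_(k < n) (a k - b) * \1_`](a k - b)%R, (a k + b)%R[ r)%:E).
  apply/measurable_EFinP; apply: measurable_sum => k; exact: measurable_funM.
have p1 (r : R) : 0 <= Num.max r 0 * \1_`[0%R, rho] r.
  by rewrite mulr_ge0 ?indicE ?ler0n// le_max lexx orbT.
have p2 (r : R) : 0 <= \sum_(k < n) (a k - b) * \1_`](a k - b)%R, (a k + b)%R[ r.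
  by apply: sumr_ge0 => k _; rewrite mulr_ge0 ?c0// indicE ler0n.
rewrite -ge0_integralD//; [|by move=> r _; rewrite lee_fin p1|by move=> r _; rewrite lee_fin p2].
apply: ge0_le_integral => //.
- by move=> r _; rewrite adde_ge0// lee_fin ?p1 ?p2.
- exact: emeasurable_funD.
- exact: measurable_ray_integrand.
move=> r _; rewrite -EFinD lee_fin.
have [r0|r0] := leP r 0.
  rewrite !mul0r add0r big1// => k _.
  rewrite indicE memNset ?mulr0//= in_itv/= => /andP[+ _].
  by move=> /lt_le_trans/(_ r0); rewrite ltNge c0.
rewrite [X in _ <= _ * X]indicE.
have [rrho|rrho] := leP r rho.
  rewrite mem_set ?mulr1; last exact: E0.
  rewrite [X in _ + X]big1 ?addr0.
    by rewrite ler_piMr ?(ltW r0)// indicE lern1 leq_b1.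
  move=> k _; rewrite indicE memNset ?mulr0//= in_itv/= => /andP[+ _].
  by move=> /lt_le_trans/(_ rrho); rewrite ltNge rhoa.
rewrite indicE memNset ?mulr0 ?add0r; last by rewrite /= in_itv/= => /andP[_]; rewrite leNgt rrho.
have [[k kn rk]|no] := pselect (exists2 k, (k < n)%N & `|r - a k| < b); last first.
  rewrite big1 ?mulr_ge0 ?(ltW r0) ?ler0n//.
  move=> k _; rewrite indicE memNset ?mulr0//= in_itv/= => rk.
  by apply: no; exists k => //; rewrite ltr_norml; move: rk; lra.
rewrite mem_set ?mulr1; last exact: (Ek _ k).
rewrite (bigD1 (Ordinal kn))//= indicE mem_set; last first.
  by move: rk; rewrite ltr_norml /= in_itv/=; lra.
rewrite big1 ?addr0 ?mulr1; first by move: rk; rewrite ltr_norml; lra.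
move=> i; rewrite -val_eqE/= => ik.
rewrite indicE memNset ?mulr0//= in_itv/= => ri.
move: rk; rewrite ltr_norml; case: (ltngtP i k) ik => // ik _ rk.
  by have := dis i k; rewrite ik kn => /(_ isT); lra.
by have := dis k i; rewrite ik ltn_ord => /(_ isT); lra.
Qed.
End RayBounds.

Section PowerDecay.
Variable R : realType.
Implicit Types x al : R.

Lemma powR_oneB x al : 0 < x -> x `^ (1 - al) = x * x `^ (- al).
Proof.
by move=> x0; rewrite powRD ?powRr1 ?(ltW x0)// (gt_eqF x0) implybT.
Qed.

Lemma powRN_scale x al (l : R) : 0 < x -> 0 <= al <= 1 -> 1 <= l ->
  x `^ (- al) / l <= (l * x) `^ (- al).
Proof.
move=> x0 /andP[al0 al1] l1; have l0 : 0 < l by exact: lt_le_trans l1.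
rewrite powRM ?(ltW x0) ?(ltW l0)// mulrC ler_wpM2r ?powR_ge0//.
by rewrite powRN lef_pV2 ?posrE ?powR_gt0// ler1_powR.
Qed.

Lemma near_powR_ge (p M : R) : 0 < p -> \forall x \near +oo, M <= x `^ p.
Proof.
move=> p0; near=> x.
have [M0|M0] := leP M 0; first by rewrite (le_trans M0)// powR_ge0.
have -> : M = (M `^ p^-1) `^ p by rewrite -powRrM mulVf ?gt_eqF// powRr1 ?ltW.
have xM : M `^ p^-1 <= x by near: x; apply: nbhs_pinfty_ge; rewrite num_real.
apply: ge0_ler_powR; rewrite ?nnegrE ?(ltW p0)// ?powR_ge0//.
Unshelve. all: by end_near. Qed.

Lemma near_powRN_le (p M : R) : 0 < p -> 0 < M -> \forall x \near +oo, x `^ (- p) <= M.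
Proof.
move=> p0 M0; near=> x.
have x0 : 0 < x by near: x; apply: nbhs_pinfty_gt; rewrite num_real.
rewrite powRN -[leRHS]invrK lef_pV2 ?posrE ?invr_gt0 ?powR_gt0//.
by near: x; exact: near_powR_ge.
Unshelve. all: by end_near. Qed.

End PowerDecay.

Section Spiral.
Variable R : realType.
Implicit Types (rad : R -> R) (sg al c : R).

(** The radius is equivalent to c t^(-al) and its derivative to - al c
    t^(-al-1). The derivative enters through increments over at most one turn,
    which makes sense for a radius known only through a parametrization. *)
Definition decaying_radius rad al c :=
  (forall d, 0 < d -> \forall t \near +oo,
    (1 - d) * (c * t `^ (- al)) <= rad t <= (1 + d) * (c * t `^ (- al))) /\
  (forall d, 0 < d -> \forall t \near +oo, forall u, t <= u <= t + 2 * pi ->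
    (1 - d) * (al * c * (t `^ (- al) / t)) * (u - t) <= rad t - rad u <=
    (1 + d) * (al * c * (t `^ (- al) / t)) * (u - t)).

Definition spiral rad sg t0 : set (R * R) :=
  [set (rad t * cos t, sg * (rad t * sin t)) | t in [set t | t0 <= t]].

(** Half the asymptotic distance between consecutive turns at the angle T. *)
Definition spiral_eps al c T : R := pi * al * c * (T `^ (- al) / T).
(** The leading term of ray_weight: the disc of radius c T^(-al) gives the
    summand 1 of (1 + al) / (1 - al) = 1 + 2 al / (1 - al), and the turns before
    T give the other one. *)
Definition spiral_main al c T : R :=
  (c * T `^ (- al)) ^+ 2 / 2 * ((1 + al) / (1 - al)).

Lemma spiral_tube_radial rad sg t0 eps t r : sg * sg = 1 ->
  t0 <= t -> `|r - rad t| < eps ->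
  tube (spiral rad sg t0) eps (r * cos t, r * (sg * sin t)).
Proof.
move=> sg2 t0t rt; exists (rad t * cos t, sg * (rad t * sin t)); first by exists t.
have eps0 : 0 < eps by apply: le_lt_trans rt.
rewrite edist_ltP//=.
have -> : (r * cos t - rad t * cos t) ^+ 2 +
   (r * (sg * sin t) - sg * (rad t * sin t)) ^+ 2 =
   (r - rad t) ^+ 2 * (cos t ^+ 2 + sg * sg * sin t ^+ 2) by ring.
rewrite sg2 mul1r cos2Dsin2 mulr1 -(real_normK (num_real (r - rad t))).
by rewrite ltr_pXn2r// nnegrE// ltW.
Qed.

(** The crossings at angles up to (1-d) T are at least 2 eps apart, so that
    their intervals are disjoint; beyond (1+d) T they are closer than 2 eps and
    cover the ray down to the origin. *)
Lemma spiral_ray_ge rad sg al c t0 d : sg * sg = 1 -> 0 < al < 1 -> 0 < c ->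
  decaying_radius rad al c -> 0 < d < 1 / 8 ->
  \forall T \near +oo, forall e, e.1 ^+ 2 + e.2 ^+ 2 = 1 ->
  (((1 - 6 * d) * spiral_main al c T)%:E <=
    ray_weight (tube (spiral rad sg t0) (spiral_eps al c T)) e)%E.
Proof.
move=> sg2 al01 c0 [rad_equiv rad_incr] /andP[d0 d8].
have /andP[al0 al1] := al01; have pi0 := pi_gt0 R.
have [Th [ThR H1]] := rad_equiv _ d0.
have [Th' [ThR' H2]] := rad_incr _ d0.
pose A := Num.max (Num.max t0 (2 * pi + 1)) (Num.max (Th + 1) (Th' + 1)).
have At0 : t0 <= A by rewrite /A !le_max lexx.
have Api : 2 * pi + 1 <= A by rewrite /A !le_max lexx ?orbT.
have ATh t : A <= t -> Th < t.
  by apply: lt_le_trans; rewrite (lt_le_trans _ (_ : Th + 1 <= A))// ?ltrDl// /A !le_max lexx ?orbT.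
have ATh' t : A <= t -> Th' < t.
  by apply: lt_le_trans; rewrite (lt_le_trans _ (_ : Th' + 1 <= A))// ?ltrDl// /A !le_max lexx ?orbT.
have A0 : 0 < A by clear - Api pi0; lra.
near=> T => e e1.
have TA : A + 2 * pi <= (1 - d) * T.
  rewrite -ler_pdivrMl; last by clear - d8; lra.
  by near: T; apply: nbhs_pinfty_ge; rewrite num_real.
have T2pi : 2 * pi <= d * T by rewrite -ler_pdivrMl//.
have Tal : (A + 2 * pi) `^ (1 - al) <= d * T `^ (1 - al).
  rewrite -ler_pdivrMl//.
  by near: T; apply: near_powR_ge; rewrite subr_gt0.
have T0 : 0 < T by clear - T2pi d0 pi0; nra.
have p0 : 0 < T `^ (- al) by exact: powR_gt0.
set eps := spiral_eps al c T.
have epsE : eps * T = pi * al * c * T `^ (- al) by rewrite /eps /spiral_eps; field; exact: lt0r_neq0.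
have eps0 : 0 < eps by rewrite /eps /spiral_eps !mulr_gt0// invr_gt0.
have epsd : eps <= d * (c * T `^ (- al)).
  rewrite -(ler_pM2r T0) epsE.
  have : pi * al <= d * T by clear - T2pi pi0 al0 al1; nra.
  have : 0 < c * T `^ (- al) by rewrite mulr_gt0.
  clear; nra.
have [||phi /andP[phi1 phi2] [eE1 eE2]] := @unit_angle_after R e.1 (sg * e.2) A.
- by rewrite exprMn [sg ^+ 2]sg2 mul1r.
- by clear - Api; lra.
have {eE2}eE2 : e.2 = sg * sin phi by rewrite -eE2 mulrA sg2 mul1r.
pose th k : R := phi + 2 * pi * k%:R.
(* th k are the angles at which the spiral crosses the ray *)
pose Rk k := rad (th k).
have thS k : th k.+1 = th k + 2 * pi by rewrite /th -natr1; ring.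
have thphi k : phi <= th k by rewrite lerDl !mulr_ge0// ltW.
have thA k : A <= th k by rewrite (le_trans (ltW phi1)).
have th0 k : 0 < th k by rewrite (lt_le_trans A0).
have le_th j k : (j <= k)%N -> th j <= th k.
  by move=> jk; rewrite lerD2l ler_wpM2l ?ler_nat// mulr_ge0// ltW.
have Pth0 k : 0 < (th k) `^ (- al) by exact: powR_gt0.
have gap k : (1 - d) * (al * c * ((th k) `^ (- al) / th k)) * (2 * pi) <= Rk k - Rk k.+1 <=
    (1 + d) * (al * c * ((th k) `^ (- al) / th k)) * (2 * pi).
  have := H2 (th k) (ATh' _ (thA k)) (th k.+1).
  have -> : th k.+1 - th k = 2 * pi by rewrite thS; ring.
  by apply; rewrite thS lexx andbT lerDl; clear - pi0; lra.
have Rk1 k : (1 - d) * (c * (th k) `^ (- al)) <= Rk k by have /andP[] := H1 _ (ATh _ (thA k)).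
have Rk2 k : Rk k <= (1 + d) * (c * (th k) `^ (- al)) by have /andP[] := H1 _ (ATh _ (thA k)).
have RkS k : Rk k.+1 <= Rk k.
  rewrite -subr_ge0; have /andP[+ _] := gap k; apply: le_trans.
  rewrite !mulr_ge0 ?invr_ge0// ?(ltW al0) ?(ltW c0) ?(ltW (th0 k)) ?(ltW (Pth0 k))//; clear - d8 pi0; lra.
have le_Rk j k : (j <= k)%N -> Rk k <= Rk j.
  move=> /subnKC <-; elim: (k - j)%N => [|m IH]; first by rewrite addn0.
  by rewrite addnS (le_trans (RkS _)).
have [||n' /andP[n1 n2]] := @progression_floor R phi (2 * pi) ((1 - d) * T); [by clear - pi0; lra|by clear - TA phi2; lra|].
have [||K' /andP[K1 K2]] := @progression_floor R phi (2 * pi) ((1 + d) * T); [by clear - pi0; lra|by clear - TA phi2 d0 T0; nra|].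
pose n := n'.+1; pose K := K'.+1.
have thn : (1 - d) * T < th n by [].
have thn' k : (k < n)%N -> th k <= (1 - d) * T.
  by rewrite ltnS => /le_th/le_trans; apply.
have thK : (1 + d) * T < th K by [].
have thK' : th K <= (1 + 2 * d) * T by rewrite /K thS; move: K1; rewrite -/(th K'); clear - T2pi; lra.
have thKk k : (K <= k)%N -> (1 + d) * T < th k by move=> /le_th; exact: lt_le_trans.
have nK k : (k < n)%N -> (k < K)%N.
  move=> kn; rewrite ltnNge; apply/negP => /thKk; rewrite ltNge (le_trans (thn' _ kn))//; clear - d0 T0; nra.
have gap_small k : (K <= k)%N -> Rk k - Rk k.+1 < 2 * eps.
  move=> kK; have /andP[_ g2] := gap k; apply: (le_lt_trans g2).
  rewrite -subr_gt0; set y := th k; set q := y `^ (- al).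
  have qp : q <= T `^ (- al).
    by apply: powRN_ge; rewrite ?(ltW al0)//; move: (thKk _ kK); rewrite -/y; clear - d0 T0; nra.
  have y1 : (1 + d) * T < y by exact: thKk.
  have y0 : 0 < y by exact: th0.
  have q0 : 0 < q by exact: Pth0.
  have -> : 2 * eps - (1 + d) * (al * c * (q / y)) * (2 * pi) =
    (2 * pi * (al * c)) * ((T `^ (- al) * y - (1 + d) * T * q) / (T * y)).
    by rewrite /eps /spiral_eps; field; rewrite !lt0r_neq0.
  rewrite mulr_gt0 ?divr_gt0 ?mulr_gt0// subr_gt0.
  by apply: (@le_lt_trans _ _ ((1 + d) * T * T `^ (- al))); [rewrite ler_wpM2l//; clear - d0 T0; nra|rewrite mulrC ltr_pM2l].
have gap_big k : (k < n)%N -> 2 * eps <= Rk k - Rk k.+1.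
  move=> kn; have /andP[g1 _] := gap k; apply: (le_trans _ g1).
  rewrite -subr_ge0; set y := th k; set q := y `^ (- al).
  have y1 : y <= (1 - d) * T by exact: thn'.
  have y0 : 0 < y by exact: th0.
  have qp : T `^ (- al) <= q.
    by apply: powRN_ge; rewrite ?(ltW al0)//; clear - y1 d0 T0; nra.
  have q0 : 0 < q by exact: Pth0.
  have -> : (1 - d) * (al * c * (q / y)) * (2 * pi) - 2 * eps =
    (2 * pi * (al * c)) * (((1 - d) * T * q - T `^ (- al) * y) / (T * y)).
    by rewrite /eps /spiral_eps; field; rewrite !lt0r_neq0.
  rewrite mulr_ge0 ?divr_ge0 ?mulr_ge0 ?(ltW pi0) ?(ltW al0) ?(ltW c0) ?(ltW T0) ?(ltW y0)// subr_ge0.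
  apply: (@le_trans _ _ (T `^ (- al) * ((1 - d) * T))); first by rewrite ler_wpM2l// ltW.
  by rewrite mulrC ler_wpM2l//; clear - d8 T0; nra.
have etube k r : `|r - Rk k| < eps -> tube (spiral rad sg t0) eps (r * e.1, r * e.2).
  move=> rk; have := @spiral_tube_radial rad sg t0 eps (th k) r sg2 (le_trans At0 (thA k)) rk.
  by rewrite /th cosD2piMn sinD2piMn eE1 eE2.
pose rho := Rk K.
have rho_ge : (1 - 3 * d) * (c * T `^ (- al)) <= rho.
  apply: le_trans (Rk1 K).
  have : T `^ (- al) / (1 + 2 * d) <= (th K) `^ (- al).
    apply: le_trans (@powRN_scale _ T al (1 + 2 * d) T0 _ _) _; [by rewrite !ltW|by clear - d0; lra|].
    by apply: powRN_ge; rewrite ?(ltW al0).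
  rewrite ler_pdivrMr; last by clear - d0; lra.
  move: ((th K) `^ (- al)) (Pth0 K) => q q0 qp.
  have : T `^ (- al) * (1 - 3 * d) <= q * (1 - d) by clear - qp q0 p0 d0 d8; nra.
  by move=> /(ler_wpM2l (ltW c0)); clear; lra.
have rho0 : 0 <= rho by apply: le_trans rho_ge; rewrite !mulr_ge0 ?(ltW c0) ?(ltW p0)//; clear - d8; lra.
have Rk_ge k : (k < n)%N -> (1 - 2 * d) * (c * (th k) `^ (- al)) <= Rk k - eps.
  move=> kn; have := Rk1 k.
  have : T `^ (- al) <= (th k) `^ (- al).
    by apply: powRN_ge => //; [rewrite (le_trans (thn' _ kn))//; clear - d0 T0; nra|exact: ltW].
  move=> /(ler_wpM2l (ltW c0))/(ler_wpM2l (ltW d0)).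
  move: epsd; clear; lra.
apply: le_trans (@ray_weight_ge _ _ _ rho n Rk eps _ rho0 (ltW eps0) _ _ _ _).
- rewrite lee_fin.
  have sumP : \sum_(k < n) 2 * eps * ((1 - 2 * d) * (c * (th k) `^ (- al))) <=
      \sum_(k < n) 2 * eps * (Rk k - eps).
    by apply: ler_sum => k _; rewrite ler_wpM2l ?Rk_ge// mulr_ge0// ltW.
  have sumE : \sum_(k < n) 2 * eps * ((1 - 2 * d) * (c * (th k) `^ (- al))) =
      2 * eps * (1 - 2 * d) * c * \sum_(k < n) (th k) `^ (- al).
    by rewrite mulr_sumr; apply: eq_bigr => k _; ring.
  have S1 : (1 - 2 * d) * (T * T `^ (- al)) <= (1 - al) * (2 * pi) * \sum_(k < n) (th k) `^ (- al).
    apply: le_trans (@sum_powR_ge R al phi (2 * pi) n al01 _ _); last 2 first.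
    + by clear - phi1 A0; lra.
    + by clear - pi0; lra.
    have t1 : phi `^ (1 - al) <= d * T `^ (1 - al).
      apply: le_trans Tal; apply: ge0_ler_powR; rewrite ?nnegrE ?subr_ge0 ?(ltW al1)//; clear - phi1 phi2 A0 pi0; lra.
    have t2 : ((1 - d) * T) `^ (1 - al) <= (th n) `^ (1 - al).
      apply: ge0_ler_powR; rewrite ?nnegrE ?subr_ge0 ?(ltW al1) ?(ltW (th0 n)) ?(ltW thn)//.
      by rewrite mulr_ge0 ?(ltW T0)//; clear - d8; lra.
    have dT0 : 0 < (1 - d) * T by rewrite mulr_gt0//; clear - d8; lra.
    have t3 : (1 - d) * (T * T `^ (- al)) <= ((1 - d) * T) `^ (1 - al).
      rewrite powR_oneB// mulrA ler_wpM2l ?(ltW dT0)//.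
      by apply: powRN_ge; rewrite ?(ltW al0)//; clear - d0 T0; nra.
    move: t1; rewrite (powR_oneB _ T0) -/(th n) => t1.
    clear - t1 t2 t3; lra.
  have r2 : (1 - 6 * d) * (c * T `^ (- al)) ^+ 2 <= rho ^+ 2.
    have : ((1 - 3 * d) * (c * T `^ (- al))) ^+ 2 <= rho ^+ 2.
      by rewrite ler_pXn2r// nnegrE !mulr_ge0 ?(ltW c0) ?(ltW p0)//; clear - d8; lra.
    apply: le_trans; rewrite [leRHS]exprMn ler_wpM2r ?sqr_ge0//; clear; nra.
  have a1 : 0 < 1 - al by clear - al1; lra.
  have S2 : (1 - 6 * d) * (c * T `^ (- al)) ^+ 2 * (al / (1 - al)) <=
      2 * eps * (1 - 2 * d) * c * \sum_(k < n) (th k) `^ (- al).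
    move: S1; rewrite -ler_pdivrMl; last by rewrite !mulr_gt0.
    have k0 : 0 <= 2 * eps * (1 - 2 * d) * c.
      have d2 : 0 <= 1 - 2 * d by clear - d8; lra.
      by apply: mulr_ge0 (ltW c0); apply: mulr_ge0 d2; apply: mulr_ge0 (ltW eps0).
    move=> /(ler_wpM2l k0); apply: le_trans.
    have -> : 2 * eps * (1 - 2 * d) * c * (((1 - al) * (2 * pi))^-1 * ((1 - 2 * d) * (T * T `^ (- al)))) =
      (1 - 2 * d) ^+ 2 * (c * T `^ (- al)) ^+ 2 * (al / (1 - al)).
      rewrite /eps /spiral_eps; move: (@pi R) pi0 => pi0 pi_gt0; field.
      by rewrite !lt0r_neq0.
    rewrite ler_wpM2r ?divr_ge0 ?(ltW al0) ?(ltW a1)// ler_wpM2r ?sqr_ge0//; clear - d0; nra.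
  have -> : (1 - 6 * d) * spiral_main al c T =
    (1 - 6 * d) * (c * T `^ (- al)) ^+ 2 / 2 + (1 - 6 * d) * (c * T `^ (- al)) ^+ 2 * (al / (1 - al)).
    by rewrite /spiral_main; field; exact: lt0r_neq0.
  by apply: lerD; [rewrite ler_wpM2r|apply: le_trans S2 _; rewrite -sumE].
- exact: measurable_tube.
- move=> r r0 rrho.
  have dd : 0 < 1 + d by clear - d0; lra.
  have M0 : 0 < r / (2 * (1 + d) * c) by rewrite divr_gt0// !mulr_gt0.
  have [X [XR HX]] := near_powRN_le al0 M0.
  have exm : exists m, Rk m < r.
    have [||m /andP[_ m2]] := @progression_floor R phi (2 * pi) (Num.max phi X); [by clear - pi0; lra|by rewrite le_max lexx|].
    exists m.+1; apply: le_lt_trans (Rk2 _) _.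
    have : (th m.+1) `^ (- al) <= r / (2 * (1 + d) * c).
      by apply: HX; rewrite (le_lt_trans _ m2)// le_max lexx orbT.
    rewrite ler_pdivlMr ?mulr_gt0//.
    by have := mulr_gt0 (mulr_gt0 dd c0) (Pth0 m.+1); clear; lra.
  case: (ex_minnP exm) => [[|m] mr mmin].
    by move: mr; rewrite ltNge (le_trans rrho)// le_Rk.
  have Km : (K <= m)%N.
    rewrite leqNgt; apply/negP => mK.
    by move: mr; rewrite ltNge (le_trans rrho)// le_Rk.
  have rm : r <= Rk m.
    by rewrite leNgt; apply/negP => /mmin; rewrite ltnn.
  have gm := gap_small _ Km.
  have [h|h] := ltP (Rk m - r) eps.
    apply: (etube m); rewrite distrC ger0_norm ?subr_ge0//.
  apply: (etube m.+1); rewrite ger0_norm ?subr_ge0 ?(ltW mr)//.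
  by clear - gm h; lra.
- by move=> r k _ _; exact: etube.
- move=> k kn; have := gap_big _ kn; have := le_Rk _ _ (nK _ kn); rewrite -/rho; clear - eps0; lra.
- move=> j k /andP[jk kn]; have := gap_big _ (ltn_trans jk kn); have := le_Rk _ _ jk; clear; lra.
Unshelve. all: by end_near. Qed.
End Spiral.

Section SpiralUpper.
Variable R : realType.
Implicit Types (rad : R -> R) (sg al c : R).

(** The left-hand side is the squared distance between points at radii r and q
    and at an angle eta, by the law of cosines. *)
Lemma chord_angle (r q eta eps : R) : 0 < eps -> 2 * eps < r ->
  `|eta| <= pi -> (r - q) ^+ 2 + 2 * r * q * (1 - cos eta) < eps ^+ 2 ->
  0 <= q -> `|r - q| < eps /\ `|eta| * q <= 3 * eps.
Proof.
move=> e0 re etapi h q0.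
have c1 : cos eta <= 1 by exact: cos_le1.
have rq2 : (r - q) ^+ 2 < eps ^+ 2.
  by apply: le_lt_trans h; rewrite lerDl !mulr_ge0//; clear - e0 re c1; lra.
have rq : `|r - q| < eps.
  by move: rq2; rewrite -(real_normK (num_real (r - q))) ltr_pXn2r// nnegrE// ltW.
split=> //; move: rq; rewrite ltr_norml => /andP[rq1 rq3].
have rqe : 2 * eps ^+ 2 <= r * q by clear - e0 re rq1 rq3; nra.
have h2 : 2 * r * q * (1 - cos eta) < eps ^+ 2.
  by apply: le_lt_trans h; rewrite lerDr sqr_ge0.
have chalf : 1 / 2 <= cos eta by clear - h2 rqe e0; nra.
have e8 := sqr_le_1Bcos etapi chalf.
have : (`|eta| * q) ^+ 2 <= (3 * eps) ^+ 2.
  rewrite exprMn real_normK ?num_real//.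
  have q32 : q <= 3 / 2 * r by clear - rq3 re rq1; lra.
  have : eta ^+ 2 * q ^+ 2 <= 8 * (1 - cos eta) * q ^+ 2 by rewrite ler_wpM2r ?sqr_ge0.
  have : (1 - cos eta) * q ^+ 2 <= (1 - cos eta) * (3 / 2 * r * q).
    by rewrite ler_wpM2l ?subr_ge0// expr2 ler_wpM2r.
  clear - h2 e0; nra.
by rewrite ler_pXn2r// nnegrE ?mulr_ge0// ltW.
Qed.

Lemma nearest_angle (phi t : R) : phi <= t -> exists k : nat,
  `|t - (phi + 2 * pi * k%:R)| <= pi.
Proof.
move=> pt; have pi0 := pi_gt0 R.
have [||k /andP[k1 k2]] := @progression_floor R phi (2 * pi) (t + pi).
- by clear - pi0; lra.
- by clear - pt pi0; lra.
exists k; rewrite ler_norml; move: k2; rewrite -natr1 => k2.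
by apply/andP; split; clear - k1 k2; lra.
Qed.

(** A point of the ray within eps of the spiral is near some spiral point of
    angle t; the nearest crossing th satisfies |t - th| = O(eps / rad t), and
    moving from t to th changes the radius by O(al rad t / t |t - th|) = O(eps /
    th) only. *)
Lemma spiral_tube_ray rad sg al c A t0 phi eps r :
  sg * sg = 1 -> 0 < al < 1 -> 0 < c -> 2 * pi + 1 <= A -> A + 2 * pi <= t0 ->
  (forall t, A <= t -> 1 / 2 * (c * t `^ (- al)) <= rad t) ->
  (forall t, A <= t -> forall u, t <= u <= t + 2 * pi ->
    0 <= rad t - rad u <= 3 / 2 * (al * c * (t `^ (- al) / t)) * (u - t)) ->
  t0 - 2 * pi < phi <= t0 -> 0 < eps -> 2 * eps < r ->
  tube (spiral rad sg t0) eps (r * cos phi, r * (sg * sin phi)) ->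
  exists t k, let th := phi + 2 * pi * k%:R in
    [/\ t0 <= t, th <= t + pi, `|r - rad t| < eps &
       `|r - rad th| < eps * (1 + 36 / th)].
Proof.
move=> sg2 /andP[al0 al1] c0 Api At0 radge radinc /andP[phi1 phi2] e0 re.
have pi0 := pi_gt0 R.
move=> [_ [t /= t0t <-]]; rewrite edist_ltP//= => dist.
have [|k tk] := @nearest_angle phi t; first exact: le_trans t0t.
pose th := phi + 2 * pi * k%:R; exists t, k; rewrite -/th.
have At : A <= t by clear - At0 t0t pi0; lra.
have Ath : A <= th by rewrite (@le_trans _ _ phi)// ?lerDl ?mulr_ge0 ?(ltW pi0)//; clear - phi1 At0; lra.
have t1 : 0 < t by clear - At Api pi0; lra.
have th1 : 0 < th by clear - Ath Api pi0; lra.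
have q0 : 0 <= rad t by rewrite (le_trans _ (radge _ At))// !mulr_ge0 ?(ltW c0) ?powR_ge0.
have tkpi : `|t - th| <= pi by [].
have [rq etaq] : `|r - rad t| < eps /\ `|t - th| * rad t <= 3 * eps.
  apply: chord_angle => //.
  have -> : cos (t - th) = cos (t - phi).
    rewrite -(@cosD2piMn R (t - th) k); congr cos; rewrite /th; ring.
  rewrite cosB.
  apply: le_lt_trans dist.
  have -> : (r - rad t) ^+ 2 + 2 * r * rad t * (1 - (cos t * cos phi + sin t * sin phi)) =
    r ^+ 2 * (cos phi ^+ 2 + sin phi ^+ 2) + (rad t) ^+ 2 * (cos t ^+ 2 + sin t ^+ 2)
      - 2 * r * rad t * (cos t * cos phi + sin t * sin phi).
    by rewrite !cos2Dsin2; ring.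
  have -> : (r * cos phi - rad t * cos t) ^+ 2 + (r * (sg * sin phi) - sg * (rad t * sin t)) ^+ 2 =
    (r * cos phi - rad t * cos t) ^+ 2 + (sg * sg) * (r * sin phi - rad t * sin t) ^+ 2 by ring.
  by rewrite sg2 le_eqVlt; apply/orP; left; apply/eqP; ring.
split => //.
  by move: tkpi; rewrite ler_norml; clear; lra.
have rth : `|rad t - rad th| <= 36 * eps / th.
  pose m := Num.min t th.
  have mt : t / 2 <= m.
    by rewrite /m le_min; move: tkpi; rewrite ler_norml => H; apply/andP; split; clear - H At Api pi0; lra.
  have mth : th / 2 <= m.
    by rewrite /m le_min; move: tkpi; rewrite ler_norml => H; apply/andP; split; clear - H Ath Api pi0; lra.
  have m0 : 0 < m by apply: lt_le_trans mt; rewrite divr_gt0.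
  have Am : A <= m by rewrite /m le_min At.
  have inc : `|rad t - rad th| <= 3 / 2 * (al * c * (m `^ (- al) / m)) * `|t - th|.
    have [tth|tth] := leP t th.
      have := radinc t At th; rewrite tth => /(_ _)/andP[|i1 i2].
        by move: tkpi; rewrite ler_norml; clear - pi0; lra.
      by rewrite ger0_norm// ler0_norm ?subr_le0// opprB /m (min_idPl tth).
    have := radinc th Ath t; rewrite (ltW tth) => /(_ _)/andP[|i1 i2].
      by move: tkpi; rewrite ler_norml; clear - pi0; lra.
    by rewrite distrC ger0_norm// ger0_norm ?subr_ge0 ?(ltW tth)// /m (min_idPr (ltW tth)).
  apply: (le_trans inc).
  have Pm : m `^ (- al) <= 2 * t `^ (- al).
    apply: (@le_trans _ _ ((t / 2) `^ (- al))).
      by apply: powRN_ge; rewrite ?(ltW al0)// divr_gt0.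
    have := @powRN_scale R (t / 2) al 2.
    have -> : 2 * (t / 2) = t by field.
    rewrite ler_pdivrMr// (mulrC 2).
    by apply; [rewrite divr_gt0|rewrite !ltW|clear; lra].
  have im : m^-1 <= 2 / th.
    rewrite -[2 / th]invrK lef_pV2 ?posrE ?invr_gt0 ?divr_gt0//.
    by rewrite invfM invrK mulrC.
  have ct : `|t - th| * (c * t `^ (- al)) <= 6 * eps.
    have := ler_wpM2l (normr_ge0 (t - th)) (radge _ At).
    by clear - etaq; lra.
  have P0 : 0 <= m `^ (- al) by exact: powR_ge0.
  have im0 : 0 <= m^-1 by rewrite invr_ge0 ltW.
  have step : m `^ (- al) / m <= 2 * t `^ (- al) * (2 / th) by exact: ler_pM.
  have -> : 36 * eps / th = 3 / 2 * (4 / th) * (6 * eps) by field; exact: lt0r_neq0.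
  apply: (@le_trans _ _ (3 / 2 * (4 / th) * (`|t - th| * (c * t `^ (- al))))); last first.
    by rewrite ler_wpM2l// ltW// mulr_gt0// divr_gt0.
  have -> : 3 / 2 * (al * c * (m `^ (- al) / m)) * `|t - th| =
    (3 / 2 * c * `|t - th|) * (al * (m `^ (- al) / m)) by ring.
  have -> : 3 / 2 * (4 / th) * (`|t - th| * (c * t `^ (- al))) =
    (3 / 2 * c * `|t - th|) * (1 * (2 * t `^ (- al) * (2 / th))) by field; exact: lt0r_neq0.
  rewrite ler_wpM2l ?mulr_ge0 ?(ltW c0)// ler_pM ?mulr_ge0 ?(ltW al0) ?(ltW al1)//.
have -> : r - rad th = (r - rad t) + (rad t - rad th) by ring.
apply: le_lt_trans (ler_normD _ _) _.
have -> : eps * (1 + 36 / th) = eps + 36 * eps / th by field; exact: lt0r_neq0.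
exact: ltr_leD.
Qed.

Lemma sum_ltn_le (n n0 : nat) : \sum_(k < n) ((k < n0)%N%:R : R) <= n0%:R.
Proof.
suff -> : \sum_(k < n) ((k < n0)%N%:R : R) = (minn n n0)%:R by rewrite ler_nat geq_minr.
elim: n => [|n IH]; first by rewrite big_ord0 min0n.
rewrite big_ord_recr/= IH -natrD; congr (_%:R).
by case: (ltnP n n0) => h; lia.
Qed.

(** Apart from the segment of length (1+3d) c T^(-al), the tube meets the ray
    near crossings of angle at most T + pi. The first n0 of them, where the
    asymptotics of the radius are not yet accurate, contribute O(eps), which is
    negligible against eps T^(1-al). *)
Lemma spiral_ray_le rad sg al c : sg * sg = 1 -> 0 < al < 1 -> 0 < c ->
  decaying_radius rad al c ->
  \forall t0 \near +oo, forall d, 0 < d < 1 / 8 ->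
  \forall T \near +oo, forall e, e.1 ^+ 2 + e.2 ^+ 2 = 1 ->
  (ray_weight (tube (spiral rad sg t0) (spiral_eps al c T)) e <=
   ((1 + 9 * d) * spiral_main al c T)%:E)%E.
Proof.
move=> sg2 al01 c0 [rad_equiv rad_incr]; have /andP[al0 al1] := al01.
have pi0 := pi_gt0 R.
have onep : (1 : R) `^ (- al) = 1 by rewrite powR1.
have h0 : (0 : R) < 1 / 2 by rewrite divr_gt0.
have half1 : 1 - 1 / 2 = 1 / 2 :> R by field.
have half2 : 1 + 1 / 2 = 3 / 2 :> R by field.
have [B [BR HB]] := rad_equiv _ h0.
have [B' [BR' HB']] := rad_incr _ h0.
pose A := Num.max (2 * pi + 1) (Num.max (B + 1) (B' + 1)).
have Api : 2 * pi + 1 <= A by rewrite /A le_max lexx.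
have AB t : A <= t -> B < t.
  by apply: lt_le_trans; rewrite (lt_le_trans _ (_ : B + 1 <= A))// ?ltrDl// /A !le_max lexx ?orbT.
have AB' t : A <= t -> B' < t.
  by apply: lt_le_trans; rewrite (lt_le_trans _ (_ : B' + 1 <= A))// ?ltrDl// /A !le_max lexx ?orbT.
near=> t0 => d /andP[d0 d8].
have At0 : A + 2 * pi <= t0 by near: t0; apply: nbhs_pinfty_ge; rewrite num_real.
have [Th [ThR H1]] := rad_equiv _ d0.
pose n0 := (Num.truncn (Num.max `|Th| (36 / d))).+1.
pose M := 2 * (1 + d) * (1 + 2 * d) * c + 2960 * c * n0%:R.
near=> T => e e1.
have T0 : t0 <= T by near: T; apply: nbhs_pinfty_ge; rewrite num_real.
have TTh : Th < T by near: T; apply: nbhs_pinfty_gt; rewrite num_real.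
have T1 : 0 < T by clear - T0 At0 Api pi0; lra.
have T2pi : pi <= d / 4 * T.
  by rewrite -ler_pdivrMl ?divr_gt0//.
have TM : pi * M * (1 - al) / (d * c) <= T `^ (1 - al).
  by near: T; apply: near_powR_ge; rewrite subr_gt0.
have TM' : pi * M * (1 - al) <= d * c * (T * T `^ (- al)).
  by move: TM; rewrite ler_pdivrMr ?mulr_gt0// powR_oneB// (mulrC _ (d * c)).
pose p := T `^ (- al).
have p0 : 0 < p by exact: powR_gt0.
have [eps epsdef] : exists eps, eps = spiral_eps al c T by exists (spiral_eps al c T).
rewrite -epsdef.
have epsE : eps * T = pi * al * c * p by rewrite epsdef /spiral_eps /p; field; exact: lt0r_neq0.
have eps0 : 0 < eps by rewrite epsdef /spiral_eps !mulr_gt0// invr_gt0.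
have cp0 : 0 < c * p by exact: mulr_gt0.
have epsd : eps <= d / 4 * (c * p).
  rewrite -(ler_pM2r T1) epsE.
  have : pi * al <= d / 4 * T by clear - T2pi pi0 al0 al1; nra.
  by move=> /(ler_wpM2r (ltW cp0)); clear; lra.
have t0pi : 2 * pi <= t0 - 2 * pi by clear - At0 Api; lra.
have [||phi /andP[phi1 phi2] [eE1 eE2]] := @unit_angle_after R e.1 (sg * e.2) (t0 - 2 * pi).
- by rewrite exprMn [sg ^+ 2]sg2 mul1r.
- exact: t0pi.
have {}phi2 : phi <= t0 by clear - phi2; lra.
have {eE2}eE2 : e.2 = sg * sin phi by rewrite -eE2 mulrA sg2 mul1r.
pose th k : R := phi + 2 * pi * k%:R.
have thphi k : phi <= th k by rewrite lerDl !mulr_ge0// ltW.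
have phiA : A <= phi by clear - phi1 At0; lra.
have thA k : A <= th k by rewrite (le_trans phiA).
have th1 k : 1 <= th k by rewrite (le_trans _ (thA k))//; clear - Api pi0; lra.
have th0 k : 0 < th k by rewrite (lt_le_trans _ (th1 k)).
have Pth0 k : 0 < (th k) `^ (- al) by exact: powR_gt0.
have Pth1 k : (th k) `^ (- al) <= 1.
  by rewrite -[leRHS]onep powRN_ge// ltW.
have Rk0 k : 1 / 2 * (c * (th k) `^ (- al)) <= rad (th k) <= 3 / 2 * (c * (th k) `^ (- al)).
  by have := HB _ (AB _ (thA k)); rewrite half1 half2.
have radge t : A <= t -> 1 / 2 * (c * t `^ (- al)) <= rad t.
  by move=> /AB/HB/andP[+ _]; rewrite half1.
have radinc t : A <= t -> forall u, t <= u <= t + 2 * pi ->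
    0 <= rad t - rad u <= 3 / 2 * (al * c * (t `^ (- al) / t)) * (u - t).
  move=> At u tu; have := HB' _ (AB' _ At) u tu.
  rewrite half2 => /andP[i1 ->]; rewrite andbT (le_trans _ i1)//.
  have t1 : 0 < t by clear - At Api pi0; lra.
  rewrite !mulr_ge0 ?(ltW al0) ?(ltW c0) ?powR_ge0 ?invr_ge0 ?(ltW t1)//.
    by clear; lra.
  by move: tu => /andP[+ _]; rewrite subr_ge0.
have [||n' /andP[n1 n2]] := @progression_floor R phi (2 * pi) (T + pi).
- by clear - pi0; lra.
- by clear - phi2 T0 pi0; lra.
pose n := n'.+1.
have thn k : (k < n)%N -> th k <= T + pi.
  rewrite ltnS => kn; apply: le_trans n1.
  by rewrite lerD2l ler_wpM2l ?ler_nat// mulr_ge0// ltW.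
have lt_n k : th k <= T + pi -> (k < n)%N.
  move=> kT; have := le_lt_trans kT n2; rewrite ltrD2l ltr_pM2l ?mulr_gt0//.
  by rewrite ltr_nat.
pose rho := (1 + 3 * d) * (c * p).
have rho0 : 0 <= rho by rewrite mulr_ge0 ?(ltW cp0)//; clear - d0; lra.
pose b k := eps * (1 + 36 / th k).
have b0 k : 0 <= b k.
  by rewrite mulr_ge0 ?(ltW eps0)// addr_ge0// divr_ge0// ltW.
have a0 k : 0 <= rad (th k).
  have /andP[+ _] := Rk0 k; apply: le_trans.
  by rewrite !mulr_ge0 ?(ltW c0) ?(ltW (Pth0 k)).
apply: le_trans (@ray_weight_le _ _ _ rho n (rad \o th) b _ rho0 _ _ _) _.
- exact: measurable_tube.
- by move=> k _; exact: a0.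
- by move=> k _; exact: b0.
- move=> r r0; rewrite eE1 eE2 => rE; have [|rrho] := leP r rho; first by left.
  have re : 2 * eps < r.
    apply: le_lt_trans rrho; rewrite /rho.
    by clear - epsd d0 d8 cp0; nra.
  have phi12 : t0 - 2 * pi < phi <= t0 by rewrite phi1.
  have [t [k [t0t tk rt rk]]] := spiral_tube_ray sg2 al01 c0 Api At0 radge radinc phi12 eps0 re rE.
  right; exists k => //; apply: lt_n; apply: (le_trans tk); rewrite lerD2r leNgt.
  apply/negP => Tt.
  have /andP[_ rt2] := H1 _ (lt_trans TTh Tt).
  have Pt : t `^ (- al) <= p by apply: powRN_ge; rewrite ?ltW.
  have : rad t <= (1 + d) * (c * p).
    apply: (le_trans rt2); rewrite ler_wpM2l//; first by clear - d0; lra.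
    by rewrite ler_wpM2l// ltW.
  move: rt rrho; rewrite ltr_norml /rho; clear - epsd d0 cp0; nra.
rewrite lee_fin.
have dd : 0 <= 1 + d by clear - d0; lra.
have dd2 : 0 <= 1 + 2 * d by clear - d0; lra.
have term k : (k < n)%N -> 2 * b k * (rad (th k) + b k) <=
    2 * eps * (1 + d) * (1 + 2 * d) * c * (th k) `^ (- al) +
    eps * (2960 * c) * (k < n0)%N%:R.
  move=> kn; have /andP[_ rk] := Rk0 k.
  have [kn0|n0k] := ltnP k n0.
    have bk : b k <= 37 * eps.
      rewrite /b mulrC ler_wpM2r ?(ltW eps0)//.
      have : 36 / th k <= 36 by rewrite ler_pdivrMr// ler_peMr.
      by clear; lra.
    have rk2 : rad (th k) + b k <= 40 * c.
      have : c * (th k) `^ (- al) <= c by rewrite ler_piMr// ltW.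
      have : c * p <= c.
        rewrite ler_piMr ?(ltW c0)// -[leRHS]onep; apply: powRN_ge; rewrite ?(ltW al0)//.
      have : eps <= c * p.
        by apply: (le_trans epsd); rewrite ler_piMl ?(ltW cp0)//; clear - d8; lra.
      clear - rk bk c0; lra.
    apply: (@le_trans _ _ (2 * (37 * eps) * (40 * c))).
      apply: ler_pM => //; first by rewrite mulr_ge0.
      - by rewrite addr_ge0.
      - by rewrite ler_wpM2l.
    rewrite mulr1 -subr_ge0.
    have -> : 2 * eps * (1 + d) * (1 + 2 * d) * c * th k `^ (- al) + eps * (2960 * c) -
      2 * (37 * eps) * (40 * c) = 2 * eps * (1 + d) * (1 + 2 * d) * c * th k `^ (- al) by ring.
    by rewrite !mulr_ge0 ?(ltW eps0) ?(ltW c0) ?(ltW (Pth0 k)).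
  rewrite mulr0 addr0.
  have n0th : Num.max `|Th| (36 / d) < th k.
    rewrite (lt_le_trans (truncnS_gt _))// (@le_trans _ _ k%:R) ?ler_nat//.
    rewrite /th.
    have : (0 : R) <= k%:R by [].
    have := pi_ge2 R; clear - phiA Api pi0; nra.
  move: n0th; rewrite gt_max => /andP[Thk dk].
  have /andP[_ rk2] := H1 _ (le_lt_trans (ler_norm _) Thk).
  have bk : b k <= (1 + d) * eps.
    rewrite /b mulrC ler_wpM2r ?(ltW eps0)// lerD2l.
    by rewrite ler_pdivrMr// mulrC -ler_pdivrMr// ltW.
  have Pk : p <= 2 * (th k) `^ (- al).
    have := @powRN_scale R T al 2 T1.
    rewrite (ltW al0) (ltW al1) => /(_ isT)/(_ _)/le_trans => h.
    rewrite -ler_pdivrMl// mulrC; apply: h; first by clear; lra.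
    apply: powRN_ge; rewrite ?(ltW al0)// (le_trans (thn _ kn))//.
    by clear - T2pi d8 d0 T1; nra.
  have rk3 : rad (th k) + b k <= (1 + 2 * d) * (c * (th k) `^ (- al)).
    have h1 : c * p <= 2 * (c * (th k) `^ (- al)) by rewrite mulrCA ler_wpM2l// ltW.
    have h2 : d / 4 * (c * p) <= d / 4 * (2 * (c * (th k) `^ (- al))).
      by rewrite ler_wpM2l// divr_ge0// ltW.
    have h3 : (1 + d) * eps <= 2 * eps by rewrite ler_wpM2r ?(ltW eps0)//; clear - d8; lra.
    clear - rk2 bk epsd h2 h3; lra.
  have -> : 2 * eps * (1 + d) * (1 + 2 * d) * c * th k `^ (- al) =
    2 * ((1 + d) * eps) * ((1 + 2 * d) * (c * (th k) `^ (- al))) by ring.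
  apply: ler_pM => //; first by rewrite mulr_ge0.
  - by rewrite addr_ge0.
  - by rewrite ler_wpM2l.
have sum1 : \sum_(k < n) 2 * b k * ((rad \o th) k + b k) <=
    2 * eps * (1 + d) * (1 + 2 * d) * c * \sum_(k < n) (th k) `^ (- al) +
    eps * (2960 * c) * n0%:R.
  apply: (@le_trans _ _ (\sum_(k < n) (2 * eps * (1 + d) * (1 + 2 * d) * c * (th k) `^ (- al) +
    eps * (2960 * c) * (k < n0)%N%:R))).
    by apply: ler_sum => k _; exact: term.
  rewrite big_split lerD//=; first by rewrite mulr_sumr.
  have c29 : 0 <= 2960 * c by clear - c0; lra.
  have ec0 := mulr_ge0 (ltW eps0) c29.
  rewrite -mulr_sumr.
  exact: (ler_wpM2l ec0 (sum_ltn_le n n0)).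
have a1 : 0 < 1 - al by clear - al1; lra.
have S1 : (1 - al) * (2 * pi) * \sum_(k < n) (th k) `^ (- al) <=
    (1 - al) * (2 * pi) + (1 + d) * (T * p).
  have phi0 : 0 < phi by clear - phiA Api pi0; lra.
  apply: le_trans (@sum_powR_le R al phi (2 * pi) n' al01 phi0 _) _.
    by clear - pi0; lra.
  have P0 : phi `^ (- al) <= 1.
    by have := Pth1 0%N; rewrite /th mulr0 addr0.
  have e2 : (1 - al) * (2 * pi) * phi `^ (- al) <= (1 - al) * (2 * pi).
    by rewrite ler_piMr// mulr_ge0 ?(ltW a1)// mulr_ge0// ltW.
  have e3 : 0 <= phi `^ (1 - al) by exact: powR_ge0.
  have Tpi0 : 0 < T + pi by clear - T1 pi0; lra.
  have e4 : (phi + 2 * pi * n'%:R) `^ (1 - al) <= (T + pi) `^ (1 - al).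
    by apply: ge0_ler_powR; rewrite ?nnegrE ?(ltW a1) ?(ltW Tpi0) ?(ltW (th0 n'))// thn.
  have e5 : (T + pi) `^ (1 - al) <= (1 + d) * (T * p).
    rewrite powR_oneB// mulrA ler_pM ?(ltW Tpi0) ?powR_ge0//.
      by clear - T2pi d0 T1; nra.
    by apply: powRN_ge; rewrite ?(ltW al0)//; clear - pi0; lra.
  clear - e2 e3 e4 e5; lra.
have S2 : 2 * eps * (1 + d) * (1 + 2 * d) * c * \sum_(k < n) (th k) `^ (- al) <=
    2 * eps * (1 + d) * (1 + 2 * d) * c +
    (1 + d) ^+ 2 * (1 + 2 * d) * ((c * p) ^+ 2 * (al / (1 - al))).
  move: S1; rewrite -ler_pdivlMl ?mulr_gt0// => S1.
  have k0 : 0 <= 2 * eps * (1 + d) * (1 + 2 * d) * c.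
    by rewrite !mulr_ge0 ?(ltW eps0) ?(ltW c0).
  apply: (le_trans (ler_wpM2l k0 S1)).
  rewrite le_eqVlt; apply/orP; left; apply/eqP.
  rewrite epsdef /spiral_eps -/p; move: (@pi R) pi0 => pi0 pi_gt0; field.
  by rewrite !lt0r_neq0.
have S3 : eps * M <= d * ((c * p) ^+ 2 * (al / (1 - al))).
  rewrite -(ler_pM2r T1) -(ler_pM2r a1).
  have -> : eps * M * T * (1 - al) = al * (c * p) * (pi * M * (1 - al)).
    have -> : eps * M * T * (1 - al) = (eps * T) * (M * (1 - al)) by ring.
    by rewrite epsE; ring.
  have -> : d * ((c * p) ^+ 2 * (al / (1 - al))) * T * (1 - al) =
    al * (c * p) * (d * c * (T * p)) by field; exact: lt0r_neq0.
  by rewrite ler_wpM2l// mulr_ge0 ?(ltW al0)// ltW.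
have rho2 : rho ^+ 2 / 2 <= (1 + 9 * d) * ((c * p) ^+ 2 / 2).
  rewrite /rho exprMn -mulrA ler_wpM2r//; first by rewrite divr_ge0// sqr_ge0.
  by clear - d0 d8; nra.
have Q0 : 0 <= (c * p) ^+ 2 * (al / (1 - al)).
  by rewrite mulr_ge0 ?sqr_ge0// divr_ge0// ltW.
have S4 : (1 + d) ^+ 2 * (1 + 2 * d) * ((c * p) ^+ 2 * (al / (1 - al))) +
    d * ((c * p) ^+ 2 * (al / (1 - al))) <=
    (1 + 9 * d) * ((c * p) ^+ 2 * (al / (1 - al))).
  by rewrite -mulrDl ler_wpM2r//; clear - d0 d8; nra.
have -> : (1 + 9 * d) * spiral_main al c T =
    (1 + 9 * d) * ((c * p) ^+ 2 / 2) + (1 + 9 * d) * ((c * p) ^+ 2 * (al / (1 - al))).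
  by rewrite /spiral_main /p; field; exact: lt0r_neq0.
have ME : eps * M = 2 * eps * (1 + d) * (1 + 2 * d) * c + eps * (2960 * c) * n0%:R.
  by rewrite /M; ring.
clear - sum1 S2 S3 rho2 S4 ME; lra.
Unshelve. all: by end_near. Qed.

End SpiralUpper.

Section SpiralContent.
Variable R : realType.
Implicit Types (rad : R -> R) (sg al c eps : R).

(** The angle T with spiral_eps al c T = eps. *)
Definition spiral_time al c eps : R := (pi * al * c / eps) `^ (1 + al)^-1.

Lemma spiral_timeK al c eps : 0 < al -> 0 < c -> 0 < eps ->
  spiral_eps al c (spiral_time al c eps) = eps.
Proof.
move=> al0 c0 e0; have pi0 := pi_gt0 R.
have a1 : 0 < 1 + al by rewrite addr_gt0.
have k0 : 0 < pi * al * c by rewrite !mulr_gt0.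
have q0 : 0 < pi * al * c / eps by rewrite divr_gt0.
have T0 : 0 < spiral_time al c eps by exact: powR_gt0.
rewrite /spiral_eps -[X in _ / X](powRr1 (ltW T0)) -powRB ?(gt_eqF T0) ?implybT//.
rewrite /spiral_time -powRrM.
have -> : (1 + al)^-1 * (- al - 1) = -1 by field; exact: lt0r_neq0.
by rewrite powR_inv1 ?ltW// invf_div mulrCA divff ?mulr1// gt_eqF.
Qed.

Lemma near_spiral_time al c (Q : R -> Prop) : 0 < al -> 0 < c ->
  (\forall T \near +oo, Q T) -> \forall eps \near 0^'+, Q (spiral_time al c eps).
Proof.
move=> al0 c0 [X [XR HX]]; have pi0 := pi_gt0 R.
have a1 : 0 < 1 + al by rewrite addr_gt0.
have k0 : 0 < pi * al * c by rewrite !mulr_gt0.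
pose Y := Num.max X 1.
have Y0 : 0 < Y by rewrite /Y lt_max ltr01 orbT.
near=> eps.
have e0 : 0 < eps by near: eps; exact: nbhs_right_gt.
have eY : eps < pi * al * c / Y `^ (1 + al).
  by near: eps; apply: nbhs_right_lt; rewrite divr_gt0// powR_gt0.
apply: HX; apply: (@le_lt_trans _ _ Y); first by rewrite /Y le_max lexx.
have -> : Y = (Y `^ (1 + al)) `^ (1 + al)^-1.
  by rewrite -powRrM divff ?gt_eqF// powRr1// ltW.
rewrite /spiral_time; apply: gt0_ltr_powR; rewrite ?invr_gt0 ?nnegrE ?powR_ge0//.
  by rewrite divr_ge0 ?ltW.
by rewrite ltr_pdivlMr// mulrC -ltr_pdivlMr// powR_gt0.
Unshelve. all: by end_near. Qed.

Definition spiral_content al c : R :=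
  c `^ (2 / (1 + al)) * pi * (pi * al) `^ (- (2 * al / (1 + al))) *
  ((1 + al) / (1 - al)).

Lemma spiral_mainE al c eps : 0 < al < 1 -> 0 < c -> 0 < eps ->
  2 * pi * spiral_main al c (spiral_time al c eps) =
  spiral_content al c * eps `^ (2 - 2 / (1 + al)).
Proof.
move=> /andP[al0 al1] c0 e0; have pi0 := pi_gt0 R.
have a1 : 0 < 1 + al by rewrite addr_gt0.
have pa0 : 0 < pi * al by rewrite mulr_gt0.
pose be := 2 * al / (1 + al).
have -> : 2 - 2 / (1 + al) = be by rewrite /be; field; exact: lt0r_neq0.
rewrite /spiral_content /spiral_main.
have -> : 2 / (1 + al) = 2 - be by rewrite /be; field; exact: lt0r_neq0.
have -> : (c * spiral_time al c eps `^ (- al)) ^+ 2 =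
    c `^ (2 - be) * (pi * al) `^ (- be) * eps `^ be.
  have c0' := ltW c0; have e0' := ltW e0.
  rewrite exprMn -[in RHS](opprK be) (powRN eps).
  have -> : (spiral_time al c eps `^ (- al)) ^+ 2 = (pi * al * c / eps) `^ (- be).
    rewrite -powR_mulrn ?powR_ge0// /spiral_time -!powRrM; congr (_ `^ _).
    by rewrite /be; field; exact: lt0r_neq0.
  rewrite !powRM ?invr_ge0 ?(ltW pa0) ?(ltW c0) ?(ltW e0) ?mulr_ge0 ?(ltW pi0) ?(ltW al0)//.
  rewrite powRD ?(gt_eqF c0) ?implybT// (powR_mulrn 2)  ?(ltW c0)//.
  rewrite -(powR_inv1 (ltW e0)) -powRrM mulN1r opprK -powRN opprK.
  ring.
rewrite /be; have : 0 < 1 - al by rewrite subr_gt0.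
move=> b1; move: (@pi R) => p0; field; exact: lt0r_neq0.
Qed.

(** Letting eps tend to 0 amounts to letting T tend to infinity in the two ray
    estimates. *)
Theorem spiral_tube_asymptotic rad sg al c : sg * sg = 1 -> 0 < al < 1 -> 0 < c ->
  decaying_radius rad al c ->
  \forall t0 \near +oo,
    tube_asymptotic (spiral rad sg t0) (2 / (1 + al)) (spiral_content al c).
Proof.
move=> sg2 al01 c0 hr; have /andP[al0 al1] := al01; have pi0 := pi_gt0 R.
have C0 : 0 < spiral_content al c.
  have pa0 : 0 < pi * al by rewrite mulr_gt0.
  rewrite /spiral_content; apply: mulr_gt0; last by rewrite divr_gt0 ?subr_gt0 ?addr_gt0.
  by rewrite !mulr_gt0// powR_gt0.
near=> t0 => e e0.
pose d := Num.min (1 / 16) (e / (9 * spiral_content al c)).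
have d0 : 0 < d by rewrite lt_min; apply/andP; split; apply: divr_gt0 => //; exact: mulr_gt0.
have d8 : d < 1 / 8 by rewrite gt_min; apply/orP; left; clear; lra.
have d08 : 0 < d < 1 / 8 by rewrite d0.
have dC : 9 * d * spiral_content al c <= e.
  have : d <= e / (9 * spiral_content al c) by rewrite ge_min lexx orbT.
  by rewrite ler_pdivlMr; [clear; lra|exact: mulr_gt0].
have up : \forall T \near +oo, forall e, e.1 ^+ 2 + e.2 ^+ 2 = 1 ->
  (ray_weight (tube (spiral rad sg t0) (spiral_eps al c T)) e <=
   ((1 + 9 * d) * spiral_main al c T)%:E)%E.
  by move: d d08 {d0 d8 dC}; near: t0; exact: spiral_ray_le.
have lo := spiral_ray_ge t0 sg2 al01 c0 hr d08.
have /(near_spiral_time al0 c0) up' := up.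
have /(near_spiral_time al0 c0) lo' := lo.
near=> eps.
have eps0 : 0 < eps by near: eps; exact: nbhs_right_gt.
have mt : measurable (tube (spiral rad sg t0) eps) by exact: measurable_tube.
have p0 : 0 <= eps `^ (2 - 2 / (1 + al)) by exact: powR_ge0.
split.
- have lo2 : forall e, e.1 ^+ 2 + e.2 ^+ 2 = 1 ->
    (((1 - 6 * d) * spiral_main al c (spiral_time al c eps))%:E <=
    ray_weight (tube (spiral rad sg t0) (spiral_eps al c (spiral_time al c eps))) e)%E.
    by near: eps.
  rewrite spiral_timeK// in lo2.
  apply: le_trans (area_ge_rays mt _ lo2); last first.
    have d6 : 0 <= 1 - 6 * d by clear - d8; lra.
    apply: mulr_ge0 d6 _; apply: mulr_ge0; first by rewrite divr_ge0 ?sqr_ge0.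
    by apply: divr_ge0; rewrite ?subr_ge0 ?addr_ge0// ltW.
  have -> : 2 * pi * ((1 - 6 * d) * spiral_main al c (spiral_time al c eps)) =
    (1 - 6 * d) * (2 * pi * spiral_main al c (spiral_time al c eps)) by ring.
  rewrite spiral_mainE// mulrA lee_fin ler_wpM2r//.
  by clear - dC d0 C0; nra.
- have up2 : forall e, e.1 ^+ 2 + e.2 ^+ 2 = 1 ->
  (ray_weight (tube (spiral rad sg t0) (spiral_eps al c (spiral_time al c eps))) e <=
   ((1 + 9 * d) * spiral_main al c (spiral_time al c eps))%:E)%E.
    by near: eps.
  rewrite spiral_timeK// in up2.
  apply: le_trans (area_le_rays mt up2) _.
  have -> : 2 * pi * ((1 + 9 * d) * spiral_main al c (spiral_time al c eps)) =
    (1 + 9 * d) * (2 * pi * spiral_main al c (spiral_time al c eps)) by ring.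
  rewrite spiral_mainE// mulrA lee_fin ler_wpM2r//.
  by clear - dC; lra.
Unshelve. all: by end_near. Qed.

End SpiralContent.

(** * Tubes of chirps *)

Section Chirp.
Variable R : realType.
Local Notation mu := (@lebesgue_measure R).
Implicit Types (Z : R -> R) (al eps : R).

(** What the area estimates use of a function that oscillates at infinity with
    amplitude of order t^(-al) and with frequencies bounded above and below. *)
Record chirp_bounds Z al (M m L t1 : R) : Prop := ChirpBounds {
  chirp_M0 : 0 < M ; chirp_m0 : 0 < m ; chirp_L0 : 0 < L ; chirp_t10 : 0 < t1 ;
  chirp_continuous : continuous Z ;
  chirp_le : forall t, t1 <= t -> `|Z t| <= M * t `^ (- al) ;
  chirp_lip : forall t t', t1 <= t <= t' ->
    `|Z t - Z t'| <= M * t `^ (- al) * (t' - t) ;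
  chirp_osc : forall t, t1 <= t -> exists a b, [/\ t <= a <= t + L,
    t <= b <= t + L, m * t `^ (- al) <= Z a & Z b <= - (m * t `^ (- al))] }.

Lemma powRN_inv (t al : R) : 0 < t -> (t^-1) `^ (- al) = t `^ al.
Proof.
by move=> t0; rewrite -powR_inv1 ?(ltW t0)// -powRrM mulN1r opprK.
Qed.

Lemma area_rectangle (a b c d : R) : a <= b -> c <= d ->
  area (`[a, b] `*` `[c, d]) = ((b - a) * (d - c))%:E.
Proof.
move=> ab cd; rewrite /area product_measure1E; [|exact: measurable_itv|exact: measurable_itv].
rewrite /= [X in (X * _)%E](@lebesgue_measure_itv R) [X in (_ * X)%E](@lebesgue_measure_itv R) /= !lte_fin.
move: ab cd; rewrite !le_eqVlt => /predU1P[->|->]; last first.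
  by move=> /predU1P[->|->]; rewrite ?ltxx ?subrr ?mulr0 ?mule0.
by rewrite ltxx subrr mul0r mul0e.
Qed.

(** The variable 1/t runs through a window of length L while t moves by at most
    L t^2 <= eps / 2; the intermediate value theorem then provides a point of
    the graph at height y. *)
Lemma chirp_section Z al M m L t1 t0 eps t y : chirp_bounds Z al M m L t1 ->
  0 <= al -> 0 < eps -> 0 < t -> t <= t0 -> t0 <= t1^-1 -> 2 * L * t ^+ 2 <= eps ->
  `|y| <= m * t `^ al -> tube (inv_graph Z t0) eps (t, y).
Proof.
move=> [M0 m0 L0 t10 Zc _ _ osc] al0 e0 tt tt0 t0t1 Lt hy.
have tV : t1 <= t^-1.
  by rewrite -[t1]invrK lef_pV2 ?posrE ?invr_gt0// (le_trans tt0).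
have [a [b [/andP[a1 a2] /andP[b1 b2] ha hb]]] := osc _ tV.
rewrite powRN_inv// in ha hb.
move: hy; rewrite ler_norml => /andP[y1 y2].
have key c : t^-1 <= c -> c <= t^-1 + L -> Z c = y -> tube (inv_graph Z t0) eps (t, y).
  move=> c1 c2 Zcy.
  have tV0 : 0 < t^-1 by rewrite invr_gt0.
  have c0 : 0 < c by exact: lt_le_trans c1.
  have ct : c^-1 <= t by rewrite -[t]invrK lef_pV2 ?posrE.
  exists (c^-1, y).
    by rewrite /inv_graph/= invr_gt0 invrK Zcy; split => //; split => //; exact: le_trans tt0.
  rewrite edist_ltP//= subrr expr0n/= addr0 ltr_pXn2r ?nnegrE ?subr_ge0 ?(ltW e0)//.
  have : t - c^-1 <= L * t ^+ 2.
    have h : c * t <= 1 + L * t.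
      have := ler_wpM2r (ltW tt) c2; rewrite mulrDl mulVf ?gt_eqF//.
    rewrite -(ler_pM2r c0) mulrBl mulVf ?gt_eqF//.
    have : 1 <= c * t by have := ler_wpM2r (ltW tt) c1; rewrite mulVf ?gt_eqF.
    clear - h tt L0; nra.
  have : 0 < L * t ^+ 2 by rewrite mulr_gt0// exprn_gt0.
  clear - Lt; lra.
have [ab|ba] := leP a b.
  have [||c] := @IVT R Z a b y ab.
  - exact: continuous_subspaceT.
  - by rewrite ge_min le_max; apply/andP; split; apply/orP; [right; exact: le_trans y1|left; exact: le_trans ha].
  rewrite in_itv/= => /andP[ac cb] Zy; apply: (key c) => //.
    exact: le_trans ac.
  exact: le_trans b2.
have [||c] := @IVT R Z b a y (ltW ba).
- exact: continuous_subspaceT.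
- by rewrite ge_min le_max; apply/andP; split; apply/orP; [left; exact: le_trans y1|right; exact: le_trans ha].
rewrite in_itv/= => /andP[bc ca] Zy; apply: (key c) => //.
  exact: le_trans bc.
exact: le_trans a2.
Qed.

(** A single rectangle over [k sqrt eps / 2, k sqrt eps] has area of the right
    order. *)
Lemma chirp_area_ge Z al M m L t1 t0 : chirp_bounds Z al M m L t1 ->
  0 < al < 1 -> 0 < t0 -> t0 <= t1^-1 ->
  exists2 c1, 0 < c1 & \forall eps \near 0^'+,
   ((c1 * eps `^ ((1 + al) / 2))%:E <= area (tube (inv_graph Z t0) eps))%E.
Proof.
move=> hZ /andP[al0 al1] t00 t0t1.
have L0 := chirp_L0 hZ; have m0 := chirp_m0 hZ.
(* chosen so that chirp_section applies for t <= k sqrt eps *)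
have [k k0 k2] : exists2 k : R, 0 < k & 2 * L * k ^+ 2 = 1.
  exists (Num.sqrt (2 * L))^-1; first by rewrite invr_gt0 sqrtr_gt0 mulr_gt0.
  by rewrite exprVn sqr_sqrtr ?mulfV ?mulr_ge0 ?(ltW L0)// gt_eqF// mulr_gt0.
have k20 : 0 < k / 2 by rewrite divr_gt0.
exists (k / 2 * (2 * m * (k / 2) `^ al)).
  by rewrite !mulr_gt0 ?powR_gt0.
near=> eps.
have e0 : 0 < eps by near: eps; exact: nbhs_right_gt.
pose u := eps `^ 2^-1.
have u0 : 0 < u by exact: powR_gt0.
have u2 : u ^+ 2 = eps.
  by rewrite -powR_mulrn ?(ltW u0)// -powRrM mulVf// powRr1// ltW.
have kut0 : k * u <= t0.
  rewrite -ler_pdivlMl// /u; near: eps; apply: near0r_powR_le => //.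
  by rewrite mulr_gt0// invr_gt0.
have hk : k / 2 * u <= k * u by rewrite ler_pM2r//; clear - k0; lra.
pose h := m * (k / 2 * u) `^ al.
have h0 : 0 < h by rewrite mulr_gt0 ?powR_gt0 ?mulr_gt0.
have -> : k / 2 * (2 * m * (k / 2) `^ al) * eps `^ ((1 + al) / 2) =
    (k * u - k / 2 * u) * (h - - h).
  rewrite /h (powRM _ (ltW k20) (ltW u0)).
  have -> : eps `^ ((1 + al) / 2) = u * u `^ al.
    rewrite mulrC powRrM -/u powRD ?powRr1 ?(ltW u0)//.
    by rewrite (gt_eqF u0) implybT.
  by move: ((k / 2) `^ al) (u `^ al) => p q; field.
rewrite -area_rectangle//; last by clear - h0; lra.
apply: le_area; [apply: measurableX; exact: measurable_itv|exact: measurable_tube|].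
move=> [t y] [/=]; rewrite !in_itv/= => /andP[t1' t2'] /andP[y1 y2].
have tt : 0 < t by apply: lt_le_trans t1'; rewrite mulr_gt0.
apply: (chirp_section hZ) => //; first exact: ltW.
- exact: le_trans kut0.
- have -> : eps = 2 * L * (k * u) ^+ 2 by rewrite exprMn mulrA k2 mul1r u2.
  have L2 : 0 <= 2 * L by rewrite mulr_ge0// ltW.
  by rewrite (ler_wpM2l L2)// ler_pXn2r// nnegrE ?(ltW tt)// mulr_ge0// ltW.
- apply: (@le_trans _ _ h); first by rewrite ler_norml y1.
  rewrite ler_wpM2l ?(ltW m0)//; apply: ge0_ler_powR => //; rewrite ?nnegrE ?(ltW al0) ?(ltW tt)//.
  by rewrite mulr_ge0// ltW.
Unshelve. all: by end_near. Qed.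

Lemma area_le_sections (E : set (R * R)) (g : R -> R) : measurable E ->
  measurable_fun setT g -> (forall x, 0 <= g x) ->
  (forall x, exists2 c : R, 0 <= g x & forall y, E (x, y) -> `|y - c| <= g x / 2) ->
  (area E <= \int[mu]_x (g x)%:E)%E.
Proof.
move=> mE mg g0 sec; rewrite /area /product_measure1.
apply: ge0_le_integral => //.
- exact: measurable_fun_xsection.
- exact/measurable_EFinP.
move=> x _ /=; have [c gx h] := sec x.
apply: (@le_trans _ _ (mu `[c - g x / 2, c + g x / 2]%classic)).
  apply: le_measure; rewrite ?inE//; first exact: measurable_xsection.
  move=> y; rewrite /xsection/= inE => /h; rewrite ler_norml in_itv/= => /andP[h1 h2].
  by apply/andP; split; clear - h1 h2; lra.
rewrite [leLHS](@lebesgue_measure_itv R) /= lte_fin; case: ifPn => _; last by rewrite lee_fin.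
by rewrite -EFinB lee_fin; clear; lra.
Qed.

Lemma integral_decay_le al (a b e M : R) : 0 < al < 1 -> 0 < a -> a < b -> 0 <= e -> 0 <= M ->
  (\int[mu]_x ((e + M * x `^ (al - 2)) * \1_`[a, b] x)%:E <=
   (e * b + M / (1 - al) * a `^ (al - 1))%:E)%E.
Proof.
move=> /andP[al0 al1] a0 ab e0 M0.
have a1 : 0 < 1 - al by clear - al1; lra.
rewrite (_ : (fun x => _) = (fun x => (e + M * x `^ (al - 2))%:E) \_ `[a, b]); last first.
  apply/funext => r; rewrite /patch indicE; case: ifPn => _; last by rewrite mulr0.
  by rewrite mulr1.
rewrite -integral_mkcond.
pose F x := e * x - M / (1 - al) * x `^ (al - 1).
have dF (x : R) : 0 < x -> is_derive x 1 F (e + M * x `^ (al - 2)).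
  move=> x0; have dp := is_derive_powR (al - 1) x0.
  apply: is_derive_eq; rewrite /GRing.scale/=.
  have -> : al - 1 - 1 = al - 2 by ring.
  by field; rewrite gt_eqF.
have cf : {within `[a, b], continuous (fun x : R => e + M * x `^ (al - 2))}.
  apply: derivable_within_continuous => x; rewrite in_itv/= => /andP[ax _].
  have dp := is_derive_powR (al - 2) (lt_le_trans a0 ax).
  exact: ex_derive.
rewrite (@continuous_FTC2 _ _ F)//.
- rewrite lee_fin /F.
  have : 0 <= M / (1 - al) * b `^ (al - 1) by rewrite mulr_ge0 ?powR_ge0// divr_ge0// ltW.
  have : 0 <= e * a by rewrite mulr_ge0// ltW.
  clear; lra.
- have cF x : 0 < x -> {for x, continuous F}.
    by move=> x0; apply: differentiable_continuous; apply/derivable1_diffP; have := dF _ x0 => ?; exact: ex_derive.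
  split.
  + move=> x; rewrite in_itv/= => /andP[ax _].
    by have := dF x (lt_trans a0 ax) => ?; exact: ex_derive.
  + by apply: cvg_at_right_filter; apply: cF.
  + by apply: cvg_at_left_filter; apply: cF; exact: lt_trans ab.
- move=> x; rewrite in_itv/= => /andP[ax _]; rewrite derive1E.
  by have := dF x (lt_trans a0 ax) => ?; rewrite derive_val.
Qed.

(** At abscissas above 2 eps the graph varies by O(eps x^(al-2)) over a distance
    eps, x^(al-2) being the size of the derivative of Z (1/x). *)
Lemma chirp_section_far Z al M m L t1 t0 eps x : chirp_bounds Z al M m L t1 ->
  0 <= al <= 1 -> 0 < eps -> 2 * eps <= x -> t0 <= t1^-1 -> exists c, forall y,
  tube (inv_graph Z t0) eps (x, y) -> `|y - c| <= eps + 8 * M * eps * x `^ (al - 2).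
Proof.
move=> hZ /andP[al0 al1] e0 ex t0t1; have [M0 m0 L0 t10 _ _ lip _] := hZ.
have x0 : 0 < x by clear - e0 ex; lra.
(* the tube extends beyond the end t0 of the graph by eps *)
pose x' := Num.min x t0; exists (Z x'^-1) => y [[t z] [/= tt [tt0 ->]]].
rewrite edist_ltP//= => dist.
have dx : `|x - t| < eps.
  rewrite -(@ltr_pXn2r _ 2)// ?nnegrE ?(ltW e0)// real_normK ?num_real//.
  by apply: le_lt_trans dist; rewrite lerDl sqr_ge0.
have dy : `|y - Z t^-1| < eps.
  rewrite -(@ltr_pXn2r _ 2)// ?nnegrE ?(ltW e0)// real_normK ?num_real//.
  by apply: le_lt_trans dist; rewrite lerDr sqr_ge0.
move: dx; rewrite ltr_norml => /andP[dx1 dx2].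
have xt : x / 2 <= t by clear - dx1 dx2 ex; lra.
have xx' : x / 2 <= x' by rewrite /x' le_min; apply/andP; split; clear - dx1 dx2 ex tt0 x0; lra.
have x'x : x' <= x by rewrite /x' ge_min lexx.
have x't0 : x' <= t0 by rewrite /x' ge_min lexx orbT.
have tx' : `|t - x'| <= eps.
  rewrite ler_norml /x'; apply/andP; split.
    by have : Num.min x t0 <= x by []; clear - dx1 dx2; lra.
  by rewrite lerBlDr addrC -lerBlDr le_min; apply/andP; split; clear - dx1 dx2 tt0 e0; lra.
have key p q : x / 2 <= p -> p <= q -> q <= t0 -> q <= 2 * x -> q - p <= eps ->
    `|Z q^-1 - Z p^-1| <= 8 * M * eps * x `^ (al - 2).
  move=> xp pq qt0 qx qp.
  have p0 : 0 < p by clear - xp x0; lra.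
  have q0 : 0 < q by clear - p0 pq; lra.
  have : t1 <= q^-1 <= p^-1.
    by rewrite -{1}[t1]invrK !lef_pV2 ?posrE ?invr_gt0// pq (le_trans qt0).
  move=> /lip/le_trans; apply; rewrite powRN_inv//.
  have -> : p^-1 - q^-1 = (q - p) * (p^-1 * q^-1) by field; rewrite !gt_eqF.
  have qal : q `^ al <= 2 * x `^ al.
    apply: (@le_trans _ _ ((2 * x) `^ al)).
      by apply: ge0_ler_powR; rewrite ?nnegrE ?(ltW q0)// mulr_ge0// ltW.
    by rewrite powRM// ?(ltW x0)// ler_wpM2r ?powR_ge0// ler1_powR// ler1n.
  have xV : 0 < 2 / x by rewrite divr_gt0.
  have pV : p^-1 <= 2 / x by rewrite -[2 / x]invrK lef_pV2 ?posrE ?invr_gt0// invf_div.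
  have qV : q^-1 <= 2 / x.
    by rewrite (le_trans _ pV)// lef_pV2.
  have -> : x `^ (al - 2) = x `^ al / x ^+ 2.
    by rewrite powRB ?(gt_eqF x0) ?implybT// powR_mulrn// ltW.
  have -> : 8 * M * eps * (x `^ al / x ^+ 2) = M * (2 * x `^ al) * (eps * (2 / x * (2 / x))).
    by field; rewrite gt_eqF.
  apply: ler_pM.
  - by rewrite mulr_ge0 ?powR_ge0// ltW.
  - by rewrite !mulr_ge0 ?subr_ge0 ?invr_ge0 ?(ltW p0) ?(ltW q0).
  - by rewrite ler_wpM2l// ltW.
  - apply: ler_pM => //; first by rewrite subr_ge0.
      by rewrite mulr_ge0 ?invr_ge0 ?(ltW p0) ?(ltW q0).
    by apply: ler_pM; rewrite ?invr_ge0 ?(ltW p0) ?(ltW q0).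
have -> : y - Z x'^-1 = (y - Z t^-1) + (Z t^-1 - Z x'^-1) by ring.
apply: le_trans (ler_normD _ _) _; apply: lerD; first exact: ltW.
have [tlx|xlt] := leP t x'.
  rewrite distrC; apply: key => //; first by clear - x'x x0; lra.
  by move: tx'; rewrite ler_norml; clear; lra.
apply: key => //; [exact: ltW|by clear - dx1 dx2 ex x0; lra|].
by move: tx'; rewrite ler_norml; clear; lra.
Qed.

(** Near the origin the envelope x^al of the graph is the better bound. *)
Lemma chirp_section_near Z al M m L t1 t0 eps x y v : chirp_bounds Z al M m L t1 ->
  0 <= al -> 0 < eps -> x + eps <= v -> t0 <= t1^-1 ->
  tube (inv_graph Z t0) eps (x, y) -> - eps <= x /\ `|y| <= M * v `^ al + eps.
Proof.
move=> [M0 m0 L0 t10 _ bnd _ _] al0 e0 xv t0t1 [[t z] [/= tt [tt0 ->]]].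
rewrite edist_ltP//= => dist.
have dx : `|x - t| < eps.
  rewrite -(@ltr_pXn2r _ 2)// ?nnegrE ?(ltW e0)// real_normK ?num_real//.
  by apply: le_lt_trans dist; rewrite lerDl sqr_ge0.
have dy : `|y - Z t^-1| < eps.
  rewrite -(@ltr_pXn2r _ 2)// ?nnegrE ?(ltW e0)// real_normK ?num_real//.
  by apply: le_lt_trans dist; rewrite lerDr sqr_ge0.
move: dx; rewrite ltr_norml => /andP[dx1 dx2].
split; first by clear - dx1 dx2 tt; lra.
have -> : y = Z t^-1 + (y - Z t^-1) by ring.
apply: le_trans (ler_normD _ _) _; apply: lerD; last exact: ltW.
have : t1 <= t^-1 by rewrite -[t1]invrK lef_pV2 ?posrE ?invr_gt0// (le_trans tt0).
move=> /bnd/le_trans; apply; rewrite powRN_inv// ler_wpM2l ?(ltW M0)//.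
have tv : t <= v by clear - dx1 xv; lra.
by apply: ge0_ler_powR; rewrite ?nnegrE ?(ltW tt)// ltW// (lt_le_trans tt).
Qed.

(** The two bounds of the sections balance at x of order sqrt eps; the integral
    of eps x^(al-2) beyond that point is eps^(1 + (al-1)/2). *)
Lemma chirp_area_le Z al M m L t1 t0 : chirp_bounds Z al M m L t1 ->
  0 < al < 1 -> 0 < t0 -> t0 <= t1^-1 ->
  exists2 c2, 0 < c2 & \forall eps \near 0^'+,
   (area (tube (inv_graph Z t0) eps) <= (c2 * eps `^ ((1 + al) / 2))%:E)%E.
Proof.
move=> hZ al01 t00 t0t1; have /andP[al0 al1] := al01.
have M0 := chirp_M0 hZ.
have a1 : 0 < 1 - al by clear - al1; lra.
exists (18 * M + 6 + 2 * (t0 + 1) + 16 * M / (1 - al)).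
  have : 0 < 16 * M / (1 - al) by apply: divr_gt0 => //; clear - M0; lra.
  by clear - M0 t00; lra.
near=> eps.
have e0 : 0 < eps by near: eps; exact: nbhs_right_gt.
have e1 : eps <= 1 by near: eps; apply: nbhs_right_le.
have [u u0 [u2 uE]] : exists2 u, 0 < u & u ^+ 2 = eps /\ u = eps `^ 2^-1.
  exists (eps `^ 2^-1); first exact: powR_gt0.
  split => //; rewrite -powR_mulrn ?powR_ge0// -powRrM mulVf// powRr1// ltW.
have ut0 : 2 * u < t0.
  rewrite -ltr_pdivlMl// uE (le_lt_trans (_ : _ <= 2^-1 * t0 / 2))//; last first.
    by rewrite ltr_pdivrMr// ltr_pMr ?mulr_gt0 ?invr_gt0// ltr1n.
  near: eps; apply: near0r_powR_le; rewrite ?invr_gt0// !divr_gt0// mulr_gt0// invr_gt0.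
have u1 : u <= 1 by clear - u0 u2 e1; nra.
have eu : eps <= u by clear - u0 u1 u2; nra.
pose K := M * (3 * u) `^ al + eps.
have K0 : 0 <= K by rewrite addr_ge0 ?(ltW e0)// mulr_ge0 ?powR_ge0// ltW.
pose g x := 2 * K * \1_`[(- eps), 2 * u] x +
  (2 * eps + 16 * M * eps * x `^ (al - 2)) * \1_`[2 * u, (t0 + eps)] x.
have f0 x : 0 <= 2 * eps + 16 * M * eps * x `^ (al - 2).
  by rewrite addr_ge0 ?mulr_ge0 ?powR_ge0 ?(ltW M0) ?(ltW e0).
have g10 x : 0 <= 2 * K * \1_`[(- eps), 2 * u] x.
  by rewrite mulr_ge0 ?mulr_ge0// indicE ler0n.
have g20 x : 0 <= (2 * eps + 16 * M * eps * x `^ (al - 2)) * \1_`[2 * u, (t0 + eps)] x.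
  by rewrite mulr_ge0// indicE ler0n.
have g0 x : 0 <= g x by rewrite addr_ge0.
have m1 : measurable_fun setT (fun x : R => 2 * K * \1_`[(- eps), 2 * u] x).
  by apply: measurable_funM => //; apply: measurable_indic; exact: measurable_itv.
have m2 : measurable_fun setT (fun x : R => (2 * eps + 16 * M * eps * x `^ (al - 2)) * \1_`[2 * u, (t0 + eps)] x).
  apply: measurable_funM; last by apply: measurable_indic; exact: measurable_itv.
  apply: measurable_funD => //; exact: measurable_funM.
apply: (@le_trans _ _ (\int[mu]_x (g x)%:E)%E).
  apply: area_le_sections => //.
  - exact: measurable_tube.
  - exact: measurable_funD.
  move=> x; have [xu|ux] := ltP x (2 * u).
    exists 0 => // y yE; rewrite subr0.
    have xv : x + eps <= 3 * u by clear - xu eu; lra.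
    have [ex yK] := chirp_section_near hZ (ltW al0) e0 xv t0t1 yE.
    apply: (le_trans yK); rewrite -/K.
    apply: (@le_trans _ _ (2 * K * \1_`[(- eps), 2 * u] x / 2)).
      by rewrite indicE mem_set ?mulr1 /= ?in_itv/= ?ex ?(ltW xu)//; clear; lra.
    by rewrite ler_wpM2r// lerDl.
  have ex2 : 2 * eps <= x by clear - eu ux; lra.
  have al01' : 0 <= al <= 1 by rewrite !ltW.
  have [c hc] := chirp_section_far hZ al01' e0 ex2 t0t1.
  exists c => // y yE.
  have xt0 : x <= t0 + eps.
    move: yE => [[t z] [/= tt [tt0 _]]]; rewrite edist_ltP//= => dist.
    have : `|x - t| < eps.
      rewrite -(@ltr_pXn2r _ 2)// ?nnegrE ?(ltW e0)// real_normK ?num_real//.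
      by apply: le_lt_trans dist; rewrite lerDl sqr_ge0.
    by rewrite ltr_norml; clear - tt0; lra.
  apply: (le_trans (hc y yE)).
  apply: (@le_trans _ _ ((2 * eps + 16 * M * eps * x `^ (al - 2)) * \1_`[2 * u, (t0 + eps)] x / 2)).
    by rewrite indicE mem_set ?mulr1 /= ?in_itv/= ?ux ?xt0//; clear; lra.
  by rewrite ler_wpM2r// lerDr.
under eq_integral do rewrite EFinD.
rewrite ge0_integralD//; last 4 first.
- by move=> x _; rewrite lee_fin.
- exact/measurable_EFinP.
- by move=> x _; rewrite lee_fin.
- exact/measurable_EFinP.
have I1 : (\int[mu]_x (2 * K * \1_`[(- eps), 2 * u] x)%:E = (2 * K * (2 * u + eps))%:E)%E.
  under eq_integral do rewrite EFinM.
  rewrite ge0_integralZl_EFin//=; last 2 first.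
  - by apply/measurable_EFinP; apply: measurable_indic; exact: measurable_itv.
  - by rewrite mulr_ge0.
  rewrite integral_indic// setIT [X in (_ * X)%E](_ : _ = (2 * u + eps)%:E)//.
  rewrite [LHS](@lebesgue_measure_itv R) /= lte_fin.
  rewrite ifT; first by rewrite -EFinB opprK.
  by clear - e0 u0; lra.
rewrite I1.
have I2 := @integral_decay_le al (2 * u) (t0 + eps) (2 * eps) (16 * M * eps) al01.
apply: le_trans (leeD2l _ (I2 _ _ _ _)) _.
- by rewrite mulr_gt0.
- by clear - ut0 e0; lra.
- by rewrite mulr_ge0// ltW.
- by rewrite !mulr_ge0 ?(ltW M0)// ltW.
rewrite -EFinD lee_fin.
have ual0 : 0 < u `^ al by exact: powR_gt0.
have -> : eps `^ ((1 + al) / 2) = u * u `^ al.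
  by rewrite mulrC powRrM -uE powRD ?powRr1 ?(ltW u0)// (gt_eqF u0) implybT.
have u01 : 0 < u <= 1 by rewrite u0.
have uual : u <= u `^ al by apply: ger1_powR => //; exact: ltW.
have uu : eps <= u * u `^ al by rewrite -u2 expr2 ler_wpM2l// ltW.
have ueu : u * eps <= u * u `^ al.
  by apply: le_trans uu; rewrite ler_piMl// ltW.
have u3 : (3 * u) `^ al <= 3 * u `^ al.
  by rewrite powRM ?(ltW u0)// ler_wpM2r ?(ltW ual0)// ler1_powR ?ler1n// ltW.
have t1' : 2 * K * (2 * u + eps) <= 18 * M * (u * u `^ al) + 6 * (u * u `^ al).
  have K1 : K <= 3 * M * u `^ al + eps.
    by rewrite /K lerD2r; have := ler_wpM2l (ltW M0) u3; clear; lra.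
  have K3 : 2 * K * (2 * u + eps) <= 2 * K * (3 * u).
    by rewrite ler_wpM2l ?mulr_ge0//; clear - eu; lra.
  have K4 : K * u <= (3 * M * u `^ al + eps) * u by rewrite ler_wpM2r// ltW.
  by clear - K3 K4 ueu; lra.
have t2' : 2 * eps * (t0 + eps) <= 2 * (t0 + 1) * (u * u `^ al).
  apply: (@le_trans _ _ (2 * eps * (t0 + 1))).
    by rewrite ler_wpM2l ?mulr_ge0 ?(ltW e0)// lerD2l.
  have := ler_wpM2l (ltW (addr_gt0 t00 ltr01)) uu; clear; lra.
have t3' : 16 * M * eps / (1 - al) * (2 * u) `^ (al - 1) <= 16 * M / (1 - al) * (u * u `^ al).
  have -> : 16 * M * eps / (1 - al) * (2 * u) `^ (al - 1) =
    16 * M / (1 - al) * (u ^+ 2 * (2 * u) `^ (al - 1)) by rewrite u2; ring.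
  have k0 : 0 <= 16 * M / (1 - al) by apply: divr_ge0; [clear - M0; lra|exact: ltW].
  apply: (ler_wpM2l k0).
  have -> : u * u `^ al = u ^+ 2 * u `^ (- (1 - al)).
    rewrite opprB powRB ?(gt_eqF u0) ?implybT// powRr1 ?(ltW u0)//; field.
    by rewrite gt_eqF.
  rewrite ler_wpM2l ?sqr_ge0// -opprB powRN_ge ?(ltW a1)//.
  by clear - u0; lra.
by clear - t1' t2' t3'; lra.
Unshelve. all: by end_near. Qed.

Lemma chirp_tube_order Z al M m L t1 : chirp_bounds Z al M m L t1 -> 0 < al < 1 ->
  \forall t0 \near 0^'+, tube_order (inv_graph Z t0) ((3 - al) / 2).
Proof.
move=> hZ al01; have t10 := chirp_t10 hZ; near=> t0.
have t00 : 0 < t0 by near: t0; exact: nbhs_right_gt.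
have t01 : t0 <= t1^-1 by near: t0; apply: nbhs_right_le; rewrite invr_gt0.
have [c1 c10 h1] := chirp_area_ge hZ al01 t00 t01.
have [c2 c20 h2] := chirp_area_le hZ al01 t00 t01.
exists c1, c2; split => //.
have -> : 2 - (3 - al) / 2 = (1 + al) / 2 by field.
by near=> eps; split; near: eps.
Unshelve. all: by end_near. Qed.

End Chirp.

(** * Smooth functions, flat points and division *)

Section LocalSmooth.
Variable R : realType.
Implicit Types (f g h : R -> R) (x : R) (n k : nat).

(** Differentiability near x rather than at x, so that derivatives can be taken
    again; local and of finite order, which lets products and inverses be
    treated by induction on n. *)
Fixpoint smooth_at n f x : Prop :=
  if n is n'.+1 then (\forall y \near x, derivable f y 1) /\ smooth_at n' (derive1 f) x
  else True.

Fixpoint flat_at n f x : Prop :=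
  f x = 0 /\
  if n is n'.+1 then (\forall y \near x, derivable f y 1) /\ flat_at n' (derive1 f) x
  else True.

Lemma near_near (P : R -> Prop) x : (\forall y \near x, P y) ->
  \forall y \near x, \forall z \near y, P z.
Proof. by move=> h; exact: near_join. Qed.

Lemma near_derive1 f g x : (\forall y \near x, f y = g y) ->
  \forall y \near x, (derive1 f) y = (derive1 g) y.
Proof.
move=> /near_near; apply: filterS => y h.
by rewrite !derive1E; apply: near_eq_derive.
Qed.

Lemma near_derivable f g x : (\forall y \near x, f y = g y) ->
  (\forall y \near x, derivable f y 1) -> \forall y \near x, derivable g y 1.
Proof.
move=> /near_near h1 h2; apply: filterS2 h1 h2 => y h.
by apply: near_eq_derivable.
Qed.

Lemma smooth_at_near n f g x : (\forall y \near x, f y = g y) -> smooth_at n f x -> smooth_at n g x.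
Proof.
elim: n f g => [//|n IH] f g fg /= [df sf]; split.
  exact: near_derivable df.
by apply: IH sf; exact: near_derive1.
Qed.

Lemma flat_at_near n f g x : (\forall y \near x, f y = g y) -> flat_at n f x -> flat_at n g x.
Proof.
elim: n f g => [|n IH] f g fg /= [fx]; first by move: (nbhs_singleton fg) => <-.
move=> [df sf]; split; first by move: (nbhs_singleton fg) => <-.
split; first exact: near_derivable df.
by apply: IH sf; exact: near_derive1.
Qed.

Lemma smooth_atW n f x : smooth_at n.+1 f x -> smooth_at n f x.
Proof. by elim: n f => [//|n IH] f [df sf]; split => //; exact: IH. Qed.

Lemma flat_atW n f x : flat_at n.+1 f x -> flat_at n f x.
Proof.
elim: n f => [|n IH] f [fx [df sf]]; first by [].
by split => //; split => //; exact: IH.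
Qed.

Lemma smooth_at_of_flat_at n f x : flat_at n f x -> smooth_at n f x.
Proof. by elim: n f => [//|n IH] f [fx [df sf]]; split => //; exact: IH. Qed.

Lemma smooth_at_cst n (c : R) x : smooth_at n (fun=> c) x.
Proof.
elim: n c => [//|n IH] c; split; first by near=> y; exact: derivable_cst.
by apply: smooth_at_near (IH 0); near=> y; rewrite derive1_cst.
Unshelve. all: by end_near. Qed.

Lemma flat_at_0 n x : flat_at n (fun=> 0) x.
Proof.
elim: n => [//|n IH]; split => //; split; first by near=> y; exact: derivable_cst.
by apply: flat_at_near IH; near=> y; rewrite derive1_cst.
Unshelve. all: by end_near. Qed.

Lemma smooth_at_id n x : smooth_at n (fun y => y) x.
Proof.
case: n => [//|n]; split; first by near=> y; exact: derivable_id.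
by apply: smooth_at_near (smooth_at_cst n 1 x); near=> y; rewrite derive1_id.
Unshelve. all: by end_near. Qed.

Lemma near_derive1D f g x : (\forall y \near x, derivable f y 1) ->
  (\forall y \near x, derivable g y 1) ->
  \forall y \near x, (derive1 f) y + (derive1 g) y = (derive1 (fun z => f z + g z)) y.
Proof.
by move=> df dg; apply: filterS2 df dg => y df dg; rewrite !derive1E deriveD.
Qed.

Lemma near_derive1M f g x : (\forall y \near x, derivable f y 1) ->
  (\forall y \near x, derivable g y 1) ->
  \forall y \near x, (derive1 f) y * g y + f y * (derive1 g) y = (derive1 (fun z => f z * g z)) y.
Proof.
move=> df dg; apply: filterS2 df dg => y df dg; rewrite !derive1E deriveM//.
by rewrite /GRing.scale/= addrC [X in _ + X = _]mulrC.
Qed.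

Lemma smooth_atD n f g x : smooth_at n f x -> smooth_at n g x -> smooth_at n (fun y => f y + g y) x.
Proof.
elim: n f g => [//|n IH] f g [df sf] [dg sg]; split.
  by apply: filterS2 df dg => y; exact: derivableD.
by apply: smooth_at_near (IH _ _ sf sg); exact: near_derive1D.
Qed.

Lemma flat_atD n f g x : flat_at n f x -> flat_at n g x -> flat_at n (fun y => f y + g y) x.
Proof.
elim: n f g => [|n IH] f g /= [fx hf] [gx hg]; first by rewrite fx gx addr0.
move: hf hg => [df sf] [dg sg]; split; first by rewrite fx gx addr0.
split; first by apply: filterS2 df dg => y; exact: derivableD.
by apply: flat_at_near (IH _ _ sf sg); exact: near_derive1D.
Qed.

Lemma smooth_atM n f g x : smooth_at n f x -> smooth_at n g x -> smooth_at n (fun y => f y * g y) x.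
Proof.
elim: n f g => [//|n IH] f g hf hg; have [df sf] := hf; have [dg sg] := hg; split.
  by apply: filterS2 df dg => y; exact: derivableM.
apply: smooth_at_near (smooth_atD (IH _ _ sf (smooth_atW hg)) (IH _ _ (smooth_atW hf) sg)).
exact: near_derive1M.
Qed.

Lemma flat_atM n f g x : flat_at n f x -> smooth_at n g x -> flat_at n (fun y => f y * g y) x.
Proof.
elim: n f g => [|n IH] f g hf hg; first by case: hf => fx _; split => //; rewrite fx mul0r.
have [fx [df sf]] := hf; have [dg sg] := hg; split; first by rewrite fx mul0r.
split; first by apply: filterS2 df dg => y; exact: derivableM.
apply: flat_at_near (flat_atD (IH _ _ sf (smooth_atW hg)) (IH _ _ (flat_atW hf) sg)).
exact: near_derive1M.
Qed.

Lemma smooth_atN n f x : smooth_at n f x -> smooth_at n (fun y => - f y) x.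
Proof.
move=> sf; apply: smooth_at_near (smooth_atM (smooth_at_cst n (-1) x) sf).
by near=> y; rewrite mulN1r.
Unshelve. all: by end_near. Qed.

Lemma smooth_at_continuous f x : smooth_at 1 f x -> {for x, continuous f}.
Proof.
move=> [df _]; apply: differentiable_continuous; apply/derivable1_diffP.
exact: nbhs_singleton df.
Qed.

Lemma smooth_atV n f x : f x != 0 -> smooth_at n f x -> smooth_at n (fun y => (f y)^-1) x.
Proof.
move=> fx; elim: n => [//|n IH] hf; have [df sf] := hf.
have f0 : \forall y \near x, f y != 0.
  have cf : {for x, continuous f} by apply: smooth_at_continuous; split.
  exact: (cvgr_neq0 (f x) cf fx).
split.
  by apply: filterS2 df f0 => y dfy fy; exact: derivableV.
have IH' := IH (smooth_atW hf).
apply: smooth_at_near (smooth_atN (smooth_atM sf (smooth_atM IH' IH'))).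
apply: filterS2 df f0 => y dfy fy; rewrite !derive1E deriveV//.
by rewrite /GRing.scale/= mulNr expr2 invfM mulrC.
Qed.

End LocalSmooth.

Section Smooth.
Variable R : realType.
Local Notation mu := (@lebesgue_measure R).
Implicit Types (f g h : R -> R) (x : R) (n k : nat).

Lemma smooth_derive1 f : smooth f -> smooth (derive1 f).
Proof. by move=> sf k x; rewrite -derive1Sn; exact: sf. Qed.

Lemma smooth_at_of_smooth f : smooth f -> forall n x, smooth_at n f x.
Proof.
move=> sf n; elim: n f sf => [//|n IH] f sf x; split.
  by near=> y; exact: (sf 0%N).
by apply: IH; exact: smooth_derive1.
Unshelve. all: by end_near. Qed.

Lemma smooth_of_smooth_at f : (forall n x, smooth_at n f x) -> smooth f.
Proof.
move=> sf k; elim: k f sf => [|k IH] f sf x.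
  by have [df _] := sf 1%N x; exact: nbhs_singleton df.
by rewrite derive1Sn; apply: IH => n y; have [_] := sf n.+1 y.
Qed.

Lemma smooth_derivable f : smooth f -> forall x, derivable f x 1.
Proof. by move=> sf x; exact: (sf 0%N). Qed.

Lemma smooth_is_derive f x : smooth f -> is_derive x 1 f (derive1 f x).
Proof. by move=> sf; rewrite derive1E; apply: derivableP; exact: smooth_derivable. Qed.

Lemma smooth_continuous f : smooth f -> continuous f.
Proof.
by move=> sf x; apply: differentiable_continuous; apply/derivable1_diffP; exact: smooth_derivable.
Qed.

Lemma smooth_cst (c : R) : smooth (fun=> c : R).
Proof. by apply: smooth_of_smooth_at => n x; exact: smooth_at_cst. Qed.

Lemma smooth_id : smooth (fun x : R => x).
Proof. by apply: smooth_of_smooth_at => n x; exact: smooth_at_id. Qed.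

Lemma smoothD f g : smooth f -> smooth g -> smooth (fun x => f x + g x).
Proof. by move=> sf sg; apply: smooth_of_smooth_at => n x; apply: smooth_atD; exact: smooth_at_of_smooth. Qed.

Lemma smoothM f g : smooth f -> smooth g -> smooth (fun x => f x * g x).
Proof. by move=> sf sg; apply: smooth_of_smooth_at => n x; apply: smooth_atM; exact: smooth_at_of_smooth. Qed.

Lemma smoothX n : smooth (fun x : R => x ^+ n).
Proof.
elim: n => [|n IH]; first exact: smooth_cst.
rewrite (_ : (fun x => _) = (fun x => x * x ^+ n)); last by apply/funext => x; rewrite exprS.
exact: smoothM smooth_id IH.
Qed.

Lemma flat_atP f x : smooth f -> (forall k, derive1n k f x = 0) -> forall n, flat_at n f x.
Proof.
move=> sf f0 n; elim: n f sf f0 => [|n IH] f sf f0; first by split => //; exact: (f0 0%N).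
split; first exact: (f0 0%N).
split; first by near=> y; exact: smooth_derivable.
apply: IH; first exact: smooth_derive1.
by move=> k; rewrite -derive1Sn.
Unshelve. all: by end_near. Qed.

Lemma flat_at_derive1n f x : (forall n, flat_at n f x) -> forall k, derive1n k f x = 0.
Proof.
move=> ff k; elim: k f ff => [|k IH] f ff; first by have [] := ff 0%N.
by rewrite derive1Sn; apply: IH => n; have [_ []] := ff n.+1.
Qed.

Lemma continuous_bounded_itv f (a b : R) : a <= b -> continuous f ->
  exists2 B, 0 <= B & forall t, a <= t <= b -> `|f t| <= B.
Proof.
move=> ab cf.
have [c _ hc] : exists2 c, c \in `[a, b]%R & forall t, t \in `[a, b]%R -> `|f t| <= `|f c|.
  apply: EVT_max => //; apply: continuous_subspaceT => x.
  by apply: continuous_comp; [exact: cf|exact: norm_continuous].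
by exists `|f c| => // t tab; apply: hc; rewrite in_itv.
Qed.

Lemma is_derive_integral (F dF : R -> R -> R) (a b : R) x0 :
  (forall x t, is_derive x 1 (F ^~ t) (dF x t)) ->
  (forall x, continuous (F x)) ->
  (exists B, forall x t, `|x - x0| <= 1 -> a <= t <= b -> `|dF x t| <= B) ->
  is_derive x0 1 (fun x => \int[mu]_(t in `[a, b]) F x t) (\int[mu]_(t in `[a, b]) dF x0 t).
Proof.
move=> hd hc [B hB].
have Ix : `]x0 - 1, x0 + 1[%classic x0 by rewrite /= in_itv/=; apply/andP; split; lra.
have mB : measurable `[a, b]%classic by exact: measurable_itv.
have intF x : `]x0 - 1, x0 + 1[%classic x -> mu.-integrable `[a, b] (EFin \o F x).
  move=> _; apply: continuous_compact_integrable; first exact: segment_compact.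
  exact: continuous_subspaceT.
have derF x t : `]x0 - 1, x0 + 1[%classic x -> `[a, b]%classic t -> derivable (F ^~ t) x 1.
  by move=> _ _; have := hd x t => ?; exact: ex_derive.
pose G (t : R) : R := `|B|.
have G0 t : 0 <= G t by exact: normr_ge0.
have intG : mu.-integrable `[a, b] (EFin \o G).
  apply: continuous_compact_integrable; first exact: segment_compact.
  by apply: continuous_subspaceT => x; exact: cst_continuous.
have Gub x t : `]x0 - 1, x0 + 1[%classic x -> `[a, b]%classic t -> `|partial1of2 F x t| <= G t.
  rewrite /= !in_itv/= => /andP[x1 x2] tab.
  rewrite partial1of2E; have := hd x t => ?; rewrite derive_val.
  apply: le_trans (ler_norm B); apply: hB => //.
  by rewrite ler_norml; apply/andP; split; clear - x1 x2; lra.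
have E := @differentiation_under_integral R _ _ mu F _ mB x0 (x0 - 1) (x0 + 1) Ix intF derF G G0 intG Gub.
apply: DeriveDef; first exact: (@derivable_under_integral R _ _ mu F _ mB x0 (x0 - 1) (x0 + 1) Ix intF derF G G0 intG Gub).
rewrite -derive1E E; apply: eq_Rintegral => t _.
by rewrite partial1of2E; have := hd x0 t => ?; rewrite derive_val.
Qed.

Lemma continuous_affine_comp f (x0 d : R) : continuous f ->
  continuous (fun t : R => f (x0 + t * d)).

Proof.
move=> cf t; apply: (cvg_comp (fun t : R => x0 + t * d) f); last exact: cf.
by apply: cvgD; [exact: cvg_cst|apply: cvgM; [exact: cvg_id|exact: cvg_cst]].
Qed.

(** For k = 0 and the derivative of f this is the quotient of f - f x0 by x -
    x0; differentiating it in x raises k. *)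
Definition moment x0 k f x : R :=
  \int[mu]_(t in `[0%R, 1%R]) (t ^+ k * f (x0 + t * (x - x0))).

Lemma is_derive_moment x0 k f x : smooth f ->
  is_derive x 1 (moment x0 k f) (moment x0 k.+1 (derive1 f) x).
Proof.
move=> sf.
have -> : moment x0 k.+1 (derive1 f) x =
  \int[mu]_(t in `[0%R, 1%R]) (t ^+ k * (t * derive1 f (x0 + t * (x - x0)))).
  by apply: eq_Rintegral => t _; rewrite exprSr mulrA.
apply: (@is_derive_integral (fun x t => t ^+ k * f (x0 + t * (x - x0)))
  (fun x t => t ^+ k * (t * derive1 f (x0 + t * (x - x0))))).
- move=> y t.
  have h1 : is_derive y 1 (fun y => x0 + t * (y - x0)) t.
    by apply: is_derive_eq; rewrite /GRing.scale/=; ring.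
  have h2 := smooth_is_derive (x0 + t * (y - x0)) sf.
  have h3 : is_derive y 1 (f \o (fun y => x0 + t * (y - x0))) (t * derive1 f (x0 + t * (y - x0))).
    by rewrite mulrC; exact: is_derive1_comp.
  apply: is_derive_eq; rewrite /GRing.scale/=; ring.
- move=> y t; apply: cvgM; first exact: exprn_continuous.
  by apply: continuous_affine_comp; exact: smooth_continuous.
- have b0 : 0 <= `|x - x0| + 1 by rewrite addr_ge0.
  have [||B B0 hB] := @continuous_bounded_itv (derive1 f) (x0 - (`|x - x0| + 1)) (x0 + (`|x - x0| + 1)).
  + by clear - b0; lra.
  + by apply: smooth_continuous; exact: smooth_derive1.
  exists B => y t yx /andP[t0 t1].
  have nt : `|t ^+ k| <= 1 by rewrite normrX ger0_norm// exprn_ile1.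
  have nt1 : `|t| <= 1 by rewrite ger0_norm.
  have hb : `|derive1 f (x0 + t * (y - x0))| <= B.
    apply: hB.
    have : `|t * (y - x0)| <= `|x - x0| + 1.
      rewrite normrM (le_trans (ler_piMl _ nt1))//.
      have -> : y - x0 = (x - x0) + (y - x) by ring.
      by apply: le_trans (ler_normD _ _) _; rewrite lerD2l.
    by rewrite ler_norml => /andP[h1 h2]; apply/andP; split; clear - h1 h2; lra.
  rewrite !normrM -[B]mul1r ler_pM// ?mulr_ge0//.
  by rewrite -[B]mul1r ler_pM.
Qed.

Lemma smooth_moment x0 k f : smooth f -> smooth (moment x0 k f).
Proof.
move=> sf; apply: smooth_of_smooth_at => n x; elim: n k f sf => [//|n IH] k f sf; split.
  by near=> y; have := is_derive_moment x0 k y sf => ?; exact: ex_derive.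
apply: smooth_at_near (IH k.+1 _ (smooth_derive1 sf)).
by near=> y; rewrite derive1E; have := is_derive_moment x0 k y sf => ?; rewrite derive_val.
Unshelve. all: by end_near. Qed.

(** The quotient is the mean of the derivative of f over the segment from x0 to
    x, hence smooth in x. *)
Lemma hadamard x0 f : smooth f -> exists2 h, smooth h &
  forall x, f x = f x0 + (x - x0) * h x.
Proof.
move=> sf; exists (moment x0 0 (derive1 f)).
  exact/smooth_moment/smooth_derive1.
move=> x.
have -> : (x - x0) * moment x0 0 (derive1 f) x =
    \int[mu]_(t in `[0%R, 1%R]) ((x - x0) * derive1 f (x0 + t * (x - x0))).
  rewrite /moment -RintegralZl//.
    by apply: eq_Rintegral => t _; rewrite expr0 mul1r.
  apply: continuous_compact_integrable; first exact: segment_compact.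
  apply: continuous_subspaceT => t; apply: cvgM; first exact: exprn_continuous.
  by apply: continuous_affine_comp; apply: smooth_continuous; exact: smooth_derive1.
pose F t := f (x0 + t * (x - x0)).
have dF (t : R) : is_derive t 1 F ((x - x0) * derive1 f (x0 + t * (x - x0))).
  have h1 : is_derive t 1 (fun t : R => x0 + t * (x - x0)) (x - x0).
    by apply: is_derive_eq; rewrite /GRing.scale/=; ring.
  have h2 := smooth_is_derive (x0 + t * (x - x0)) sf.
  by rewrite mulrC; exact: is_derive1_comp.
have cF (t : R) : {for t, continuous F}.
  by apply: differentiable_continuous; apply/derivable1_diffP; have := dF t => ?; exact: ex_derive.
rewrite /Rintegral (@continuous_FTC2 _ _ F)//=.
- rewrite /F mul1r mul0r addr0 (addrC x0 (x - x0)) subrK; ring.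
- apply: continuous_subspaceT => t; apply: cvgM; first exact: cvg_cst.
  by apply: continuous_affine_comp; apply: smooth_continuous; exact: smooth_derive1.
- split.
  + by move=> t _; have := dF t => ?; exact: ex_derive.
  + by apply: cvg_at_right_filter; apply: cF.
  + by apply: cvg_at_left_filter; apply: cF.
- by move=> t _; rewrite derive1E; have := dF t => ?; rewrite derive_val.
Qed.

End Smooth.

Section Division.
Variable R : realType.
Implicit Types (f g h a q : R -> R) (x : R) (n k : nat).

Lemma smooth_derive1n k f : smooth f -> smooth (derive1n k f).
Proof.
elim: k f => [|k IH] f sf; first by [].
by rewrite derive1Sn; apply: IH; exact: smooth_derive1.
Qed.

Lemma derive1n_linear_factor x0 h k : smooth h ->
  derive1n k.+1 (fun x => (x - x0) * h x) =
  (fun x => (x - x0) * derive1n k.+1 h x + k.+1%:R * derive1n k h x).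
Proof.
move=> sh; elim: k => [|k IH].
  apply/funext => x; rewrite !derive1n1 derive1n0 derive1E.
  have dh := smooth_is_derive x sh.
  apply: (@derive_val _ _ _ x 1 (fun x => (x - x0) * h x)).
  by apply: is_derive_eq; rewrite /GRing.scale/= derive1E; ring.
rewrite derive1nS IH; apply/funext => x; rewrite derive1E.
have dh := smooth_is_derive x (@smooth_derive1n k.+1 _ sh).
have dh' := smooth_is_derive x (@smooth_derive1n k _ sh).
apply: (@derive_val _ _ _ x 1 (fun x => (x - x0) * derive1n k.+1 h x + k.+1%:R * derive1n k h x)).
apply: is_derive_eq; rewrite /GRing.scale/= -!derive1nS.
by rewrite -[k.+2%:R]natr1; ring.
Qed.

(** Hadamard's lemma repeated. The last clause carries the order of vanishing of
    f over to the quotient h. *)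
Lemma factor_zero x0 f k : smooth f ->
  (forall i, (i < k)%N -> derive1n i f x0 = 0) ->
  exists2 h, smooth h & (forall x, f x = (x - x0) ^+ k * h x) /\
    forall j, (derive1n (j + k) f x0 = 0) <-> (derive1n j h x0 = 0).
Proof.
elim: k f => [|k IH] f sf f0.
  exists f => //; split => [x|j]; first by rewrite expr0 mul1r.
  by rewrite addn0.
have [h1 sh1 fE] := hadamard x0 sf.
have {}fE : f = (fun x => (x - x0) * h1 x).
  have f00 : f x0 = 0 by exact: (f0 0%N).
  by apply/funext => x; rewrite fE f00 add0r.
have D i : derive1n i.+1 f x0 = i.+1%:R * derive1n i h1 x0.
  by rewrite fE derive1n_linear_factor// subrr mul0r add0r.
have D0 i : derive1n i.+1 f x0 = 0 <-> derive1n i h1 x0 = 0.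
  rewrite D; split => [/eqP|->]; last by rewrite mulr0.
  by rewrite mulf_eq0 pnatr_eq0/= => /eqP.
have [|h sh [hE hD]] := IH h1 sh1.
  by move=> i ik; apply/D0; exact: f0.
exists h => //; split => [x|j]; first by rewrite fE hE exprS mulrA.
by rewrite addnS D0.
Qed.

(** With k the order of q at x0, both q and a are divisible by (x - x0)^k; the
    quotient of q is invertible and that of a is still flat. At x0 the
    convention 0^-1 = 0 gives the right value. *)
Lemma flat_quotient a q x0 : smooth a -> smooth q -> (forall n, flat_at n a x0) ->
  (exists k, derive1n k q x0 != 0) -> forall n, flat_at n (fun x => a x / q x) x0.
Proof.
move=> sa sq fa exq n.
case: (ex_minnP exq) => k qk kmin.
have [|q1 sq1 [qE qD]] := @factor_zero x0 q k sq.
  by move=> i ik; apply/eqP; apply/negPn/negP => /kmin; rewrite leqNgt ik.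
have [|a1 sa1 [aE aD]] := @factor_zero x0 a k sa.
  by move=> i _; exact: flat_at_derive1n.
have q10 : q1 x0 != 0.
  by apply/eqP => /(qD 0%N); apply/eqP.
have fa1 : forall m, flat_at m a1 x0.
  by apply: flat_atP => // j; apply/aD; exact: flat_at_derive1n.
apply: flat_at_near (flat_atM (fa1 n) (smooth_atV q10 (smooth_at_of_smooth sq1 n x0))).
near=> y; rewrite aE qE.
have [->|yx0] := eqVneq y x0.
  have [a10 _] := fa1 0%N; rewrite a10.
  by rewrite mulr0 !mul0r.
rewrite invfM mulrACA divff ?mul1r//.
by rewrite expf_neq0// subr_eq0.
Unshelve. all: by end_near. Qed.

End Division.

Section Admissible.
Variable R : realType.
Implicit Types (f g h a b q : R -> R) (x : R) (n k s : nat).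

(** The factorizations are global; q vanishes at the critical points of g other
    than 0. *)
Record phase_form g h q s : Prop := PhaseForm {
  phase_s : (0 < s)%N ;
  phase_smooth : smooth g ;
  phase_smooth_h : smooth h ;
  phase_smooth_q : smooth q ;
  phaseE : forall x, g x = x ^+ s * h x ;
  phase_deriveE : forall x, derive1 g x = x ^+ s.-1 * q x ;
  phase_qE : forall x, q x = s%:R * h x + x * derive1 h x ;
  phase_h0 : h 0 != 0 }.

(** Amplitudes that remain smooth after division by q, whose zeros are the
    nonzero critical points of g. *)
Record admissible g a : Prop := Admissible {
  adm_smooth : smooth a ;
  adm_compact : exists M, forall x, M < `|x| -> a x = 0 ;
  adm_crit : forall x, x != 0 -> derive1 g x = 0 ->
    (\forall y \near x, a y = 0) \/
    ((forall n, flat_at n a x) /\ exists k, derive1n k (derive1 g) x != 0) }.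

Lemma admD g a b : admissible g a -> admissible g b ->
  admissible g (fun x => a x + b x).
Proof.
move=> [sa [Ma ca] ha] [sb [Mb cb] hb]; split.
- exact: smoothD.
- by exists (Num.max Ma Mb) => x; rewrite gt_max => /andP[? ?]; rewrite ca// cb// addr0.
move=> x x0 gx; have [a0|[fa k]] := ha x x0 gx; have [b0|[fb k']] := hb x x0 gx.
- by left; apply: filterS2 a0 b0 => y -> ->; rewrite addr0.
- right; split => // n; apply: flat_atD => //; apply: flat_at_near (flat_at_0 n x).
  by apply: filterS a0 => y ->.
- right; split => // n; apply: flat_atD => //; apply: flat_at_near (flat_at_0 n x).
  by apply: filterS b0 => y ->.
- by right; split => // n; exact: flat_atD.
Qed.

Lemma admM g a b : admissible g a -> smooth b -> admissible g (fun x => a x * b x).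
Proof.
move=> [sa [Ma ca] ha] sb; split.
- exact: smoothM.
- by exists Ma => x /ca ->; rewrite mul0r.
move=> x x0 gx; have [a0|[fa k]] := ha x x0 gx.
- by left; apply: filterS a0 => y ->; rewrite mul0r.
- by right; split => // n; apply: flat_atM => //; exact: smooth_at_of_smooth.
Qed.

Lemma adm_derive g a : admissible g a -> admissible g (derive1 a).
Proof.
move=> [sa [Ma ca] ha]; split.
- exact: smooth_derive1.
- exists Ma => x Mx.
  have : \forall y \near x, a y = (fun=> 0) y.
    have : \forall y \near x, Ma < `|y|.
      have := @norm_continuous R R x; move=> /(@cvgr_gt _ _ _ _ _)/(_ Ma Mx); exact.
    by apply: filterS => y /ca.
  by move=> /near_derive1/nbhs_singleton ->; rewrite derive1_cst.
move=> x x0 gx; have [a0|[fa k]] := ha x x0 gx.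
- left; have : \forall y \near x, a y = (fun=> 0) y by [].
  by move=> /near_derive1; apply: filterS => y ->; rewrite derive1_cst.
- by right; split => // n; have [_ []] := fa n.+1.
Qed.

Lemma phase_q0 g h q s : phase_form g h q s -> q 0 != 0.
Proof.
move=> P; rewrite (phase_qE P) mul0r addr0 mulf_neq0 ?(phase_h0 P)//.
by rewrite pnatr_eq0 -lt0n (phase_s P).
Qed.

Lemma phase_crit g h q s x : phase_form g h q s -> q x = 0 ->
  x != 0 /\ derive1 g x = 0.
Proof.
move=> P qx; split; last by rewrite (phase_deriveE P) qx mulr0.
by apply/eqP => x0; move: qx; rewrite x0; apply/eqP; exact: phase_q0 P.
Qed.

(** If q were flat at x, so would be g' = x^(s-1) q. *)
Lemma phase_finite_order g h q s x k : phase_form g h q s ->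
  derive1n k (derive1 g) x != 0 -> exists k, derive1n k q x != 0.
Proof.
move=> P gk; apply: contrapT => nq.
have fq : forall n, flat_at n q x.
  apply: flat_atP; first exact: (phase_smooth_q P).
  by move=> j; apply/eqP; apply/negPn/negP => qj; apply: nq; exists j.
have : forall n, flat_at n (derive1 g) x.
  move=> n; have sX : smooth_at n (fun y : R => y ^+ s.-1) x by apply: smooth_at_of_smooth; exact: smoothX.
  apply: flat_at_near (flat_atM (fq n) sX).
  by near=> y; rewrite (phase_deriveE P) mulrC.
by move=> /flat_at_derive1n/(_ k)/eqP; apply/negP.
Unshelve. all: by end_near. Qed.

Lemma adm_zero g a x : admissible g a -> x != 0 -> derive1 g x = 0 -> a x = 0.
Proof.
move=> A x0 gx; have [a0|[fa _]] := adm_crit A x0 gx; first exact: nbhs_singleton a0.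
by have [] := fa 0%N.
Qed.

Lemma adm_div g h q s a : phase_form g h q s -> admissible g a ->
  admissible g (fun x => a x / q x).
Proof.
move=> P A; have [sa [Ma ca] ha] := A; have sq := phase_smooth_q P.
have flat x : q x = 0 -> (\forall y \near x, a y / q y = 0) \/
    ((forall n, flat_at n (fun y => a y / q y) x) /\ exists k, derive1n k (derive1 g) x != 0).
  move=> qx; have [x0 gx] := phase_crit P qx.
  have [a0|[fa [k gk]]] := ha x x0 gx.
    by left; apply: filterS a0 => y ->; rewrite mul0r.
  right; split; last by exists k.
  by apply: flat_quotient => //; exact: phase_finite_order P gk.
split.
- apply: smooth_of_smooth_at => n x; have [qx|qx] := eqVneq (q x) 0.
    have [a0|[fa _]] := flat x qx; last by apply: smooth_at_of_flat_at; exact: fa.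
    by apply: smooth_at_near (smooth_at_cst n 0 x); apply: filterS a0 => y ->.
  by apply: smooth_atM; [exact: smooth_at_of_smooth|apply: smooth_atV => //; exact: smooth_at_of_smooth].
- by exists Ma => x /ca ->; rewrite mul0r.
move=> x x0 gx; apply: flat; apply/eqP; move: gx; rewrite (phase_deriveE P) => /eqP.
by rewrite mulf_eq0 expf_eq0 (negbTE x0) andbF.
Qed.

Lemma adm_divK g h q s a x : phase_form g h q s -> admissible g a ->
  q x * (a x / q x) = a x.
Proof.
move=> P A; have [qx|qx] := eqVneq (q x) 0; last by rewrite mulrC divfK.
by have [x0 gx] := phase_crit P qx; rewrite qx mul0r (adm_zero A x0 gx).
Qed.

End Admissible.

(** * Oscillatory integrals *)

Section Osc.
Variable R : realType.
Local Notation mu := (@lebesgue_measure R).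
Implicit Types (f g h a b q : R -> R) (x th tau : R).

(** The angles th = 0 and th = - pi / 2 give the real and imaginary parts of the
    integral of e^(i tau g) a; derivatives in tau and integrations by parts
    shift th by pi / 2. *)
Definition osc g a th tau : R := \int[mu]_(x in setT) (cos (tau * g x + th) * a x).

Definition compactly_supported a := exists M, forall x, M < `|x| -> a x = 0.

Lemma compact_range a b : compactly_supported a -> compactly_supported b ->
  exists2 B, 0 < B & forall x, ~ `[- B, B]%classic x -> a x = 0 /\ b x = 0.
Proof.
move=> [M hM] [M' hM']; exists (Num.max (Num.max M M') 0 + 1).
  by rewrite ltr_wpDl// le_max lexx orbT.
move=> x /= /negP; rewrite in_itv/= -ler_norml -ltNge => Bx.
have : Num.max (Num.max M M') 0 < `|x| by apply: lt_trans Bx; rewrite ltrDl.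
by rewrite !gt_max => /andP[/andP[? ?] _]; rewrite hM ?hM'.
Qed.

Lemma Rintegral_support f (A : set R) : (forall x, ~ A x -> f x = 0) ->
  \int[mu]_(x in setT) f x = \int[mu]_(x in A) f x.
Proof.
move=> h; rewrite [RHS]Rintegral_mkcond; congr Rintegral.
apply/funext => x; rewrite /patch; case: ifPn => //; rewrite notin_setE; exact: h.
Qed.

Lemma osc_cosE g a th tau (A : set R) : (forall x, ~ A x -> a x = 0) ->
  osc g a th tau = \int[mu]_(x in A) (cos (tau * g x + th) * a x).
Proof. by move=> h; apply: Rintegral_support => x /h ->; rewrite mulr0. Qed.

Lemma continuous_osc g a th tau : continuous g -> continuous a ->
  continuous (fun x => cos (tau * g x + th) * a x).
Proof.
move=> cg ca x; apply: cvgM; last exact: ca.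
apply: (cvg_comp (fun x => tau * g x + th) (@cos R)); last exact: continuous_cos.
by apply: cvgD; [apply: cvgM; [exact: cvg_cst|exact: cg]|exact: cvg_cst].
Qed.

Lemma integrable_itv f (A B : R) : continuous f ->
  mu.-integrable `[A, B] (EFin \o f).
Proof.
move=> cf; apply: continuous_compact_integrable; first exact: segment_compact.
exact: continuous_subspaceT.
Qed.

Lemma oscD g a b th tau : continuous g -> continuous a -> continuous b ->
  compactly_supported a -> compactly_supported b ->
  osc g (fun x => a x + b x) th tau = osc g a th tau + osc g b th tau.
Proof.
move=> cg ca cb sa sb; have [B B0 hB] := compact_range sa sb.
rewrite (@osc_cosE g (fun x => a x + b x) th tau `[- B, B]); last first.
  by move=> x /hB[-> ->]; rewrite addr0.
rewrite (@osc_cosE g a th tau `[- B, B]); last by move=> x /hB[].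
rewrite (@osc_cosE g b th tau `[- B, B]); last by move=> x /hB[].
rewrite -RintegralD//; last 2 first.
- by apply: integrable_itv; exact: continuous_osc.
- by apply: integrable_itv; exact: continuous_osc.
by apply: eq_Rintegral => x _; rewrite mulrDr.
Qed.

Lemma oscZ g a th tau (c : R) : continuous g -> continuous a ->
  compactly_supported a ->
  osc g (fun x => c * a x) th tau = c * osc g a th tau.
Proof.
move=> cg ca sa; have [B B0 hB] := compact_range sa sa.
rewrite (@osc_cosE g (fun x => c * a x) th tau `[- B, B]); last first.
  by move=> x /hB[-> _]; rewrite mulr0.
rewrite (@osc_cosE g a th tau `[- B, B]); last by move=> x /hB[].
rewrite -RintegralZl//; last by apply: integrable_itv; exact: continuous_osc.
by apply: eq_Rintegral => x _; rewrite mulrCA.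
Qed.

Lemma osc_bounded g a th : continuous g -> continuous a -> compactly_supported a ->
  exists2 C, 0 <= C & forall tau, `|osc g a th tau| <= C.
Proof.
move=> cg ca sa; have [B B0 hB] := compact_range sa sa.
exists (\int[mu]_(x in `[- B, B]) `|a x|).
  by apply: Rintegral_ge0 => x _.
move=> tau; rewrite (@osc_cosE g a th tau `[- B, B]); last by move=> x /hB[].
have ic : mu.-integrable `[- B, B] (EFin \o (fun x => cos (tau * g x + th) * a x)).
  by apply: integrable_itv; exact: continuous_osc.
have ia : mu.-integrable `[- B, B] (EFin \o (fun x => `|a x|)).
  by apply: integrable_itv => x; apply: continuous_comp; [exact: ca|exact: norm_continuous].
apply: le_trans (le_normr_Rintegral _ ic) _; first exact: measurable_itv.
apply: le_Rintegral => //.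
- by have := integrable_norm ic.
- move=> x _ /=; rewrite normrM ler_piMl//; exact: cos_max.
Qed.

Lemma is_derive_osc g a th tau : continuous g -> continuous a -> compactly_supported a ->
  is_derive tau 1 (osc g a th) (osc g (fun x => g x * a x) (th + pi / 2) tau).
Proof.
move=> cg ca sa; have [B B0 hB] := compact_range sa sa.
have -> : osc g a th = (fun tau => \int[mu]_(x in `[- B, B]) (cos (tau * g x + th) * a x)).
  by apply/funext => t; apply: osc_cosE => x /hB[].
rewrite (@osc_cosE g _ _ _ `[- B, B]); last by move=> x /hB[-> _]; rewrite mulr0.
apply: (@is_derive_integral _ (fun tau x => cos (tau * g x + th) * a x)
  (fun tau x => cos (tau * g x + (th + pi / 2)) * (g x * a x))).
- move=> t x; rewrite addrA cosDpihalf.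
  have h1 : is_derive t 1 (fun t : R => t * g x + th) (g x).
    by apply: is_derive_eq; rewrite /GRing.scale/=; ring.
  have h2 : is_derive t 1 (cos \o (fun t : R => t * g x + th)) (- sin (t * g x + th) * g x).
    by apply: is_derive1_comp.
  by apply: is_derive_eq; rewrite /GRing.scale/=; ring.
- by move=> t; exact: continuous_osc.
- have [||C C0 hC] := @continuous_bounded_itv R (fun x => g x * a x) (- B) B.
  + by clear - B0; lra.
  + by move=> x; apply: cvgM; [exact: cg|exact: ca].
  exists C => t x _ xB; rewrite normrM -[C]mul1r ler_pM ?hC//; exact: cos_max.
Qed.

Lemma osc_by_parts g b th tau : smooth g -> smooth b -> compactly_supported b ->
  tau * osc g (fun x => derive1 g x * b x) th tau =
  - osc g (derive1 b) (th - pi / 2) tau.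
Proof.
move=> sg sb cb.
have cg := smooth_continuous sg; have cb' := smooth_continuous sb.
have cg1 := smooth_continuous (smooth_derive1 sg).
have cb1 := smooth_continuous (smooth_derive1 sb).
have [B B0 hB] := compact_range cb cb.
have hb1 x : ~ `[- (B + 1), B + 1]%classic x -> derive1 b x = 0.
  move=> /= /negP; rewrite in_itv/= -ler_norml -ltNge => Bx.
  have : \forall y \near x, b y = (fun=> 0) y.
    have Bx' : B < `|x| by clear - Bx; lra.
    have := @norm_continuous R R x; move=> /(@cvgr_gt _ _ _ _ _)/(_ B Bx').
    apply: filterS => y By; have [] := hB y => //.
    by rewrite /= in_itv/= -ler_norml; apply/negP; rewrite -ltNge.
  by move=> /near_derive1/nbhs_singleton ->; rewrite derive1_cst.
have hb x : ~ `[- (B + 1), B + 1]%classic x -> b x = 0.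
  move=> /= /negP; rewrite in_itv/= -ler_norml -ltNge => Bx; have [] := hB x => //.
  rewrite /= in_itv/= -ler_norml; apply/negP; rewrite -ltNge; clear - Bx; lra.
pose B' := B + 1.
rewrite (@osc_cosE g _ th tau `[- B', B']); last by move=> x /hb ->; rewrite mulr0.
rewrite (@osc_cosE g _ _ tau `[- B', B']); last exact: hb1.
pose F x := sin (tau * g x + th) * b x.
pose f1 x := cos (tau * g x + th) * (derive1 g x * b x).
pose f2 x := cos (tau * g x + (th - pi / 2)) * derive1 b x.
have cf1 : continuous f1.
  apply: continuous_osc => // x; by apply: cvgM; [exact: cg1|exact: cb'].
have cf2 : continuous f2 by exact: continuous_osc.
have dF x : is_derive x 1 F (tau * f1 x + f2 x).
  rewrite /f1 /f2 addrA cosBpihalf.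
  have dg := smooth_is_derive x sg; have db := smooth_is_derive x sb.
  have h1 : is_derive x 1 (fun x => tau * g x + th) (tau * derive1 g x).
    by apply: is_derive_eq; rewrite /GRing.scale/=; ring.
  have h2 : is_derive x 1 (sin \o (fun x => tau * g x + th)) (cos (tau * g x + th) * (tau * derive1 g x)).
    by apply: is_derive1_comp.
  by apply: is_derive_eq; rewrite /GRing.scale/=; ring.
have cF x : {for x, continuous F}.
  by apply: differentiable_continuous; apply/derivable1_diffP; have := dF x => ?; exact: ex_derive.
have BB : - B' < B' by rewrite /B'; clear - B0; lra.
have FTC : \int[mu]_(x in `[- B', B']) (tau * f1 x + f2 x) = 0.
  rewrite /Rintegral (@continuous_FTC2 _ _ F)//=.
  - have FB y : B < `|y| -> F y = 0.
      move=> By; have [|bz _] := hB y; last by rewrite /F bz mulr0.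
      by rewrite /= in_itv/= -ler_norml; apply/negP; rewrite -ltNge.
    have nB : B < `|B'| by rewrite ger0_norm /B'; clear - B0; lra.
    by rewrite (FB B')// (FB (- B')) ?subr0// normrN.
  - apply: continuous_subspaceT => x; apply: cvgD; last exact: cf2.
    by apply: cvgM; [exact: cvg_cst|exact: cf1].
  - split.
    + by move=> x _; have := dF x => ?; exact: ex_derive.
    + by apply: cvg_at_right_filter; apply: cF.
    + by apply: cvg_at_left_filter; apply: cF.
  - by move=> x _; rewrite derive1E; have := dF x => ?; rewrite derive_val.
have i1 : mu.-integrable `[- B', B'] (EFin \o f1) by exact: integrable_itv.
rewrite -RintegralZl// -/f1 -/f2.
apply/eqP; rewrite -addr_eq0 -RintegralD//; first by rewrite FTC.
- by apply: integrable_itv => x; apply: cvgM; [exact: cvg_cst|exact: cf1].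
- exact: integrable_itv.
Qed.

End Osc.

(** * Asymptotic expansions *)

Section BigO.
Variable R : realType.
Implicit Types (F G dF : R -> R) (p q r t c : R).

Definition decays F p :=
  exists C, \forall t \near +oo, `|F t| <= C * t `^ (- p).

Lemma decaysW F p q : p <= q -> decays F q -> decays F p.
Proof.
move=> pq [C h]; exists `|C|; near=> t.
have t1 : 1 <= t by near: t; apply: nbhs_pinfty_ge; rewrite num_real.
have ht : `|F t| <= C * t `^ (- q) by near: t.
apply: (le_trans ht); apply: ler_pM => //.
- have pt : 0 < t `^ (- q) by rewrite powR_gt0// (lt_le_trans ltr01).
  by rewrite -(pmulr_lge0 _ pt) (le_trans _ ht).
- exact: powR_ge0.
- exact: ler_norm.
- by apply: ler_powR => //; rewrite lerN2.
Unshelve. all: by end_near. Qed.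

Lemma decays_near F G p : (\forall t \near +oo, F t = G t) -> decays F p -> decays G p.
Proof.
move=> e [C h]; exists C; apply: filterS2 e h => t <- //.
Qed.

Lemma decaysD F G p : decays F p -> decays G p -> decays (fun t => F t + G t) p.
Proof.
move=> [C h] [C' h']; exists (C + C'); apply: filterS2 h h' => t h h'.
by rewrite mulrDl; apply: le_trans (ler_normD _ _) _; exact: lerD.
Qed.

Lemma decaysZ F p c : decays F p -> decays (fun t => c * F t) p.
Proof.
move=> [C h]; exists (`|c| * C); apply: filterS h => t h.
by rewrite normrM -mulrA ler_wpM2l.
Qed.

Lemma decays_powR c p : decays (fun t => c * t `^ (- p)) p.
Proof.
exists `|c|; near=> t; rewrite normrM ler_wpM2l// ger0_norm// powR_ge0.
Unshelve. all: by end_near. Qed.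

Lemma decays0 p : decays (fun=> 0) p.
Proof. by exists 0; near=> t; rewrite normr0 mul0r. Unshelve. all: by end_near. Qed.

Lemma decays_sum (I : eqType) (s : seq I) (Fs : I -> R -> R) p :
  (forall i, i \in s -> decays (Fs i) p) -> decays (fun t => \sum_(i <- s) Fs i t) p.
Proof.
elim: s => [|i s IH] h.
  by apply: decays_near (decays0 p); near=> t; rewrite big_nil.
have h1 : decays (Fs i) p by apply: h; rewrite mem_head.
have h2 : decays (fun t => \sum_(i <- s) Fs i t) p.
  by apply: IH => j js; apply: h; rewrite inE js orbT.
by apply: decays_near (decaysD h1 h2); near=> t; rewrite big_cons.
Unshelve. all: by end_near. Qed.

Lemma decays_le0 c p r : p < r -> decays (fun t => c * t `^ (- p)) r -> c = 0.
Proof.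
move=> pr [C h]; apply/eqP; rewrite -normr_eq0; apply/eqP.
apply: le_anti; rewrite normr_ge0 andbT.
apply/ler_addgt0Pr => e e0; rewrite add0r.
near (pinfty_nbhs R) => t.
have t0 : 0 < t by near: t; apply: nbhs_pinfty_gt; rewrite num_real.
have ht : `|c * t `^ (- p)| <= C * t `^ (- r) by near: t.
have pt : 0 < t `^ (- p) by exact: powR_gt0.
have tC : t `^ (- (r - p)) <= e / (`|C| + 1).
  by near: t; apply: near_powRN_le; rewrite ?subr_gt0// divr_gt0// ltr_wpDl.
have -> : `|c| = `|c * t `^ (- p)| / t `^ (- p).
  by rewrite normrM (gtr0_norm pt) mulfK// gt_eqF.
rewrite ler_pdivrMr//; apply: (le_trans ht).
have -> : t `^ (- r) = t `^ (- (r - p)) * t `^ (- p).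
  by rewrite -powRD; [congr (_ `^ _); ring|rewrite (gt_eqF t0) implybT].
rewrite mulrA ler_wpM2r ?(ltW pt)//.
apply: (@le_trans _ _ ((`|C| + 1) * t `^ (- (r - p)))).
  by rewrite ler_wpM2r ?powR_ge0// (le_trans (ler_norm _))// lerDl.
by rewrite mulrC -ler_pdivlMr// ltr_wpDl.
Unshelve. all: by end_near. Qed.

(** H = t^p F has a derivative bounded by M t^(-q-1) with q = r - p, so H -
    (M/q) t^(-q) increases, H + (M/q) t^(-q) decreases, and both have the limit
    C. *)
Lemma decaying_ode F dF p r : p < r ->
  (forall t, 0 < t -> is_derive t 1 F (dF t)) ->
  decays (fun t => t * dF t + p * F t) r ->
  exists C, decays (fun t => F t - C * t `^ (- p)) r.
Proof.
move=> pr hF [M [T [_ hM]]].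
pose q := r - p; have q0 : 0 < q by rewrite subr_gt0.
pose T1 := Num.max T 0 + 1.
have T10 : 0 < T1 by rewrite ltr_wpDl// le_max lexx orbT.
have T1T t : T1 <= t -> T < t.
  by apply: lt_le_trans; rewrite /T1 ltr_pwDr// le_max lexx.
have TT1 t : T1 <= t -> 0 < t by exact: lt_le_trans.
pose H t := t `^ p * F t.
pose H' t := t `^ (p - 1) * (t * dF t + p * F t).
have dH t : 0 < t -> is_derive t 1 H (H' t).
  move=> t0; have d1 := hF t t0; have d2 := is_derive_powR p t0.
  apply: is_derive_eq; rewrite /GRing.scale/= /H'.
  have -> : t `^ p = t * t `^ (p - 1).
    by rewrite powRB ?(gt_eqF t0) ?implybT// powRr1 ?(ltW t0)// mulrCA divff ?mulr1// gt_eqF.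
  ring.
have H'le t : T1 <= t -> `|H' t| <= M * t `^ (- q - 1).
  move=> tT; have t0 := TT1 t tT; rewrite /H' normrM ger0_norm ?powR_ge0//.
  apply: le_trans (ler_wpM2l (powR_ge0 _ _) (hM _ (T1T _ tT))) _.
  rewrite mulrCA ler_wpM2l//; last first.
    by rewrite -powRD ?(gt_eqF t0) ?implybT// le_eqVlt; apply/orP; left; apply/eqP; congr (_ `^ _); rewrite /q; ring.
  have := le_trans (normr_ge0 _) (hM _ (T1T _ tT)).
  by rewrite pmulr_lge0// powR_gt0.
pose L t := H t - M / q * t `^ (- q).
pose U t := H t + M / q * t `^ (- q).
have dL t : 0 < t -> is_derive t 1 L (H' t + M * t `^ (- q - 1)).
  move=> t0; have d1 := dH t t0; have d2 := is_derive_powR (- q) t0.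
  by apply: is_derive_eq; rewrite /GRing.scale/=; field; rewrite gt_eqF.
have dU t : 0 < t -> is_derive t 1 (fun t => - U t) (- (H' t - M * t `^ (- q - 1))).
  move=> t0; have d1 := dH t t0; have d2 := is_derive_powR (- q) t0.
  by apply: is_derive_eq; rewrite /GRing.scale/=; field; rewrite gt_eqF.
have Linc t t' : T1 <= t -> t <= t' -> L t <= L t'.
  move=> Tt tt'; apply: (nondecreasing_derive_ge0 tt').
    by move=> x /andP[tx _]; apply: dL; rewrite (lt_le_trans (TT1 _ Tt)).
  move=> x /andP[tx _]; have := H'le x (le_trans Tt tx); rewrite ler_norml => /andP[h _].
  by clear - h; lra.
have Udec t t' : T1 <= t -> t <= t' -> U t' <= U t.
  move=> Tt tt'; rewrite -lerN2; apply: (@nondecreasing_derive_ge0 R (fun t => - U t) _ _ _ tt').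
    by move=> x /andP[tx _]; apply: dU; rewrite (lt_le_trans (TT1 _ Tt)).
  move=> x /andP[tx _]; have := H'le x (le_trans Tt tx); rewrite ler_norml => /andP[_ h].
  by clear - h; lra.
have M0 : 0 <= M.
  have := le_trans (normr_ge0 _) (hM _ (T1T _ (lexx T1))).
  by rewrite pmulr_lge0// powR_gt0.
have LU t : L t <= U t.
  have : 0 <= M / q * t `^ (- q) by rewrite mulr_ge0 ?powR_ge0// divr_ge0// ltW.
  by rewrite /L /U; clear; lra.
have LUt t t' : T1 <= t -> T1 <= t' -> L t <= U t'.
  move=> Tt Tt'; have [tt'|t't] := leP t t'.
    exact: le_trans (Linc _ _ Tt tt') (LU t').
  exact: le_trans (LU t) (Udec _ _ Tt' (ltW t't)).
pose A := [set L t | t in [set t | T1 <= t]].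
have A0 : A !=set0 by exists (L T1), T1 => /=.
pose C := sup A.
have CU t : T1 <= t -> C <= U t.
  by move=> Tt; apply: ge_sup => // _ [t' /= Tt' <-]; exact: LUt.
have LC t : T1 <= t -> L t <= C.
  move=> Tt; apply: ub_le_sup; last by exists t.
  by exists (U T1) => _ [t' /= Tt' <-]; apply: LUt => /=.
exists C, (M / q); near=> t.
have Tt : T1 <= t by near: t; apply: nbhs_pinfty_ge; rewrite num_real.
have t0 := TT1 t Tt.
have FE : F t = t `^ (- p) * H t.
  by rewrite /H mulrA powRN mulVf ?mul1r// gt_eqF// powR_gt0.
rewrite FE [C * _]mulrC -mulrBr normrM ger0_norm ?powR_ge0//.
have -> : t `^ (- r) = t `^ (- p) * t `^ (- q).
  by rewrite -powRD ?(gt_eqF t0) ?implybT//; congr (_ `^ _); rewrite /q; ring.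
rewrite mulrCA ler_wpM2l ?powR_ge0// ler_norml.
have := LC t Tt; have := CU t Tt; rewrite /L /U => h1 h2.
by apply/andP; split; clear - h1 h2; lra.
Unshelve. all: by end_near. Qed.

End BigO.

Section Expansion.
Variable R : realType.
Implicit Types (f g h a b q : R -> R) (x th t tau : R) (m n k s N : nat).

Lemma adm_compactly_supported g a : admissible g a -> compactly_supported a.
Proof. by case. Qed.

Lemma admX g a m : admissible g a -> admissible g (fun x => x ^+ m * a x).
Proof.
move=> A; have := admM A (@smoothX R m).
by congr admissible; apply/funext => x; rewrite mulrC.
Qed.

Lemma derive1_monomialM m b x : smooth b ->
  derive1 (fun x => x ^+ m * b x) x = m%:R * x ^+ m.-1 * b x + x ^+ m * derive1 b x.
Proof.
move=> sb; have db := smooth_is_derive x sb; rewrite derive1E.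
apply: (@derive_val _ _ _ x 1 (fun x => x ^+ m * b x)).
have dX : is_derive x 1 (fun x : R => x ^+ m) (m%:R * x ^+ m.-1).
  apply: DeriveDef; first exact: exprn_derivable.
  by rewrite exp_derive /GRing.scale/= mulr1.
by apply: is_derive_eq; rewrite /GRing.scale/=; ring.
Qed.

Lemma adm_by_parts g b th t : smooth g -> admissible g b ->
  t * osc g (fun x => derive1 g x * b x) th t = - osc g (derive1 b) (th - pi / 2) t.
Proof. by move=> sg [sb cb _]; exact: osc_by_parts. Qed.

Lemma adm_oscD g a b th t : smooth g -> admissible g a -> admissible g b ->
  osc g (fun x => a x + b x) th t = osc g a th t + osc g b th t.
Proof.
move=> sg A B; apply: oscD; rewrite ?(adm_compactly_supported A) ?(adm_compactly_supported B)//.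
- exact: smooth_continuous.
- exact: smooth_continuous (adm_smooth A).
- exact: smooth_continuous (adm_smooth B).
- exact: adm_compactly_supported A.
- exact: adm_compactly_supported B.
Qed.

Lemma adm_oscZ g a th t (c : R) : smooth g -> admissible g a ->
  osc g (fun x => c * a x) th t = c * osc g a th t.
Proof.
move=> sg A; apply: oscZ.
- exact: smooth_continuous.
- exact: smooth_continuous (adm_smooth A).
- exact: adm_compactly_supported A.
Qed.

Lemma osc_is_derive g a th t : smooth g -> admissible g a ->
  is_derive t 1 (osc g a th) (osc g (fun x => g x * a x) (th + pi / 2) t).
Proof.
move=> sg A; apply: is_derive_osc.
- exact: smooth_continuous.
- exact: smooth_continuous (adm_smooth A).
- exact: adm_compactly_supported A.
Qed.

(** As g = x^s h and g' = x^(s-1) q, the amplitude g x^m a of the derivative is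
    g' b with b = x^(m+1) a h / q. Integrating by parts leaves b', which is
    ((m+1)/s) x^m a plus a multiple of x^(m+1) because q = s h + x h'. *)
Lemma osc_ode g h q s a m : phase_form g h q s -> admissible g a ->
  exists2 a2, admissible g a2 & forall th t,
    t * osc g (fun x => g x * (x ^+ m * a x)) (th + pi / 2) t +
    m.+1%:R / s%:R * osc g (fun x => x ^+ m * a x) th t =
    - osc g (fun x => x ^+ m.+1 * a2 x) th t.
Proof.
move=> P A; have s0 : s%:R != 0 :> R by rewrite pnatr_eq0 -lt0n (phase_s P).
have sg := phase_smooth P; have sh := phase_smooth_h P.
pose e x := a x / q x; have Ae : admissible g e by exact: adm_div P A.
have hq x : q x * e x = a x by exact: adm_divK P A.
pose c x := e x * h x; have Ac : admissible g c by exact: admM.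
have cE x : s%:R * c x = a x - x * derive1 h x * e x.
  by rewrite -(hq x) (phase_qE P) /c; ring.
pose a2 x := derive1 c x + - (m.+1%:R / s%:R) * (e x * derive1 h x).
have Ah : admissible g (fun x => e x * derive1 h x).
  by apply: admM => //; exact: smooth_derive1.
have AZ (k : R) b : admissible g b -> admissible g (fun x => k * b x).
  move=> Ab; have := admM Ab (@smooth_cst R k).
  by congr admissible; apply/funext => x; rewrite mulrC.
have A2 : admissible g a2 by apply: admD; [exact: adm_derive|exact: AZ].
exists a2 => // th t.
pose b x := x ^+ m.+1 * c x.
have Ab : admissible g b by exact: admX.
rewrite (_ : (fun x => g x * _) = (fun x => derive1 g x * b x)); last first.
  apply/funext => x; rewrite (phase_deriveE P) /b /c (phaseE P) -(hq x).
  rewrite -[in LHS](prednK (phase_s P)) !exprS; ring.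
rewrite adm_by_parts// addrK.
have -> : derive1 b = (fun x => m.+1%:R / s%:R * (x ^+ m * a x) + x ^+ m.+1 * a2 x).
  apply/funext => x; rewrite (derive1_monomialM m.+1 x (adm_smooth Ac)) /a2.
  have -> : a x = s%:R * c x + x * derive1 h x * e x by rewrite cE; ring.
  by rewrite exprS /=; field.
rewrite (@adm_oscD g (fun x => m.+1%:R / s%:R * (x ^+ m * a x)) (fun x => x ^+ m.+1 * a2 x))//; last 2 first.
- by apply: AZ; exact: admX.
- exact: admX.
rewrite (@adm_oscZ g (fun x => x ^+ m * a x))//; last exact: admX.
ring.
Qed.

Lemma osc_ode_decays g h q s a m th r : phase_form g h q s -> admissible g a ->
  (forall a2, admissible g a2 -> decays (osc g (fun x => x ^+ m.+1 * a2 x) th) r) ->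
  m.+1%:R / s%:R < r ->
  exists C, decays (fun t => osc g (fun x => x ^+ m * a x) th t - C * t `^ (- (m.+1%:R / s%:R))) r.
Proof.
move=> P A IH pr; have [a2 A2 E] := osc_ode m P A.
apply: (@decaying_ode R _ (osc g (fun x => g x * (x ^+ m * a x)) (th + pi / 2))) => //.
- by move=> t _; apply: osc_is_derive; [exact: phase_smooth P|exact: admX].
- apply: decays_near (decaysZ (-1) (IH _ A2)).
  by near=> t; rewrite E mulN1r.
Unshelve. all: by end_near. Qed.

(** The amplitude contains k + 1 factors g' = x^(s-1) q separated by factors x,
    each of which is integrated by parts and gives a factor 1/t. *)
Lemma osc_decays_base g h q s k a th : phase_form g h q s -> admissible g a ->
  decays (osc g (fun x => x ^+ (k.+1 * s).-1 * a x) th) k.+1%:R.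
Proof.
move=> P; elim: k a th => [|k IH] a th A;
  have sg := phase_smooth P; have s0 := phase_s P.
  have Ae := adm_div P A.
  rewrite (_ : (fun x => _) = (fun x => derive1 g x * (a x / q x))); last first.
    by apply/funext => x; rewrite (phase_deriveE P) -mulrA (adm_divK x P A) mul1n.
  have [C C0 hC] := @osc_bounded R g (derive1 (fun x => a x / q x)) (th - pi / 2)
    (smooth_continuous sg) (smooth_continuous (smooth_derive1 (adm_smooth Ae)))
    (adm_compactly_supported (adm_derive Ae)).
  exists C; near=> t.
  have t0 : 0 < t by near: t; apply: nbhs_pinfty_gt; rewrite num_real.
  rewrite powR_inv1 ?(ltW t0)// ler_pdivlMr//.
  rewrite -{2}(gtr0_norm t0) -normrM mulrC adm_by_parts// normrN; exact: hC.
have Ae := adm_div P A.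
pose b x := x ^+ (k.+1 * s) * (a x / q x).
have Ab : admissible g b by exact: admX.
pose a' x := (k.+1 * s)%:R * (a x / q x) + x * derive1 (fun x => a x / q x) x.
have AZ (l : R -> R) d : smooth l -> admissible g d -> admissible g (fun x => l x * d x).
  move=> sl Ad; have := admM Ad sl.
  by congr admissible; apply/funext => x; rewrite mulrC.
have Aa' : admissible g a'.
  apply: admD; first by apply: AZ => //; exact: smooth_cst.
  by apply: AZ; [exact: smooth_id|exact: adm_derive].
rewrite (_ : (fun x => _) = (fun x => derive1 g x * b x)); last first.
  apply/funext => x; rewrite (phase_deriveE P) /b.
  have -> : (k.+2 * s).-1 = (s.-1 + k.+1 * s)%N by rewrite mulSn; lia.
  rewrite exprD -{1}(adm_divK x P A); move: (a x / q x) => y; ring.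
have [C hC] := IH a' (th - pi / 2) Aa'.
exists C; near=> t.
have t0 : 0 < t by near: t; apply: nbhs_pinfty_gt; rewrite num_real.
have ht : `|osc g (fun x => x ^+ (k.+1 * s).-1 * a' x) (th - pi / 2) t| <= C * t `^ (- k.+1%:R) by near: t.
have -> : C * t `^ (- k.+2%:R) = C * t `^ (- k.+1%:R) / t.
  rewrite -mulrA; congr (_ * _); rewrite -[X in _ / X](powRr1 (ltW t0)) -powRB ?(gt_eqF t0) ?implybT//.
  by congr (_ `^ _); rewrite -[k.+2%:R]natr1; ring.
rewrite ler_pdivlMr//.
rewrite -{2}(gtr0_norm t0) -normrM mulrC adm_by_parts// normrN.
apply: le_trans ht; rewrite le_eqVlt; apply/orP; left; apply/eqP; congr (`|osc g _ _ _|).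
apply/funext => x; rewrite (derive1_monomialM (k.+1 * s) x (adm_smooth Ae)) /a'.
have -> : x ^+ (k.+1 * s) = x * x ^+ (k.+1 * s).-1.
  by rewrite -exprS prednK// muln_gt0 s0.
ring.
Unshelve. all: by end_near. Qed.

(** Induction downwards from an exponent covered by osc_decays_base. *)
Lemma osc_decays g h q s m a th : phase_form g h q s -> admissible g a ->
  decays (osc g (fun x => x ^+ m * a x) th) (m.+1%:R / s%:R).
Proof.
move=> P; have s0 := phase_s P.
have sR : 0 < s%:R :> R by rewrite ltr0n.
suff H (K d : nat) : forall m a th, (m + d)%N = (K.+1 * s).-1 -> admissible g a ->
    decays (osc g (fun x => x ^+ m * a x) th) (m.+1%:R / s%:R).
  move=> A; apply: (H m ((m.+1 * s).-1 - m)%N) => //.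
  by rewrite subnKC// -ltnS prednK ?muln_gt0 ?s0// leq_pmulr.
elim: d => [|d IH] {}m {}a {}th md A.
  rewrite addn0 in md; rewrite md prednK ?muln_gt0 ?s0//.
  rewrite natrM mulfK; first exact: osc_decays_base P A.
  by rewrite gt_eqF.
have pr : m.+1%:R / s%:R < m.+2%:R / s%:R :> R by rewrite ltr_pM2r ?invr_gt0// ltr_nat.
have [|C hC] := @osc_ode_decays g h q s a m th (m.+2%:R / s%:R) P A _ pr.
  by move=> a2 A2; apply: IH => //; rewrite addSn -addnS.
have := decaysD (decaysW (ltW pr) hC) (decays_powR C (m.+1%:R / s%:R)).
by apply: decays_near; near=> t; rewrite subrK.
Unshelve. all: by end_near. Qed.

(** Induction downwards on m. If the integral on the right of osc_ode has terms
    c_j t^(-j/s), subtracting from F the solutions c_j / (j/s - p) t^(-j/s), p =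
    (m+1)/s, leaves an equation whose right-hand side is as small as the error
    allowed. *)
Lemma osc_expansion g h q s N m a th : phase_form g h q s -> (m <= N)%N ->
  admissible g a -> exists C : nat -> R,
  decays (fun t => osc g (fun x => x ^+ m * a x) th t -
    \sum_(m.+1 <= j < N.+1) C j * t `^ (- (j%:R / s%:R))) (N.+1%:R / s%:R).
Proof.
move=> P mN; have s0 := phase_s P; have sR : 0 < s%:R :> R by rewrite ltr0n.
move: (subnK mN); move: (N - m)%N => d; elim: d m a th {mN} => [|d IH] m a th md A.
  exists (fun=> 0); rewrite add0n in md; rewrite -md.
  apply: decays_near (osc_decays m th P A).
  by near=> t; rewrite big_geq// subr0.
have [a2 A2 E] := osc_ode m P A.
have md' : (d + m.+1 = N)%N by rewrite addnS.
have [c hc] := IH m.+1 a2 th md' A2.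
pose p : R := m.+1%:R / s%:R.
(* coefficients of the solution of the equation with right-hand side the
   expansion c *)
pose C j := - c j / (p - j%:R / s%:R).
pose S t := \sum_(m.+2 <= j < N.+1) C j * t `^ (- (j%:R / s%:R)).
pose S' t := \sum_(m.+2 <= j < N.+1) C j * (- (j%:R / s%:R) * t `^ (- (j%:R / s%:R) - 1)).
have dS t : 0 < t -> is_derive t 1 S (S' t).
  move=> t0; rewrite /S /S' /index_iota; elim: (iota _ _) => [|j l IHl].
    rewrite big_nil (_ : (fun _ => _) = cst 0); first exact: is_derive_cst.
    by apply/funext => x; rewrite big_nil.
  rewrite big_cons.
  rewrite (_ : (fun _ => _) = (fun x => C j * x `^ (- (j%:R / s%:R)) + \sum_(j <- l) C j * x `^ (- (j%:R / s%:R)))); last first.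
    by apply/funext => x; rewrite big_cons.
  have d1 := is_derive_powR (- (j%:R / s%:R)) t0.
  by apply: is_derive_eq; rewrite /GRing.scale/=; ring.
have sg := phase_smooth P.
have Am : admissible g (fun x => x ^+ m * a x) by exact: admX.
pose F t := osc g (fun x => x ^+ m * a x) th t - S t.
pose dF t := osc g (fun x => g x * (x ^+ m * a x)) (th + pi / 2) t - S' t.
have dFE t : 0 < t -> is_derive t 1 F (dF t).
  by move=> t0; have h1 := osc_is_derive th t sg Am; have h2 := dS t t0; exact: is_deriveB.
have pN : p < N.+1%:R / s%:R.
  by rewrite ltr_pM2r ?invr_gt0// ltr_nat ltnS -md' leq_addl.
have [|C0 hC0] := @decaying_ode R F dF p (N.+1%:R / s%:R) pN dFE.
  apply: decays_near (decaysZ (-1) hc); near=> t.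
  have t0 : 0 < t by near: t; apply: nbhs_pinfty_gt; rewrite num_real.
  rewrite mulN1r opprB /F /dF mulrBr mulrBr addrACA E.
  have -> : - (t * S' t) - p * S t = \sum_(m.+2 <= j < N.+1) c j * t `^ (- (j%:R / s%:R)).
    rewrite /S /S' !mulr_sumr -!sumrN -big_split/=; apply: eq_big_nat => j /andP[mj jN].
    have tE : t `^ (- (j%:R / s%:R)) = t * t `^ (- (j%:R / s%:R) - 1).
      by rewrite powRB ?(gt_eqF t0) ?implybT// powRr1 ?(ltW t0)// mulrCA divff ?mulr1// gt_eqF.
    have jp : p - j%:R / s%:R != 0.
      by rewrite lt_eqF// subr_lt0 ltr_pM2r ?invr_gt0// ltr_nat.
    rewrite tE /C; move: (t `^ _) => y; move: (j%:R / s%:R) jp => v jp; field.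
    exact: jp.
  by rewrite addrC.
exists (fun j => if j == m.+1 then C0 else C j).
apply: decays_near hC0; near=> t.
rewrite big_ltn ?eqxx; last by rewrite -md'; lia.
rewrite (_ : \sum_(m.+2 <= j < N.+1) _ = S t); first by rewrite /F /p; ring.
rewrite /S; apply: eq_big_nat => j /andP[mj jN].
by rewrite gtn_eqF.
Unshelve. all: by end_near. Qed.

End Expansion.

Section Coefficients.
Variable R : realType.
Implicit Types (f g h a b q F : R -> R) (x th t : R) (m n k s N M : nat) (C : nat -> R).

Lemma power_sum_eq0 s M C : (0 < s)%N ->
  decays (fun t => \sum_(1 <= j < M.+1) C j * t `^ (- (j%:R / s%:R))) (M.+1%:R / s%:R) ->
  forall j, (0 < j <= M)%N -> C j = 0.
Proof.
move=> s0 hC; have sR : 0 < s%:R :> R by rewrite ltr0n.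
elim/ltn_ind => j IH /andP[j0 jM].
have jlt (i : nat) : (j < i)%N -> j%:R / s%:R < i%:R / s%:R :> R.
  by move=> ji; rewrite ltr_pM2r ?invr_gt0// ltr_nat.
apply: (decays_le0 (jlt j.+1 (ltnSn _))).
have jlt' (i : nat) : (j < i)%N -> j.+1%:R / s%:R <= i%:R / s%:R :> R.
  by move=> ji; rewrite ler_pM2r ?invr_gt0// ler_nat.
have tail : decays (fun t => -1 * \sum_(i <- index_iota j.+1 M.+1) C i * t `^ (- (i%:R / s%:R))) (j.+1%:R / s%:R).
  apply: decaysZ; apply: decays_sum => i; rewrite mem_index_iota => /andP[ji _].
  exact: decaysW (jlt' i ji) (decays_powR _ _).
have jM1 : (j < M.+1)%N by [].
apply: decays_near (decaysD (decaysW (jlt' M.+1 jM1) hC) tail).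
near=> t; rewrite mulN1r (big_cat_nat _ (n := j))//=; last exact: ltnW.
rewrite (big_ltn jM1) big_nat_cond big1 ?add0r ?addrK// => i; rewrite andbT => /andP[i0 ij].
by rewrite IH ?mul0r// i0 ltnW// (leq_trans ij)// ltnW.
Unshelve. all: by end_near. Qed.

Definition expands F s C := forall N,
  decays (fun t => F t - \sum_(1 <= j < N.+1) C j * t `^ (- (j%:R / s%:R))) (N.+1%:R / s%:R).

(** The coefficients of osc_expansion a priori depend on N; uniqueness
    (power_sum_eq0) makes them compatible. *)
Lemma osc_expands g h q s a th : phase_form g h q s -> admissible g a ->
  exists C, expands (osc g a th) s C.
Proof.
move=> P A; have s0 := phase_s P; have sR : 0 < s%:R :> R by rewrite ltr0n.
have E N : exists c : nat -> R,
    decays (fun t => osc g a th t - \sum_(1 <= j < N.+1) c j * t `^ (- (j%:R / s%:R))) (N.+1%:R / s%:R).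
  have [c hc] := osc_expansion th P (leq0n N) A; exists c.
  move: hc; rewrite (_ : (fun x => x ^+ 0 * a x) = a)//.
  by apply/funext => x; rewrite expr0 mul1r.
have [c hc] := choice E; exists (fun j => c j j) => N.
have cE j : (0 < j < N.+1)%N -> c N j = c j j.
  move=> /andP[j0 jN]; apply/eqP; rewrite -subr_eq0; apply/eqP.
  apply: (@power_sum_eq0 s j (fun i => c N i - c j i) s0); last by rewrite j0 leqnn.
  have le1 (i : nat) : (j < i)%N -> j.+1%:R / s%:R <= i%:R / s%:R :> R.
    by move=> ji; rewrite ler_pM2r ?invr_gt0// ler_nat.
  have tail : decays (fun t => -1 * \sum_(i <- index_iota j.+1 N.+1) c N i * t `^ (- (i%:R / s%:R))) (j.+1%:R / s%:R).
    apply: decaysZ; apply: decays_sum => i; rewrite mem_index_iota => /andP[ji _].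
    exact: decaysW (le1 i ji) (decays_powR _ _).
  have := decaysD (decaysD (hc j) (decaysZ (-1) (decaysW (le1 N.+1 jN) (hc N)))) tail.
  apply: decays_near; near=> t.
  have -> : \sum_(1 <= i < N.+1) c N i * t `^ (- (i%:R / s%:R)) =
      \sum_(1 <= i < j.+1) c N i * t `^ (- (i%:R / s%:R)) +
      \sum_(j.+1 <= i < N.+1) c N i * t `^ (- (i%:R / s%:R)).
    by rewrite -big_cat_nat.
  under [RHS]eq_bigr do rewrite mulrBl; rewrite sumrB.
  ring.
apply: decays_near (hc N); near=> t; congr (_ - _); apply: eq_big_nat => j jN.
by rewrite cE.
Unshelve. all: by end_near. Qed.

Lemma expands_lead F s C : (0 < s)%N -> expands F s C ->
  decays (fun t => F t - C 1%N * t `^ (- s%:R^-1)) (2 / s%:R).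
Proof. by move=> s0 /(_ 1%N); apply: decays_near; near=> t; rewrite big_nat1 div1r. Unshelve. all: by end_near. Qed.

Lemma lead_unique F (p r c c' : R) : p < r ->
  decays (fun t => F t - c * t `^ (- p)) r -> decays (fun t => F t - c' * t `^ (- p)) r -> c = c'.
Proof.
move=> pr h h'; apply/eqP; rewrite -subr_eq0; apply/eqP; apply: (decays_le0 pr).
apply: decays_near (decaysD h' (decaysZ (-1) h)); near=> t; ring.
Unshelve. all: by end_near. Qed.

(** If a vanishes at 0, then a = x a1 with a1 admissible. *)
Lemma osc_lead0 g h q s a th : phase_form g h q s -> admissible g a -> a 0 = 0 ->
  decays (osc g a th) (2 / s%:R).
Proof.
move=> P A a0; have [sa [M hM] crit] := A.
have [a1 sa1 aE] := hadamard 0 sa.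
have aE' x : a x = x * a1 x by rewrite aE a0 add0r subr0.
have a1E x : x != 0 -> a1 x = a x / x by move=> x0; rewrite aE' mulrC mulKf.
have A1 : admissible g a1.
  split => //.
    exists (Num.max M 0) => x; rewrite gt_max => /andP[Mx]; rewrite normr_gt0 => x0.
    by rewrite a1E// hM// mul0r.
  move=> x x0 gx; have nx : \forall y \near x, y != 0.
    apply: open_nbhs_nbhs; split => //; exact: open_neq.
  have [hz|[fa fin]] := crit x x0 gx; [left|right; split=> // n].
    by apply: filterS2 nx hz => y y0 ay; rewrite a1E// ay mul0r.
  apply: (@flat_at_near R n (fun y => a y / y)).
    by apply: filterS nx => y y0; rewrite a1E.
  apply: flat_quotient => //; first exact: smooth_id.
  by exists 0%N.
have := osc_decays 1 th P A1.
by congr decays; apply/funext => t; congr osc; apply/funext => x; rewrite aE' expr1.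
Unshelve. all: by end_near. Qed.

(** The case m = 0 of osc_ode, which spares differentiating an asymptotic
    expansion. *)
Lemma osc_derive_lead g h q s a th : phase_form g h q s -> admissible g a ->
  decays (fun t => t * osc g (fun x => g x * a x) (th + pi / 2) t + s%:R^-1 * osc g a th t) (2 / s%:R).
Proof.
move=> P A; have [a2 A2 E] := osc_ode 0 P A.
have := decaysZ (-1) (osc_decays 1 th P A2); apply: decays_near; near=> t.
rewrite mulN1r -E div1r; congr (_ * osc _ _ _ _ + _ * osc _ _ _ _); apply/funext => x;
  by rewrite expr0 mul1r.
Unshelve. all: by end_near. Qed.

End Coefficients.

(** * Positivity of the leading coefficient *)

Section Positivity.
Variable R : realType.
Local Notation mu := (@lebesgue_measure R).
Implicit Types (f g h a b q F phi : R -> R) (x y th t : R) (m n k s N M : nat).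

(** |\sum_(k < n) e^(i k y)|^2. *)
Definition fejer n y : R :=
  (\sum_(k < n) cos (k%:R * y)) ^+ 2 + (\sum_(k < n) sin (k%:R * y)) ^+ 2.

Lemma fejerS n y : fejer n.+1 y = fejer n y + 1 + 2 * \sum_(k < n) cos (k.+1%:R * y).
Proof.
rewrite /fejer !big_ord_recr/=.
set A := \sum_(k < n) cos _; set B := \sum_(k < n) sin _.
have -> : \sum_(k < n) cos (k.+1%:R * y) = A * cos (n%:R * y) + B * sin (n%:R * y).
  rewrite (reindex_inj rev_ord_inj)/= /A /B !mulr_suml -big_split/=.
  apply: eq_bigr => k _; rewrite subnSK// -cosB -cosN; congr cos.
  by rewrite natrB 1?ltnW//; ring.
move: A B (cos (n%:R * y)) (sin (n%:R * y)) (cos2Dsin2 (n%:R * y)) => A B c d cd.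
transitivity (A ^+ 2 + B ^+ 2 + (c ^+ 2 + d ^+ 2) + 2 * (A * c + B * d)); first by ring.
by rewrite cd.
Qed.

Lemma fejer_ge0 n y : 0 <= fejer n y.
Proof. by rewrite addr_ge0// sqr_ge0. Qed.

Lemma cos_ge_half x : 0 <= x -> x <= 1 -> 1 / 2 <= cos x.
Proof.
move=> x0 x1; have pi2 := pi_ge2 R.
have sx : sin (x / 2) <= x / 2.
  have x20 : 0 <= x / 2 by lra.
  have := @nondecreasing_derive_ge0 R (fun y => y - sin y) (fun y => 1 - cos y) 0 (x / 2) x20.
  rewrite sin0 subrr subr_ge0; apply.
    by move=> y _; rewrite subr_ge0 cos_le1.
have s0 : 0 <= sin (x / 2) by apply: sin_ge0_pi; lra.
have -> : x = x / 2 + x / 2 by field.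
rewrite cosD -!expr2 [cos _ ^+ 2]cos2sin2; nra.
Qed.

Lemma fejer_ge n y : n%:R * `|y| <= 1 -> n%:R ^+ 2 / 4 <= fejer n y.
Proof.
move=> ny; have S : n%:R / 2 <= \sum_(k < n) cos (k%:R * y).
  rewrite (_ : n%:R / 2 = \sum_(k < n) (1 / 2)); last first.
    by rewrite sumr_const card_ord -mulr_natl; field.
  apply: ler_sum => k _.
  have : `|k%:R * y| <= 1.
    apply: le_trans ny; rewrite normrM normr_nat ler_wpM2r// ler_nat; exact: ltnW.
  rewrite -(cos_norm (_ * _)); move: `|_| (normr_ge0 (k%:R * y)) => z z0 z1.
  exact: cos_ge_half.
apply: (@le_trans _ _ ((\sum_(k < n) cos (k%:R * y)) ^+ 2)); last by rewrite lerDl sqr_ge0.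
have := ler0n R n; move: (\sum_(k < n) _) S => A S n0.
by rewrite (_ : n%:R ^+ 2 / 4 = (n%:R / 2) ^+ 2) ?lerXn2r ?nnegrE//; [lra|field].
Qed.

Lemma Rintegral_ge_itv f (B e k : R) : continuous f -> (forall x, 0 <= f x) -> 0 <= k ->
  0 < e -> e <= B -> (forall x, `|x| <= e -> k <= f x) ->
  k * (2 * e) <= \int[mu]_(x in `[- B, B]) f x.
Proof.
move=> cf f0 k0 e0 eB kf.
have ie := @integrable_itv R f (- e) e cf.
have iB := @integrable_itv R f (- B) B cf.
have sub : `[- e, e] `<=` `[- B, B].
  by apply: subset_itv; rewrite bnd_simp ?lerN2.
apply: (@le_trans _ _ (\int[mu]_(x in `[- e, e]) f x)); last first.
  apply: fine_le.
  - exact: integrable_fin_num ie.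
  - exact: integrable_fin_num iB.
  - apply: ge0_subset_integral => //.
    + by have /integrableP[] := iB.
    + by move=> x _; rewrite lee_fin.
have -> : k * (2 * e) = \int[mu]_(x in `[- e, e]) k.
  rewrite Rintegral_cst//; congr (k * _).
  transitivity (fine (2 * e)%:E) => //; congr fine; apply/esym.
  rewrite [LHS](@lebesgue_measure_itv R)/= lte_fin gtrN//.
  by rewrite EFinN -EFinD opprK -mulr2n mulr_natl.
apply: le_Rintegral => //.
- by apply: integrable_itv => x; exact: cvg_cst.
- by move=> x /= ; rewrite in_itv/= -ler_norml; exact: kf.
Qed.

Lemma continuous_sumr n (Fs : nat -> R -> R) : (forall k, continuous (Fs k)) ->
  continuous (fun x => \sum_(k < n) Fs k x).
Proof.
move=> cF; elim: n => [|n IH].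
  rewrite (_ : (fun _ => _) = fun=> 0); first by move=> x; exact: cvg_cst.
  by apply/funext => x; rewrite big_ord0.
rewrite (_ : (fun _ => _) = fun x => \sum_(k < n) Fs k x + Fs n x).
  by move=> x; apply: cvgD; [exact: IH|exact: cF].
by apply/funext => x; rewrite big_ord_recr.
Qed.

Lemma Rintegral_sum (B : R) n (Fs : nat -> R -> R) : (forall k, continuous (Fs k)) ->
  \int[mu]_(x in `[- B, B]) (\sum_(k < n) Fs k x) =
  \sum_(k < n) \int[mu]_(x in `[- B, B]) (Fs k x).
Proof.
move=> cF; elim: n => [|n IH].
  under eq_Rintegral do rewrite big_ord0.
  by rewrite big_ord0 Rintegral_cst// mul0r.
under eq_Rintegral do rewrite big_ord_recr/=.
rewrite RintegralD//; first by rewrite IH big_ord_recr.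
  by apply: integrable_itv; exact: continuous_sumr.
exact: integrable_itv.
Qed.

(** The integral of the kernel against phi is a combination of the values of osc
    at integers. *)
Lemma fejer_integralS g phi (B : R) n : continuous g -> continuous phi ->
  let O t := \int[mu]_(x in `[- B, B]) (cos (t * g x) * phi x) in
  \int[mu]_(x in `[- B, B]) (fejer n.+1 (g x) * phi x) =
  \int[mu]_(x in `[- B, B]) (fejer n (g x) * phi x) + O 0 +
  2 * \sum_(k < n) O k.+1%:R.
Proof.
move=> cg cphi /=.
have ct (f1 : R -> R) : continuous f1 -> forall t : R, continuous (fun x => f1 (t * g x)).
  move=> cf1 t x; apply: (cvg_comp (fun x => t * g x) f1); last exact: cf1.
  by apply: cvgM; [exact: cvg_cst|exact: cg].
have cos_c t : continuous (fun x => cos (t * g x) * phi x).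
  by move=> x; apply: cvgM; [exact: (ct _ (@continuous_cos R))|exact: cphi].
have cS : continuous (fun x => \sum_(k < n) (cos (k.+1%:R * g x) * phi x)).
  by apply: (@continuous_sumr n (fun k x => cos (k.+1%:R * g x) * phi x)) => k; exact: cos_c.
have cfejer : continuous (fun x => fejer n (g x) * phi x).
  move=> x; apply: cvgM; last exact: cphi.
  apply: cvgD; rewrite expr2; apply: cvgM;
    apply: (@continuous_sumr n (fun k x => _ (k%:R * g x))) => k;
    by [exact: (ct _ (@continuous_cos R))|exact: (ct _ (@continuous_sin R))].
rewrite -(@Rintegral_sum B n (fun k x => cos (k.+1%:R * g x) * phi x)); last by move=> k; exact: cos_c.
rewrite -RintegralZl//; last exact: integrable_itv.
rewrite -RintegralD//; [|exact: integrable_itv|exact: integrable_itv].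
rewrite -RintegralD//; last 2 first.
- by apply: integrable_itv => x; apply: cvgD; [exact: cfejer|exact: cos_c].
- by apply: integrable_itv => x; apply: cvgM; [exact: cvg_cst|exact: cS].
apply: eq_Rintegral => x _; rewrite fejerS mul0r cos0 -mulr_suml; ring.
Qed.

(** If the values F k are bounded above by C k^(-r), their double sum over j, k
    < n grows at most like n^(2-r). *)
Lemma fejer_growth (r C : R) (D F : nat -> R) : 0 < r < 1 -> 0 <= C -> D 0%N = 0 ->
  (forall n, D n.+1 = D n + F 0%N + 2 * \sum_(k < n) F k.+1) ->
  (forall k, F k.+1 <= C * k.+1%:R `^ (- r)) -> F 0%N <= C ->
  forall n, D n <= (C + 2 * C / (1 - r)) * (n%:R * n%:R `^ (1 - r)).
Proof.
move=> /andP[r0 r1] C0 D0 DS hF F0; elim=> [|n IH]; first by rewrite D0 mul0r mulr0.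
set E := C + _ in IH *; have E0 : 0 <= E.
  by rewrite addr_ge0// divr_ge0 ?mulr_ge0// subr_ge0 ltW.
have S : \sum_(k < n) F k.+1 <= C / (1 - r) * n.+1%:R `^ (1 - r).
  case: n {IH} => [|n].
    by rewrite big_ord0 mulr_ge0 ?powR_ge0// divr_ge0// subr_ge0 ltW.
  apply: (@le_trans _ _ (C * \sum_(k < n.+1) (1 + 1 * k%:R) `^ (- r))).
    rewrite mulr_sumr; apply: ler_sum => k _.
    by rewrite mul1r addrC natr1; exact: hF.
  rewrite -mulrA; apply: ler_wpM2l => //; rewrite mulrC ler_pdivlMr ?subr_gt0//.
  have r01 : 0 < r < 1 by rewrite r0.
  have := @sum_powR_le R r 1 1 n r01 ltr01 ler01.
  rewrite !powR1 !mulr1 mul1r [_ * (1 - r)]mulrC => /le_trans; apply.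
  have : (1 + n%:R) `^ (1 - r) <= (n.+2%:R : R) `^ (1 - r).
    by apply: ge0_ler_powR; rewrite ?nnegrE ?subr_ge0 ?(ltW r1)// addrC natr1 ?ler0n// ler_nat.
  lra.
have oneX (p : R) : (1 : R) `^ p = 1 by rewrite powR1.
have m1 : n%:R `^ (1 - r) <= (n.+1%:R : R) `^ (1 - r).
  by apply: ge0_ler_powR; rewrite ?nnegrE ?subr_ge0 ?(ltW r1)// ler_nat.
have one : 1 <= (n.+1%:R : R) `^ (1 - r).
  by rewrite -[leLHS](oneX (1 - r)); apply: ge0_ler_powR; rewrite ?nnegrE ?subr_ge0 ?(ltW r1)// ler1n.
rewrite DS.
have h1 : D n <= E * (n%:R * n.+1%:R `^ (1 - r)).
  by apply: le_trans IH _; apply: ler_wpM2l => //; exact: ler_wpM2l.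
have h2 : F 0%N <= C * n.+1%:R `^ (1 - r) by apply: le_trans F0 _; exact: ler_peMr.
have -> : E * (n.+1%:R * n.+1%:R `^ (1 - r)) = E * (n%:R * n.+1%:R `^ (1 - r)) +
    C * n.+1%:R `^ (1 - r) + 2 * (C / (1 - r) * n.+1%:R `^ (1 - r)).
  by rewrite -natr1 /E; ring.
by rewrite !lerD// ler_wpM2l.
Qed.

(** If c <= 0, then osc g phi 0 t <= C t^(-r) for some r > 1/s, and the integral
    of the Fejer kernel is O(n^(2-r)). But this kernel is at least n^2 / 4 where
    |g| <= 1/n, an interval of length of order n^(-1/s), so the integral is at
    least of order n^(2-1/s). *)
Lemma osc_lead_gt0 g h q s phi (c : R) : phase_form g h q s -> (2 <= s)%N ->
  admissible g phi -> (forall x, 0 <= phi x) -> 0 < phi 0 ->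
  decays (fun t => osc g phi 0 t - c * t `^ (- s%:R^-1)) (2 / s%:R) -> 0 < c.
Proof.
move=> P s2 A phi0 phi00 hc; rewrite ltNge; apply/negP => c0.
have s0 : 0 < s%:R :> R by rewrite ltr0n (phase_s P).
have cg := smooth_continuous (phase_smooth P).
have cphi := smooth_continuous (adm_smooth A).
have cA := adm_compactly_supported A.
have [B B0 hB] := compact_range cA cA.
have [M M0 hM] := @osc_bounded R g phi 0 cg cphi cA.
(* any exponent above 1/s, below 1 and at most 2/s; the value 2/s itself
   would give a logarithm for s = 2 *)
pose r : R := 3 / (2 * s%:R).
have rp : s%:R^-1 < r.
  rewrite /r ltr_pdivlMr; last by rewrite mulr_gt0.
  by rewrite mulrC -mulrA divff ?gt_eqF//; lra.
have r2 : r <= 2 / s%:R.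
  rewrite /r ler_pdivrMr; last by rewrite mulr_gt0.
  by rewrite mulrACA -[X in _ <= X]mulrA mulVf ?gt_eqF//; lra.
have r0 : 0 < r by apply: lt_trans rp; rewrite invr_gt0.
have r1 : r < 1.
  rewrite /r ltr_pdivrMr ?mulr_gt0// mul1r.
  have : 2 <= s%:R :> R by rewrite ler_nat.
  lra.
have [C0 hC0] := decaysW r2 hc.
have [T T1 hT] : exists2 T : R, 1 <= T & forall t, T <= t -> osc g phi 0 t <= `|C0| * t `^ (- r).
  have [T [_ hT]] := hC0; exists (Num.max 1 (T + 1)); first by rewrite le_max lexx.
  move=> t; rewrite ge_max => /andP[t1 Tt].
  have := hT t; rewrite (lt_le_trans _ Tt) ?ltrDl// => /(_ isT) ht.
  have p1 := powR_ge0 t (- s%:R^-1); have p2 := powR_ge0 t (- r).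
  have h1 : c * t `^ (- s%:R^-1) <= 0 by rewrite mulr_le0_ge0.
  have h2 : C0 * t `^ (- r) <= `|C0| * t `^ (- r) by rewrite ler_wpM2r// ler_norm.
  have h3 := ler_norm (osc g phi 0 t - c * t `^ (- s%:R^-1)).
  clear - ht h1 h2 h3; lra.
(* the last two summands cover t < T and t = 0 *)
pose C := `|C0| + M * T `^ r + M.
have T0 : 0 < T by exact: lt_le_trans T1.
have CC : 0 <= C by rewrite !addr_ge0// mulr_ge0// powR_ge0.
have hF (k : nat) : osc g phi 0 k.+1%:R <= C * k.+1%:R `^ (- r).
  have k0 : 0 < k.+1%:R :> R by rewrite ltr0n.
  have p0 : 0 < (k.+1%:R : R) `^ (- r) by rewrite powR_gt0.
  have MT : 0 <= M * T `^ r by rewrite mulr_ge0// powR_ge0.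
  have [Tk|kT] := leP T k.+1%:R.
    apply: le_trans (hT _ Tk) _; rewrite ler_wpM2r ?(ltW p0)//.
    by rewrite /C -addrA lerDl addr_ge0.
  apply: le_trans (ler_norm _) (le_trans (hM _) _).
  apply: (@le_trans _ _ (M * T `^ r * k.+1%:R `^ (- r))); last first.
    rewrite ler_wpM2r ?(ltW p0)// /C; have := normr_ge0 C0; clear - M0; lra.
  rewrite -mulrA ler_peMr// powRN -ler_pdivrMr ?invr_gt0 ?powR_gt0// mul1r invrK.
  by apply: ge0_ler_powR; rewrite ?nnegrE ?(ltW r0) ?(ltW k0) ?(ltW T0) ?(ltW kT).
pose D n := \int[mu]_(x in `[- B, B]) (fejer n (g x) * phi x).
pose F n := \int[mu]_(x in `[- B, B]) (cos (n%:R * g x) * phi x).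
have FE n : F n = osc g phi 0 n%:R.
  rewrite (@osc_cosE R g phi 0 n%:R `[- B, B]); last by move=> x /hB[].
  by apply: eq_Rintegral => x _; rewrite addr0.
have D0 : D 0%N = 0.
  rewrite /D; under eq_Rintegral do rewrite /fejer !big_ord0 expr0n addr0 mul0r.
  by rewrite Rintegral_cst// mul0r.
have r01 : 0 < r < 1 by rewrite r0.
have up := @fejer_growth r C D F r01 CC D0 (fun n => @fejer_integralS g phi B n cg cphi).
have {}up n : D n <= (C + 2 * C / (1 - r)) * (n%:R * n%:R `^ (1 - r)).
  apply: up => [k|]; first by rewrite FE; exact: hF.
  rewrite FE; apply: le_trans (ler_norm _) (le_trans (hM _) _).
  by rewrite /C lerDr addr_ge0// mulr_ge0// powR_ge0.
have [d d0 hd] : exists2 d, 0 < d & d <= B /\ d <= 1 /\ forall x, `|x| <= d ->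
    phi 0 / 2 <= phi x /\ `|h x| <= `|h 0| + 1.
  have ch := smooth_continuous (phase_smooth_h P).
  have n1 : \forall x \near (0 : R), phi 0 / 2 < phi x.
    by apply: (cvgr_gt _ (cphi 0)); lra.
  have n2 : \forall x \near (0 : R), `|h x| < `|h 0| + 1.
    have cn : {for 0, continuous (fun x => `|h x|)}.
      by apply: continuous_comp; [exact: ch|exact: norm_continuous].
    by apply: (cvgr_lt _ cn); rewrite ltrDl.
  have [e /= e0 he] := filterI n1 n2.
  exists (Num.min (e / 2) (Num.min B 1)); first by rewrite !lt_min B0 divr_gt0//=.
  split; first by rewrite !ge_min lexx orbT.
  split; first by rewrite !ge_min lexx !orbT.
  move=> x; rewrite !le_min => /andP[xe _].
  have /he[/= a1 a2] : ball 0 e x by rewrite /ball/= sub0r normrN; lra.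
  by split; exact: ltW.
have [dB [d1 hphi]] := hd.
pose H := `|h 0| + 1; have H0 : 0 < H by rewrite ltr_wpDl.
(* for |x| <= e0 n^(-1/s), |g x| <= e0^s H / n <= 1 / n *)
pose e0 := Num.min d (H^-1); have e00 : 0 < e0 by rewrite lt_min d0 invr_gt0.
have e0d : e0 <= d by rewrite ge_min lexx.
have e0H : e0 * H <= 1 by rewrite -ler_pdivlMr// div1r ge_min lexx orbT.
have oneX (p : R) : (1 : R) `^ p = 1 by rewrite powR1.
have low n : (0 < n)%N -> n%:R ^+ 2 / 4 * (phi 0 / 2) * (2 * (e0 * n%:R `^ (- s%:R^-1))) <= D n.
  move=> n0; have nR : 0 < n%:R :> R by rewrite ltr0n.
  have n1 : n%:R `^ (- s%:R^-1) <= (1 : R).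
    by rewrite -[leRHS](oneX (- s%:R^-1)); apply: powRN_ge; rewrite ?ltr01 ?ler1n ?invr_ge0 ?(ltW s0).
  have pn0 : 0 < (n%:R : R) `^ (- s%:R^-1) by rewrite powR_gt0.
  have ed : e0 * n%:R `^ (- s%:R^-1) <= d by apply: le_trans e0d; rewrite ler_piMr// ltW.
  apply: Rintegral_ge_itv.
  - move=> x; apply: cvgM; last exact: cphi.
    apply: cvgD; rewrite expr2; apply: cvgM;
    apply: (@continuous_sumr n (fun k x => _ (k%:R * g x))) => k {}x.
    + by apply: (cvg_comp (fun x => k%:R * g x) (@cos R)); [apply: cvgM; [exact: cvg_cst|exact: cg]|exact: continuous_cos].
    + by apply: (cvg_comp (fun x => k%:R * g x) (@cos R)); [apply: cvgM; [exact: cvg_cst|exact: cg]|exact: continuous_cos].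
    + by apply: (cvg_comp (fun x => k%:R * g x) (@sin R)); [apply: cvgM; [exact: cvg_cst|exact: cg]|exact: continuous_sin].
    + by apply: (cvg_comp (fun x => k%:R * g x) (@sin R)); [apply: cvgM; [exact: cvg_cst|exact: cg]|exact: continuous_sin].
  - by move=> x; rewrite mulr_ge0// fejer_ge0.
  - by rewrite mulr_ge0 ?divr_ge0 ?sqr_ge0// ltW.
  - by rewrite mulr_gt0.
  - exact: le_trans ed dB.
  - move=> x xe; have [px hx] := hphi x (le_trans xe ed).
    apply: ler_pM => //; first by rewrite divr_ge0// sqr_ge0.
    apply: fejer_ge; rewrite (phaseE P) normrM normrX.
    have xs : `|x| ^+ s <= e0 * n%:R^-1.
      apply: (@le_trans _ _ ((e0 * n%:R `^ (- s%:R^-1)) ^+ s)).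
        by rewrite lerXn2r// ?nnegrE// (le_trans _ xe).
      rewrite exprMn -[(_ `^ _) ^+ s]powR_mulrn ?powR_ge0// -powRrM mulNr mulVf ?gt_eqF//.
      rewrite powR_inv1 ?(ltW nR)//; apply: ler_wpM2r; first by rewrite invr_ge0 ltW.
      by rewrite -[leRHS]expr1 ler_wiXn2l ?(ltW e00)// ?(le_trans e0d)// (phase_s P).
    apply: (@le_trans _ _ (n%:R * (e0 * n%:R^-1 * H))).
      by rewrite ler_wpM2l ?(ltW nR)// ler_pM.
    suff -> : n%:R * (e0 * n%:R^-1 * H) = e0 * H by [].
    by rewrite mulrAC mulrCA divff ?gt_eqF// mulr1.
pose E := C + 2 * C / (1 - r).
have E0 : 0 <= E by rewrite addr_ge0// divr_ge0 ?mulr_ge0// subr_ge0 ltW.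
pose K := phi 0 / 4 * e0; have K0 : 0 < K by rewrite mulr_gt0// divr_gt0.
have rs : 0 < r - s%:R^-1 by rewrite subr_gt0.
have KE : 0 < K / (E + 1) by rewrite divr_gt0// ltr_wpDl.
have [T' [_ hT']] := near_powRN_le rs KE.
pose n := (Num.truncn `|T'|).+1.
have nT : T' < n%:R by apply: le_lt_trans (ler_norm _) (truncnS_gt _).
have n0 : 0 < n%:R :> R by rewrite ltr0n.
have := hT' _ nT; rewrite ler_pdivlMr ?ltr_wpDl// => hK.
have := le_trans (low n (ltn0Sn _)) (up n); rewrite -/E.
have -> : n%:R `^ (1 - r) = n%:R * (n%:R `^ (- (r - s%:R^-1)) * (n%:R : R) `^ (- s%:R^-1)).
  rewrite -powRD ?(gt_eqF n0) ?implybT// -{2}(powRr1 (ltW n0)) -powRD ?(gt_eqF n0) ?implybT//.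
  by congr (_ `^ _); ring.
have v0 : 0 < (n%:R : R) `^ (- (r - s%:R^-1)) by rewrite powR_gt0.
have u0 : 0 < (n%:R : R) `^ (- s%:R^-1) by rewrite powR_gt0.
move: (n%:R `^ (- (r - s%:R^-1))) (n%:R `^ (- s%:R^-1)) v0 u0 hK => v u v0 u0 hK.
apply/negP; rewrite -ltNge.
rewrite [ltLHS](_ : _ = n%:R ^+ 2 * u * (E * v)); last by ring.
rewrite [ltRHS](_ : _ = n%:R ^+ 2 * u * K); last by rewrite /K; field.
rewrite ltr_pM2l; last by rewrite mulr_gt0// exprn_gt0.
apply: lt_le_trans hK; rewrite mulrDr mulr1 mulrC ltrDl//.
Qed.

End Positivity.

(** * Phases and amplitudes *)

Section Setup.
Variable R : realType.
Implicit Types (f g h a b q phi : R -> R) (x th t : R) (m n k s : nat).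

Lemma smoothBc f (c : R) : smooth f -> smooth (fun x => f x - c).
Proof. by move=> sf; exact: (smoothD sf (@smooth_cst R (- c))). Qed.

Lemma derive1Bc f (c : R) : smooth f -> derive1 (fun x => f x - c) = derive1 f.
Proof.
move=> sf; apply/funext => x; rewrite derive1E.
apply: (@derive_val _ _ _ x 1 (fun x => f x - c)).
have df := smooth_is_derive x sf.
by apply: is_derive_eq; rewrite subr0.
Qed.

Lemma phase_form_exists f s : smooth f -> (0 < s)%N ->
  (forall k, (0 < k < s)%N -> derive1n k f 0 = 0) -> derive1n s f 0 != 0 ->
  exists h q, phase_form (fun x => f x - f 0) h q s.
Proof.
move=> sf s0 fk fs; have sg := @smoothBc f (f 0) sf.
have gE k : derive1n k.+1 (fun x => f x - f 0) = derive1n k.+1 f.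
  by rewrite !derive1Sn derive1Bc.
have [|h sh [hE hD]] := @factor_zero R 0 (fun x => f x - f 0) s sg.
  by case=> [|k] ks; [exact: subrr|rewrite gE; exact: fk].
exists h, (fun x => s%:R * h x + x * derive1 h x).
have gE' x : f x - f 0 = x ^+ s * h x by rewrite hE subr0.
split=> [//|//|//||//||//|].
- have s1 := @smoothM R (fun=> s%:R) h (@smooth_cst R _) sh.
  have s2 := @smoothM R (fun x => x) (derive1 h) (@smooth_id R) (smooth_derive1 sh).
  exact: (@smoothD R _ _ s1 s2).
- move=> x; rewrite (_ : (fun x => _) = (fun x => x ^+ s * h x)); last exact/funext.
  rewrite derive1_monomialM// -{3}(prednK s0) exprS; ring.
- apply/eqP => /(hD 0%N); rewrite add0n -(prednK s0) gE prednK//.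
  exact/eqP.
Qed.

(** At a boundary point of the support the derivatives of phi are limits of
    derivatives at points where phi is locally zero. *)
Lemma standard_admissible f phi : smooth f -> standard_amplitude phi ->
  (forall x, (supp phi)° x -> critical_point f x -> x = 0) ->
  finite_order_on (supp phi) f -> admissible (fun x => f x - f 0) phi.
Proof.
move=> sf [sphi _ cK _] crit fin.
have out x : ~ supp phi x -> \forall y \near x, phi y = 0.
  move=> nx; have oC : open (~` supp phi) by apply: closed_openC; exact: closed_closure.
  apply: filterS (oC x nx) => y ny; apply: contrapT => /eqP py; apply: ny.
  exact: subset_closure.
have flat_out x n : ~ supp phi x -> flat_at n phi x.
  move=> nx; apply: (@flat_at_near R n (fun=> 0)); last exact: flat_at_0.
  by apply: filterS (out x nx) => y ->.
split => //.
  have [M [_ hM]] := compact_bounded cK; exists (M + 1) => x Mx.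
  suff nx : ~ supp phi x by exact: nbhs_singleton (out x nx).
  move=> Kx.
  have M1 : M < M + 1 by rewrite ltrDl.
  by have := hM (M + 1) M1 x Kx; rewrite /= leNgt Mx.
move=> x x0; rewrite derive1Bc// => fx.
have [Kx|nKx] := pselect (supp phi x); last by left; exact: out.
right; have nint : ~ (supp phi)° x.
  move=> ix; move/eqP: x0; apply; apply: crit => //; split => //.
  exact: smooth_derivable.
have [k k0 fkx] := fin x Kx; split; last first.
  by exists k.-1; rewrite -derive1Sn prednK.
apply: flat_atP => // j; apply: contrapT => /eqP jx; apply: nint.
have cj := smooth_continuous (@smooth_derive1n R j phi sphi).
have nz : \forall y \near x, derive1n j phi y != 0.
  exact: (@cvgr_neq0 _ _ _ _ _ (derive1n j phi) (derive1n j phi x) (cj x) jx).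
rewrite /interior; near=> y; apply: contrapT => ny.
have jy : derive1n j phi y != 0 by near: y.
move/eqP: jy; apply; apply: flat_at_derive1n => n; exact: flat_out.
Unshelve. all: by end_near. Qed.

End Setup.

(** * Real and imaginary parts as chirps *)

Section ChirpOfIntegral.
Variable R : realType.
Local Notation mu := (@lebesgue_measure R).
Implicit Types (f g h a b q phi F : R -> R) (x th t w p : R) (m n k s : nat).

Lemma decays_cvg F p r c : p < r ->
  decays (fun t => F t - c * t `^ (- p)) r -> F t * t `^ p @[t --> +oo] --> c.
Proof.
move=> pr [C hC]; have rp : 0 < r - p by rewrite subr_gt0.
apply/cvgrPdist_le => e e0; have C1 : 0 < `|C| + 1 by rewrite ltr_wpDl.
near=> t.
have t0 : 0 < t by near: t; apply: nbhs_pinfty_gt; rewrite num_real.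
have ht : `|F t - c * t `^ (- p)| <= C * t `^ (- r) by near: t.
have hs : t `^ (- (r - p)) <= e / (`|C| + 1).
  by near: t; apply: near_powRN_le => //; rewrite divr_gt0.
have E : c - F t * t `^ p = - ((F t - c * t `^ (- p)) * t `^ p).
  have : t `^ (- p) * t `^ p = 1.
    by rewrite -powRD ?(gt_eqF t0) ?implybT// addNr powRr0.
  move: (t `^ _) (t `^ p) => y z yz; rewrite mulrBl -mulrA yz; ring.
rewrite E normrN normrM (ger0_norm (powR_ge0 _ _)).
apply: (@le_trans _ _ (C * t `^ (- (r - p)))).
  apply: le_trans (ler_wpM2r (powR_ge0 t p) ht) _.
  by rewrite -mulrA -powRD ?(gt_eqF t0) ?implybT// opprB addrC.
apply: (@le_trans _ _ ((`|C| + 1) * t `^ (- (r - p)))).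
  by rewrite ler_wpM2r ?powR_ge0// (le_trans (ler_norm C))// lerDl.
by rewrite mulrC -ler_pdivlMr.
Unshelve. all: by end_near. Qed.

(** Adding the constant w to the phase rotates the integral by the angle w t. *)
Lemma osc_shift f a th t w : continuous f -> continuous a -> compactly_supported a ->
  let g x := f x - w in
  osc f a th t = cos (w * t + th) * osc g a 0 t - sin (w * t + th) * osc g a (- (pi / 2)) t.
Proof.
move=> cf ca sa g.
have cg : continuous g by move=> x; apply: cvgB; [exact: cf|exact: cvg_cst].
have [B B0 hB] := compact_range sa sa.
have supE (k : R -> R) u : osc k a u t = \int[mu]_(x in `[- B, B]) (cos (t * k x + u) * a x).
  by apply: osc_cosE => x /hB[].
rewrite !supE -!RintegralZl//; [|apply: integrable_itv; exact: continuous_osc..].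
rewrite -RintegralB//; last 2 first.
- apply: integrable_itv => x; apply: cvgM; first exact: cvg_cst.
  exact: continuous_osc.
- apply: integrable_itv => x; apply: cvgM; first exact: cvg_cst.
  exact: continuous_osc.
apply: eq_Rintegral => x _; rewrite addr0 -/(_ - pi / 2).
have -> : cos (t * g x - pi / 2) = sin (t * g x).
  by rewrite cosB cos_pihalf sin_pihalf mulr0 mulr1 add0r.
have -> : t * f x + th = (t * g x) + (w * t + th) by rewrite /g; ring.
rewrite cosD; ring.
Qed.

Lemma osc_shift_decays f h q s a th w : phase_form (fun x => f x - w) h q s ->
  smooth f -> admissible (fun x => f x - w) a -> decays (osc f a th) s%:R^-1.
Proof.
move=> P sf A; have cA := adm_compactly_supported A.
have d0 u : decays (osc (fun x => f x - w) a u) s%:R^-1.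
  have := osc_decays 0 u P A; rewrite div1r; congr decays; apply/funext => t.
  by congr osc; apply/funext => x; rewrite expr0 mul1r.
have [C0 h0] := d0 0; have [C1 h1] := d0 (- (pi / 2)).
exists (C0 + C1); near=> t.
rewrite (@osc_shift f a th t w (smooth_continuous sf) (smooth_continuous (adm_smooth A)) cA).
have k0 : `|osc (fun x => f x - w) a 0 t| <= C0 * t `^ (- s%:R^-1) by near: t.
have k1 : `|osc (fun x => f x - w) a (- (pi / 2)) t| <= C1 * t `^ (- s%:R^-1) by near: t.
rewrite [leRHS]mulrDl; apply: le_trans (ler_normB _ _) _; rewrite !normrM.
apply: lerD.
  by apply: le_trans k0; rewrite ler_piMl// cos_max.
by apply: le_trans k1; rewrite ler_piMl// sin_max.
Unshelve. all: by end_near. Qed.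

(** In time 2 pi / |w| the rotation passes through every direction. *)
Lemma angle_hit (w th e1 e2 : R) : w != 0 -> e1 ^+ 2 + e2 ^+ 2 = 1 ->
  \forall t \near +oo, exists2 u, t <= u <= t + 2 * pi / `|w| &
    cos (w * u + th) = e1 /\ sin (w * u + th) = e2.
Proof.
move=> w0 e12; have nw : 0 < `|w| by rewrite normr_gt0.
have [sg [sg2 wE]] : exists sg : R, (sg = 1 \/ sg = -1) /\ w = sg * `|w|.
  by case: (ltrgt0P w) w0 => // _ _; [exists 1|exists (-1)]; split; rewrite ?mul1r ?mulN1r ?opprK; [left| |right|].
have sgsg : sg * sg = 1 by case: sg2 => ->; ring.
have e12' : e1 ^+ 2 + (sg * e2) ^+ 2 = 1 by rewrite exprMn [sg ^+ 2]expr2 sgsg mul1r.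
near=> t.
have tw : 2 * pi - sg * th <= `|w| * t.
  rewrite [leRHS]mulrC -ler_pdivrMr//; near: t; apply: nbhs_pinfty_ge; rewrite num_real//.
have [|v /andP[v1 v2] [c1 s1]] := @unit_angle_after R e1 (sg * e2) (`|w| * t + sg * th) e12'.
  by clear - tw; lra.
exists ((v - sg * th) / `|w|).
  rewrite ler_pdivlMr// [X in _ && X]ler_pdivrMr// mulrDl divfK ?gt_eqF//.
  by rewrite mulrC; clear - v1 v2; lra.
have -> : w * ((v - sg * th) / `|w|) + th = sg * v.
  rewrite {1}wE -mulrA [`|w| * _]mulrC divfK ?gt_eqF//.
  by rewrite mulrBr mulrA sgsg mul1r subrK.
rewrite c1; have -> : e2 = sg * (sg * e2) by rewrite mulrA sgsg mul1r.
by rewrite s1; case: sg2 => ->; rewrite ?mul1r ?mulN1r ?cosN ?sinN.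
Unshelve. all: by end_near. Qed.

Lemma osc_leads g h q s phi : phase_form g h q s -> (2 <= s)%N ->
  admissible g phi -> (forall x, 0 <= phi x) -> 0 < phi 0 ->
  exists a b : R, [/\ 0 < a,
    decays (fun t => osc g phi 0 t - a * t `^ (- s%:R^-1)) (2 / s%:R) &
    decays (fun t => osc g phi (- (pi / 2)) t - b * t `^ (- s%:R^-1)) (2 / s%:R)].
Proof.
move=> P s2 A phi0 phi00; have s0 := phase_s P.
have [Ca hCa] := osc_expands 0 P A; have [Cb hCb] := osc_expands (- (pi / 2)) P A.
have la := expands_lead s0 hCa.
exists (Ca 1%N), (Cb 1%N); split => //; last exact: expands_lead.
exact: (osc_lead_gt0 P s2 A phi0 phi00 la).
Qed.

(** In each window of length 2 pi / |w| the rotation reaches the two directions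
    in which the leading term is real, with either sign. The derivative is again
    such an integral, with amplitude f phi, whence the Lipschitz bound. *)
Lemma osc_chirp f h q s phi th w : phase_form (fun x => f x - w) h q s ->
  (2 <= s)%N -> smooth f -> w != 0 -> admissible (fun x => f x - w) phi ->
  (forall x, 0 <= phi x) -> 0 < phi 0 ->
  exists M m L t1 : R, chirp_bounds (osc f phi th) s%:R^-1 M m L t1.
Proof.
move=> P s2 sf w0 A phi0 phi00; have s0 := phase_s P.
have sR : 0 < s%:R :> R by rewrite ltr0n.
have nw : 0 < `|w| by rewrite normr_gt0.
have cA := adm_compactly_supported A.
have cf := smooth_continuous sf; have cphi := smooth_continuous (adm_smooth A).
pose p : R := s%:R^-1.
have p0 : 0 < p by rewrite invr_gt0.
have p1 : p <= 1 by rewrite invf_le1// ler1n.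
have pr : p < 2 / s%:R by rewrite /p -[ltLHS]div1r ltr_pM2r ?invr_gt0// ltr1n.
have A' : admissible (fun x => f x - w) (fun x => f x * phi x).
  by have := admM A sf; congr admissible; apply/funext => x; rewrite mulrC.
have [C0 h0] := osc_shift_decays th P sf A.
have [C1 h1] := osc_shift_decays (th + pi / 2) P sf A'.
have dZ t : is_derive t 1 (osc f phi th) (osc f (fun x => f x * phi x) (th + pi / 2) t).
  exact: is_derive_osc.
have [a [b [a0 la lb]]] := osc_leads P s2 A phi0 phi00.
pose c := Num.sqrt (a ^+ 2 + b ^+ 2).
have ab0 : 0 < a ^+ 2 + b ^+ 2 by rewrite ltr_wpDr ?sqr_ge0// exprn_gt0.
have c0 : 0 < c by rewrite sqrtr_gt0.
have c2 : c ^+ 2 = a ^+ 2 + b ^+ 2 by rewrite sqr_sqrtr// ltW.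
have unit : (a / c) ^+ 2 + (- b / c) ^+ 2 = 1.
  by rewrite !expr_div_n sqrrN -mulrDl -c2 divff// expf_neq0// gt_eqF.
have unitN : (- a / c) ^+ 2 + (b / c) ^+ 2 = 1.
  by rewrite !expr_div_n sqrrN -mulrDl -c2 divff// expf_neq0// gt_eqF.
pose A0 := osc (fun x => f x - w) phi 0; pose B0 := osc (fun x => f x - w) phi (- (pi / 2)).
have big : \forall u \near +oo, c / 2 * u `^ (- p) <= (a * A0 u + b * B0 u) / c.
  have lim : (a * (A0 t * t `^ p) + b * (B0 t * t `^ p)) / c @[t --> +oo] --> (a * a + b * b) / c.
    apply: cvgM; last exact: cvg_cst.
    apply: cvgD; (apply: cvgM; [exact: cvg_cst|]).
      exact: decays_cvg pr la.
    exact: decays_cvg pr lb.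
  have : c / 2 < (a * a + b * b) / c.
    by rewrite -!expr2 -c2 expr2 mulfK ?gt_eqF// ltr_pdivrMr//; lra.
  move=> /(cvgr_gt _ lim) hu; near=> u.
  have u0 : 0 < u by near: u; apply: nbhs_pinfty_gt; rewrite num_real.
  have hu' : c / 2 < (a * (A0 u * u `^ p) + b * (B0 u * u `^ p)) / c by near: u.
  rewrite powRN ler_pdivrMr ?powR_gt0// (le_trans (ltW hu'))//.
  rewrite le_eqVlt; apply/orP; left; apply/eqP; ring.
have hp := angle_hit th w0 unit.
have hm := angle_hit th w0 unitN.
pose L := 2 * pi / `|w|.
have L0 : 0 < L by rewrite divr_gt0// mulr_gt0// pi_gt0.
have [T hT] : exists T, forall t, T < t -> [/\
   `|osc f phi th t| <= C0 * t `^ (- p),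
   `|osc f (fun x => f x * phi x) (th + pi / 2) t| <= C1 * t `^ (- p),
   c / 2 * t `^ (- p) <= (a * A0 t + b * B0 t) / c,
   exists2 u, t <= u <= t + L & cos (w * u + th) = a / c /\ sin (w * u + th) = - b / c &
   exists2 u, t <= u <= t + L & cos (w * u + th) = - a / c /\ sin (w * u + th) = b / c].
  have [T [_ hall]] := filterI (filterI h0 h1) (filterI big (filterI hp hm)).
  by exists T => t /hall[[k0 k1] [k2 [k3 k4]]]; split.
exists (`|C0| + `|C1| + 1), (c / 4), L, (Num.max (Num.max 1 L) (T + 1)); split => //.
- by rewrite divr_gt0.
- by rewrite !lt_max ltr01.
- move=> t; apply: differentiable_continuous; apply/derivable1_diffP.
  by have := dZ t => ?; exact: ex_derive.
- move=> t; rewrite !ge_max => /andP[_ Tt].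
  have [|k0 _ _ _ _] := hT t; first by rewrite (lt_le_trans _ Tt)// ltrDl.
  apply: le_trans k0 _; rewrite ler_wpM2r ?powR_ge0//.
  have := ler_norm C0; have := normr_ge0 C1; clear; lra.
- move=> t t'; rewrite !ge_max => /andP[/andP[/andP[t1 tL] Tt] tt'].
  have [x /andP[tx xt'] E] := mean_value tt' (fun x _ => dZ x).
  rewrite distrC E normrM [`|t' - t|]ger0_norm ?subr_ge0//.
  rewrite ler_wpM2r ?subr_ge0//.
  have [|_ k1 _ _ _] := hT x; first by rewrite (lt_le_trans _ (le_trans Tt tx))// ltrDl.
  apply: le_trans k1 _; apply: (@le_trans _ _ (`|C1| * x `^ (- p))).
    by rewrite ler_wpM2r ?powR_ge0// ler_norm.
  apply: ler_pM => //; first exact: powR_ge0.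
    have := normr_ge0 C0; clear; lra.
  by apply: powRN_ge => //; [exact: lt_le_trans t1|exact: ltW].
move=> t; rewrite !ge_max => /andP[/andP[t1 tL] Tt].
have t0 : 0 < t by exact: lt_le_trans t1.
have Tt' : T < t by rewrite (lt_le_trans _ Tt)// ltrDl.
have half u : t <= u <= t + L -> c / 4 * t `^ (- p) <= c / 2 * u `^ (- p).
  move=> /andP[tu uL].
  have u2 : (2 * t) `^ (- p) <= u `^ (- p).
    apply: powRN_ge; rewrite ?(ltW p0) ?(lt_le_trans t0)//.
    by clear - uL tL; lra.
  have h2 : (1 / 2 : R) <= 2 `^ (- p).
    rewrite div1r -powR_inv1//; apply: ler_powR; first by rewrite ler1n.
    by rewrite lerN2.
  rewrite (_ : c / 4 = c / 2 * (1 / 2)); last by field.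
  rewrite -mulrA ler_wpM2l//; first by rewrite divr_ge0// ltW.
  apply: le_trans u2; rewrite powRM ?(ltW t0)//.
  by rewrite ler_wpM2r ?powR_ge0.
have ZE u : osc f phi th u = cos (w * u + th) * A0 u - sin (w * u + th) * B0 u.
  exact: osc_shift.
have [_ _ _ [u1 hu1 [cu1 su1]] [u2 hu2 [cu2 su2]]] := hT t Tt'.
exists u1, u2; split => //.
  have [|_ _ k _ _] := hT u1; first by case/andP: hu1 => /(lt_le_trans Tt').
  apply: le_trans (half u1 hu1) (le_trans k _).
  by rewrite ZE cu1 su1 le_eqVlt; apply/orP; left; apply/eqP; ring.
have [|_ _ k _ _] := hT u2; first by case/andP: hu2 => /(lt_le_trans Tt').
rewrite lerNr; apply: le_trans (half u2 hu2) (le_trans k _).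
by rewrite ZE cu2 su2 le_eqVlt; apply/orP; left; apply/eqP; ring.
Unshelve. all: by end_near. Qed.

End ChirpOfIntegral.

(** * Curves in polar coordinates *)

Section PolarCurve.
Variable R : realType.
Implicit Types (rho Psi drho dPsi rad : R -> R) (p c d t u T : R).

(** Radius and derivative of the radius, both compared with powers of the polar
    angle Psi. *)
Record polar_curve rho drho Psi dPsi p c T : Prop := PolarCurve {
  polar_rho : forall t, T <= t -> is_derive t 1 rho (drho t) ;
  polar_Psi : forall t, T <= t -> is_derive t 1 Psi (dPsi t) ;
  polar_dPsi : forall t, T <= t -> 0 < dPsi t ;
  polar_unbounded : forall M, exists2 t, T <= t & M <= Psi t ;
  polar_radius : forall d, 0 < d -> \forall t \near +oo,
    (1 - d) * (c * Psi t `^ (- p)) <= rho t <= (1 + d) * (c * Psi t `^ (- p)) ;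
  polar_speed : forall d, 0 < d -> \forall t \near +oo,
    (1 - d) * (p * c * (Psi t `^ (- p) / Psi t)) * dPsi t <= - drho t <=
    (1 + d) * (p * c * (Psi t `^ (- p) / Psi t)) * dPsi t }.

Lemma polar_le rho drho Psi dPsi p c T t u : polar_curve rho drho Psi dPsi p c T -> T <= t -> t <= u -> Psi t <= Psi u.
Proof.
move=> h Tt tu; apply: (@nondecreasing_derive_ge0 R Psi dPsi) => // x /andP[tx xu].
  by apply: (polar_Psi h); exact: le_trans tx.
by rewrite ltW// (polar_dPsi h)// (le_trans Tt).
Qed.

Lemma polar_surj rho drho Psi dPsi p c T t0 th : polar_curve rho drho Psi dPsi p c T -> T <= t0 -> Psi t0 <= th -> exists2 t, t0 <= t & Psi t = th.
Proof.
move=> h Tt0 t0th; have [S TS Sth] := polar_unbounded h th.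
have [St0|t0S] := leP S t0.
  exists t0 => //; apply: le_anti; rewrite t0th/= (le_trans Sth)//; exact: (polar_le h).
have cP : {within `[t0, S], continuous Psi}.
  apply: derivable_within_continuous => x; rewrite in_itv/= => /andP[t0x _].
  by have := polar_Psi h (le_trans Tt0 t0x) => ?; exact: ex_derive.
have [|t] := @IVT R Psi t0 S th (ltW t0S) cP.
  by rewrite ge_min t0th le_max Sth orbT.
by rewrite in_itv/= => /andP[t0t _] E; exists t.
Qed.

Lemma polar_transfer rho drho Psi dPsi p c T (P : R -> Prop) : polar_curve rho drho Psi dPsi p c T -> (\forall t \near +oo, P t) ->
  \forall th \near +oo, exists t, [/\ T <= t, Psi t = th & forall x, t <= x -> P x].
Proof.
move=> h [T1 [_ hP]]; pose T2 := Num.max T (T1 + 1).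
have TT2 : T <= T2 by rewrite le_max lexx.
near=> th.
have th2 : Psi T2 <= th by near: th; apply: nbhs_pinfty_ge; rewrite num_real.
have [t T2t E] := polar_surj h TT2 th2; exists t; split => //; first exact: le_trans T2t.
move=> x tx; apply: hP; apply: (@lt_le_trans _ _ (T1 + 1)); first by rewrite ltrDl.
by apply: le_trans tx; apply: le_trans T2t; rewrite le_max lexx orbT.
Unshelve. all: by end_near. Qed.

(** With rad defined through rad (Psi t) = rho t, increments of rad are
    increments of rho; they are bounded by those of K Psi because rho + K Psi is
    monotone for the appropriate K. *)
Lemma polar_decaying rho drho Psi dPsi p c T rad : polar_curve rho drho Psi dPsi p c T -> 0 < p <= 1 -> 0 < c ->
  (forall t, T <= t -> rad (Psi t) = rho t) -> decaying_radius rad p c.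
Proof.
move=> h /andP[p0 p1] c0 hrad; have pi0 := pi_gt0 R; split=> d d0.
  have := polar_transfer h (polar_radius h d0); apply: filterS => th [t [Tt <- ht]].
  by rewrite hrad// ht.
pose d' := Num.min d 1; have d'0 : 0 < d' by rewrite lt_min d0 ltr01.
have d'd : d' <= d by rewrite ge_min lexx.
have d'1 : d' <= 1 by rewrite ge_min lexx orbT.
have d20 : 0 < d' / 2 by rewrite divr_gt0.
have := polar_transfer h (polar_speed h d20) => htr; near=> th.
have [t [Tt Et ht]] : exists t, [/\ T <= t, Psi t = th & forall x, t <= x ->
   (1 - d' / 2) * (p * c * (Psi x `^ (- p) / Psi x)) * dPsi x <= - drho x <=
    (1 + d' / 2) * (p * c * (Psi x `^ (- p) / Psi x)) * dPsi x] by near: th.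
have th0 : 0 < th by near: th; apply: nbhs_pinfty_gt; rewrite num_real.
have thd : 2 * pi <= d' / 4 * th.
  rewrite [leRHS]mulrC -ler_pdivrMr ?divr_gt0//; near: th; apply: nbhs_pinfty_ge; rewrite num_real//.
move=> u /andP[thu uth].
have [t' tt' Et'] : exists2 t', t <= t' & Psi t' = u by apply: (polar_surj h) => //; rewrite Et.
pose k := p * c * (th `^ (- p) / th).
have k0 : 0 < k by rewrite /k !mulr_gt0 ?invr_gt0 ?powR_gt0.
have Pb x : t <= x <= t' -> th <= Psi x <= u.
  move=> /andP[tx xt']; rewrite -Et -Et' !(polar_le h)//; exact: le_trans tx.
have Pu x : t <= x <= t' -> - drho x <= (1 + d') * k * dPsi x.
  move=> xb; have /andP[tx _] := xb; have /andP[_ h1] := ht x tx.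
  have dP0 := ltW (polar_dPsi h (le_trans Tt tx)).
  apply: le_trans h1 _; apply: ler_wpM2r => //; apply: ler_pM.
  - by rewrite addr_ge0// ltW.
  - have /andP[hx _] := Pb x xb; have x0 : 0 < Psi x by exact: lt_le_trans hx.
    by rewrite !mulr_ge0 ?invr_ge0 ?powR_ge0// ltW.
  - by rewrite lerD2l; clear - d'0; lra.
  - have /andP[hx _] := Pb x xb; have x0 : 0 < Psi x by exact: lt_le_trans hx.
    apply: ler_wpM2l; first by rewrite mulr_ge0// ltW.
    apply: ler_pM; rewrite ?powR_ge0 ?invr_ge0 ?(ltW x0)//.
      by apply: powRN_ge => //; exact: ltW.
    by rewrite lef_pV2 ?posrE.
have Pl x : t <= x <= t' -> (1 - d') * k * dPsi x <= - drho x.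
  move=> xb; have /andP[tx _] := xb; have /andP[h1 _] := ht x tx.
  have dP0 := ltW (polar_dPsi h (le_trans Tt tx)).
  apply: le_trans h1; apply: ler_wpM2r => //.
  have /andP[hx hxu] := Pb x xb; have x0 : 0 < Psi x by exact: lt_le_trans hx.
  pose l := 1 + d' / 4.
  have l1 : 1 <= l by rewrite /l; clear - d'0; lra.
  have l0 : 0 < l by exact: lt_le_trans l1.
  have xl : Psi x <= l * th by rewrite /l mulrDl mul1r; clear - hxu uth thd; lra.
  have lth0 : 0 < l * th by rewrite mulr_gt0.
  have e1 : th `^ (- p) / l <= Psi x `^ (- p).
    apply: (@le_trans _ _ ((l * th) `^ (- p))).
      by apply: powRN_scale => //; rewrite (ltW p0).
    by apply: powRN_ge => //; exact: ltW.
  have e2 : (l * th)^-1 <= (Psi x)^-1 by rewrite lef_pV2 ?posrE.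
  have e3 : th `^ (- p) / l * (l * th)^-1 <= Psi x `^ (- p) / Psi x.
    by apply: ler_pM => //; rewrite ?divr_ge0 ?invr_ge0 ?powR_ge0 ?(ltW l0) ?(ltW lth0).
  have e4 : (1 - d') * (th `^ (- p) / th) <= (1 - d' / 2) * (th `^ (- p) / l * (l * th)^-1).
    have -> : th `^ (- p) / l * (l * th)^-1 = (th `^ (- p) / th) * (l^-1 ^+ 2).
      rewrite invfM; ring.
    rewrite [X in _ <= X]mulrCA [X in X <= _]mulrC ler_wpM2l ?divr_ge0 ?powR_ge0 ?(ltW th0)//.
    have il : 1 - d' / 4 <= l^-1.
      rewrite -[leRHS]div1r ler_pdivlMr// /l; clear - d'0; nra.
    have : (1 - d' / 4) ^+ 2 <= l^-1 ^+ 2.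
      by rewrite lerXn2r ?nnegrE ?invr_ge0 ?(ltW l0)//; clear - d'1; lra.
    have : 0 <= 1 - d' / 2 by clear - d'1; lra.
    clear - d'0 d'1; move: (l^-1 ^+ 2) => y h1 h2.
    have : (1 - d' / 2) * (1 - d' / 4) ^+ 2 <= (1 - d' / 2) * y by rewrite ler_wpM2l.
    nra.
  have e5 : (1 - d' / 2) * (th `^ (- p) / l * (l * th)^-1) <= (1 - d' / 2) * (Psi x `^ (- p) / Psi x).
    by apply: ler_wpM2l => //; clear - d'1; lra.
  rewrite /k ![(_ - _) * (p * c * _)]mulrCA ler_wpM2l ?mulr_ge0 ?(ltW p0) ?(ltW c0)//.
  exact: le_trans e5.
have dG (K : R) x : t <= x <= t' -> is_derive x 1 (fun x => rho x + K * Psi x) (drho x + K * dPsi x).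
  move=> /andP[tx _]; have r1 := polar_rho h (le_trans Tt tx); have r2 := polar_Psi h (le_trans Tt tx).
  by apply: is_derive_eq; rewrite /GRing.scale/=.
have dG' (K : R) x : t <= x <= t' -> is_derive x 1 (fun x => - (rho x + K * Psi x)) (- (drho x + K * dPsi x)).
  by move=> hx; have r := dG K x hx; exact: is_deriveN.
have upper : rho t - rho t' <= (1 + d') * k * (u - th).
  have := @nondecreasing_derive_ge0 R _ _ t t' tt' (dG ((1 + d') * k)).
  rewrite Et Et'; have g0 x : t <= x <= t' -> 0 <= drho x + (1 + d') * k * dPsi x.
    by move=> /Pu; rewrite -subr_ge0 opprK addrC.
  move=> /(_ g0); rewrite mulrBr; move: ((1 + d') * k * th) ((1 + d') * k * u) => y z.
  clear; lra.
have lower : (1 - d') * k * (u - th) <= rho t - rho t'.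
  have := @nondecreasing_derive_ge0 R _ _ t t' tt' (dG' ((1 - d') * k)).
  rewrite Et Et'; have g0 x : t <= x <= t' -> 0 <= - (drho x + (1 - d') * k * dPsi x).
    by move=> /Pl; rewrite -subr_ge0 opprD.
  move=> /(_ g0); rewrite mulrBr; move: ((1 - d') * k * th) ((1 - d') * k * u) => y z.
  clear; lra.
rewrite -Et hrad// Et -Et' hrad ?(le_trans Tt)// Et' -/k.
have uth0 : 0 <= k * (u - th) by rewrite mulr_ge0 ?subr_ge0// ltW.
apply/andP; split.
  apply: le_trans lower; rewrite -[leLHS]mulrA -[leRHS]mulrA ler_wpM2r//; clear - d'd; lra.
by apply: le_trans upper _; rewrite -[leLHS]mulrA -[leRHS]mulrA ler_wpM2r//; clear - d'd; lra.
Unshelve. all: by end_near. Qed.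

End PolarCurve.

Section PolarOfLimits.
Variable R : realType.
Implicit Types (A B dA dB F G : R -> R) (p w sg a b c t u T l : R).

Lemma cvg_near F G l : (\forall t \near +oo, F t = G t) ->
  F t @[t --> +oo] --> l -> G t @[t --> +oo] --> l.
Proof. by move=> e; apply: cvg_trans; apply: near_eq_cvg. Qed.

Lemma cvg_inv_pinfty : (t : R)^-1 @[t --> +oo] --> (0 : R).
Proof.
apply/cvgrPdist_le => e e0; near=> t.
have t0 : 0 < t by near: t; apply: nbhs_pinfty_gt; rewrite num_real.
rewrite sub0r normrN ger0_norm ?invr_ge0 ?(ltW t0)// -[leRHS]invrK lef_pV2 ?posrE ?invr_gt0//.
Unshelve. all: by end_near. Qed.

Lemma continuous_powR_gt0 p u : 0 < u -> {for u, continuous (fun x => x `^ p)}.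
Proof.
move=> u0; apply: differentiable_continuous; apply/derivable1_diffP.
by have := is_derive_powR p u0 => ?; exact: ex_derive.
Qed.

Definition modulus A B t := Num.sqrt (A t ^+ 2 + B t ^+ 2).
Definition dmodulus A B dA dB t := (A t * dA t + B t * dB t) / modulus A B t.
Definition phase w sg A B t := w * t + sg * atan (B t / A t).
Definition dphase w sg A B dA dB t :=
  w + sg * ((dB t * A t - B t * dA t) / modulus A B t ^+ 2).

Lemma modulus_gt0 A B t : 0 < A t -> 0 < modulus A B t.
Proof. by move=> A0; rewrite sqrtr_gt0 ltr_wpDr ?sqr_ge0// exprn_gt0. Qed.

Lemma modulus2 A B t : modulus A B t ^+ 2 = A t ^+ 2 + B t ^+ 2.
Proof. by rewrite sqr_sqrtr// addr_ge0 ?sqr_ge0. Qed.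

Lemma is_derive_modulus A B dA dB t : 0 < A t ->
  is_derive t 1 A (dA t) -> is_derive t 1 B (dB t) ->
  is_derive t 1 (modulus A B) (dmodulus A B dA dB t).
Proof.
move=> A0 hA hB; have m0 := modulus_gt0 B A0.
have q0 : 0 < A t ^+ 2 + B t ^+ 2 by rewrite ltr_wpDr ?sqr_ge0// exprn_gt0.
have hq : is_derive t 1 (fun t => A t ^+ 2 + B t ^+ 2) (2 * (A t * dA t + B t * dB t)).
  by apply: is_derive_eq; rewrite /GRing.scale/=; ring.
have hs := is_derive1_sqrt q0.
have := @is_derive1_comp _ Num.sqrt (fun t => A t ^+ 2 + B t ^+ 2) t _ _ hs hq.
rewrite (_ : _ * _ = dmodulus A B dA dB t)//.
rewrite /dmodulus -/(modulus A B t); field; by rewrite gt_eqF.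
Qed.

Lemma is_derive_phase w sg A B dA dB t : 0 < A t ->
  is_derive t 1 A (dA t) -> is_derive t 1 B (dB t) ->
  is_derive t 1 (phase w sg A B) (dphase w sg A B dA dB t).
Proof.
move=> A0 hA hB; have m0 := modulus_gt0 B A0.
have An : A t != 0 by rewrite gt_eqF.
have hV := is_deriveV An hA.
have hq : is_derive t 1 (fun t => B t / A t) ((dB t * A t - B t * dA t) / A t ^+ 2).
  apply: (is_derive_eq (is_deriveM hB hV)); rewrite /GRing.scale/=.
  by move: (A t) An => y y0; field.
have hs := is_derive1_atan (B t / A t).
have hat := @is_derive1_comp _ atan (fun t => B t / A t) t _ _ hs hq.
have hl : is_derive t 1 (fun t : R => w * t) w by apply: is_derive_eq; rewrite /GRing.scale/= mulr1.
have hr := @is_deriveZ _ _ _ _ sg _ _ _ hat.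
apply: (is_derive_eq (is_deriveD hl hr)); rewrite /dphase /GRing.scale/=.
congr (_ + _ * _); rewrite modulus2.
have q0 : A t ^+ 2 + B t ^+ 2 != 0 by rewrite -modulus2 expf_neq0// gt_eqF.
by move: (A t) An (B t) q0 => y y0 z q0; field; rewrite q0.
Qed.

Lemma near_pinfty_all (P : R -> Prop) : (\forall t \near +oo, P t) ->
  \forall T \near +oo, forall t, T <= t -> P t.
Proof.
move=> [T [_ h]]; near=> T' => t Tt; apply: h; apply: lt_le_trans Tt.
by near: T'; apply: nbhs_pinfty_gt; rewrite num_real.
Unshelve. all: by end_near. Qed.

(** Everything is expressed through the functions t^p A, t^p B, t^(p+1) A' and
    t^(p+1) B', which have limits. The limits of the last two are proportional
    to those of the first two, so that the angular velocity of (A, B) is o(1/t)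
    and dPsi tends to w. *)
Lemma polar_of_limits A B dA dB a b p w sg : 0 < a -> 0 < p -> 0 < w ->
  (forall t, is_derive t 1 A (dA t)) -> (forall t, is_derive t 1 B (dB t)) ->
  A t * t `^ p @[t --> +oo] --> a -> B t * t `^ p @[t --> +oo] --> b ->
  t * dA t * t `^ p @[t --> +oo] --> - (p * a) ->
  t * dB t * t `^ p @[t --> +oo] --> - (p * b) ->
  let c := Num.sqrt (a ^+ 2 + b ^+ 2) * w `^ p in
  \forall T \near +oo, (forall t, T <= t -> 0 < A t) /\
   polar_curve (modulus A B) (dmodulus A B dA dB) (phase w sg A B)
     (dphase w sg A B dA dB) p c T.
Proof.
move=> a0 p0 w0 hA hB la lb lda ldb c.
pose c1 := Num.sqrt (a ^+ 2 + b ^+ 2).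
have q0 : 0 < a ^+ 2 + b ^+ 2 by rewrite ltr_wpDr ?sqr_ge0// exprn_gt0.
have c10 : 0 < c1 by rewrite sqrtr_gt0.
have c12 : c1 ^+ 2 = a ^+ 2 + b ^+ 2 by rewrite sqr_sqrtr// ltW.
have wp0 : 0 < w `^ p by rewrite powR_gt0.
have c0 : 0 < c by rewrite mulr_gt0.
have A0 : \forall t \near +oo, 0 < A t.
  near=> t; have h : 0 < A t * t `^ p by near: t; apply: (cvgr_gt _ la).
  have t0 : 0 < t by near: t; apply: nbhs_pinfty_gt; rewrite num_real.
  by move: h; rewrite pmulr_lgt0// powR_gt0.
have t0 : \forall t \near +oo, 0 < (t : R) by apply: nbhs_pinfty_gt; rewrite num_real.
pose rho := modulus A B; pose drho := dmodulus A B dA dB.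
pose Psi := phase w sg A B; pose dPsi := dphase w sg A B dA dB.
have lrho : rho t * t `^ p @[t --> +oo] --> c1.
  apply: (@cvg_near (fun t => Num.sqrt ((A t * t `^ p) ^+ 2 + (B t * t `^ p) ^+ 2))).
    near=> t; rewrite !exprMn -mulrDl sqrtrM ?addr_ge0 ?sqr_ge0// sqrtr_sqr.
    by rewrite ger0_norm ?powR_ge0.
  apply: (@cvg_comp _ _ _ (fun t => (A t * t `^ p) ^+ 2 + (B t * t `^ p) ^+ 2) Num.sqrt _ (nbhs (a ^+ 2 + b ^+ 2))); last exact: sqrt_continuous.
  by apply: cvgD; rewrite !expr2; apply: cvgM.
have ldrho : t * drho t * t `^ p @[t --> +oo] --> - (p * c1).
  have -> : - (p * c1) = (a * (- (p * a)) + b * (- (p * b))) / c1.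
    have -> : a * (- (p * a)) + b * (- (p * b)) = - (p * c1 ^+ 2) by rewrite c12; ring.
    by field; rewrite gt_eqF.
  apply: (@cvg_near (fun t => ((A t * t `^ p) * (t * dA t * t `^ p) + (B t * t `^ p) * (t * dB t * t `^ p)) / (rho t * t `^ p))).
    near=> t; have r0 : 0 < rho t by apply: modulus_gt0; near: t.
    have tp0 : 0 < t `^ p by rewrite powR_gt0//; near: t.
    rewrite /drho /dmodulus -/(rho t); move: (t `^ p) (rho t) tp0 r0 => y z y0 z0.
    by field; rewrite !gt_eqF.
  apply: cvgM; first by apply: cvgD; apply: cvgM.
  by apply: cvgV => //; rewrite gt_eqF.
have ldPsi : dPsi t @[t --> +oo] --> w.
  have -> : w = w + sg * ((- (p * b) * a - b * (- (p * a))) / c1 ^+ 2 * 0) by rewrite !mulr0 addr0.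
  apply: (@cvg_near (fun t => w + sg * (((t * dB t * t `^ p) * (A t * t `^ p) - (B t * t `^ p) * (t * dA t * t `^ p)) / (rho t * t `^ p) ^+ 2 * t^-1))).
    near=> t; have r0 : 0 < rho t by apply: modulus_gt0; near: t.
    have tp0 : 0 < t `^ p by rewrite powR_gt0//; near: t.
    have t1 : 0 < t by near: t.
    rewrite /dPsi /dphase -/(rho t); move: (t `^ p) (rho t) tp0 r0 => y z y0 z0.
    by congr (_ + _ * _); field; rewrite !gt_eqF.
  apply: cvgD; first exact: cvg_cst.
  apply: cvgM; first exact: cvg_cst.
  apply: cvgM; last exact: cvg_inv_pinfty.
  apply: cvgM; first by apply: cvgB; apply: cvgM.
  apply: cvgV; first by rewrite expf_neq0// gt_eqF.
  by rewrite !expr2; apply: cvgM.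
have lPsi : Psi t / t @[t --> +oo] --> w.
  have -> : w = w + sg * (atan (b / a) * 0) by rewrite !mulr0 addr0.
  apply: (@cvg_near (fun t => w + sg * (atan ((B t * t `^ p) / (A t * t `^ p)) * t^-1))).
    near=> t; have tp0 : 0 < t `^ p by rewrite powR_gt0//; near: t.
    have t1 : 0 < t by near: t.
    rewrite /Psi /phase invfM mulrACA divff ?gt_eqF// mulr1.
    by field; rewrite gt_eqF.
  apply: cvgD; first exact: cvg_cst.
  apply: cvgM; first exact: cvg_cst.
  apply: cvgM; last exact: cvg_inv_pinfty.
  apply: (@cvg_comp _ _ _ (fun t => (B t * t `^ p) / (A t * t `^ p)) atan _ (nbhs (b / a))); last exact: continuous_atan.
  by apply: cvgM => //; apply: cvgV => //; rewrite gt_eqF.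
have Psi_ge : \forall t \near +oo, w / 2 * t <= Psi t.
  near=> t; have t1 : 0 < t by near: t.
  rewrite -ler_pdivlMr//; apply: ltW; near: t; apply: (cvgr_gt _ lPsi); lra.
have Psi0 : \forall t \near +oo, 0 < Psi t.
  near=> t; have t1 : 0 < t by near: t.
  by apply: (@lt_le_trans _ _ (w / 2 * t)); [rewrite mulr_gt0 ?divr_gt0|near: t].
have dPsi0 : \forall t \near +oo, 0 < dPsi t by apply: (cvgr_gt _ ldPsi).
have lPsip : (Psi t / t) `^ p @[t --> +oo] --> w `^ p.
  apply: (@cvg_comp _ _ _ (fun t => Psi t / t) (fun x => x `^ p) _ (nbhs w)) => //.
  exact: continuous_powR_gt0.
have PsiE t : 0 < t -> 0 < Psi t -> (Psi t / t) `^ p * t `^ p = Psi t `^ p.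
  move=> t1 P1; rewrite -powRM ?divr_ge0 ?(ltW t1) ?(ltW P1)//.
  by rewrite divfK ?gt_eqF.
have lrad : rho t * Psi t `^ p @[t --> +oo] --> c.
  apply: (@cvg_near (fun t => rho t * t `^ p * (Psi t / t) `^ p)); last exact: cvgM.
  near=> t; have t1 : 0 < t by near: t.
  have P1 : 0 < Psi t by near: t.
  by rewrite -(PsiE t t1 P1); ring.
have lspeed : - drho t * Psi t * Psi t `^ p / dPsi t @[t --> +oo] --> p * c.
  have -> : p * c = - (- (p * c1)) * w * w `^ p / w.
    by rewrite /c -/c1; field; rewrite gt_eqF.
  apply: (@cvg_near (fun t => - (t * drho t * t `^ p) * (Psi t / t) * (Psi t / t) `^ p / dPsi t)).
    near=> t; have t1 : 0 < t by near: t.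
    have P1 : 0 < Psi t by near: t.
    rewrite -(PsiE t t1 P1); congr (_ / _).
    by move: (t `^ p) (_ `^ p) => y z; field; rewrite gt_eqF.
  apply: cvgM; last by apply: cvgV => //; rewrite gt_eqF.
  apply: cvgM => //; apply: cvgM => //; exact: cvgN.
near=> T; split; first by near: T; exact: near_pinfty_all.
have AT t : T <= t -> 0 < A t by move: t; near: T; exact: near_pinfty_all.
split.
- by move=> t Tt; apply: is_derive_modulus => //; exact: AT.
- by move=> t Tt; apply: is_derive_phase => //; exact: AT.
- by near: T; exact: near_pinfty_all.
- move=> M; near (pinfty_nbhs R) => t.
  have Tt : T <= t by near: t; apply: nbhs_pinfty_ge; rewrite num_real.
  have Mt : M / (w / 2) <= t by near: t; apply: nbhs_pinfty_ge; rewrite num_real.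
  have wt : w / 2 * t <= Psi t by near: t.
  exists t => //; apply: le_trans wt.
  by rewrite [leRHS]mulrC -ler_pdivrMr ?divr_gt0.
- move=> d d0; have dc : 0 < d * c by rewrite mulr_gt0.
  have /cvgrPdist_le /(_ (d * c) dc) hd := lrad; near=> t.
  have P1 : 0 < Psi t by near: t.
  have Pp : 0 < Psi t `^ p by rewrite powR_gt0.
  have : `|c - rho t * Psi t `^ p| <= d * c by near: t.
  rewrite ler_norml powRN -/(rho t) -/(Psi t) => /andP[h1 h2].
  rewrite [(1 - d) * _]mulrA [(1 + d) * _]mulrA ler_pdivrMr// ler_pdivlMr//; clear - h1 h2; lra.
- move=> d d0; have dc : 0 < d * (p * c) by rewrite !mulr_gt0.
  have /cvgrPdist_le /(_ (d * (p * c)) dc) hd := lspeed; near=> t.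
  have P1 : 0 < Psi t by near: t.
  have Pp : 0 < Psi t `^ p by rewrite powR_gt0.
  have dP : 0 < dPsi t by near: t.
  have : `|p * c - - drho t * Psi t * Psi t `^ p / dPsi t| <= d * (p * c) by near: t.
  rewrite -/(drho t) -/(Psi t) -/(dPsi t).
  rewrite ler_norml => /andP[]; set y := - drho t * _ * _ / _ => h1 h2.
  have -> : - drho t = (- drho t * Psi t * Psi t `^ p / dPsi t) * (Psi t `^ (- p) / Psi t * dPsi t).
    by rewrite powRN; field; rewrite !gt_eqF.
  have k0 : 0 < Psi t `^ (- p) / Psi t * dPsi t by rewrite !mulr_gt0 ?invr_gt0 ?powR_gt0.
  have kE e : (1 + e) * (p * c * (Psi t `^ (- p) / Psi t)) * dPsi t =
      ((1 + e) * (p * c)) * (Psi t `^ (- p) / Psi t * dPsi t) by ring.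
  rewrite !kE -/y; move: y (_ * dPsi t) k0 h1 h2 => y k k0 h1 h2.
  rewrite !ler_pM2r//; move: (p * c) h1 h2 => z h1 h2; clear - h1 h2; lra.
Unshelve. all: by end_near. Qed.

End PolarOfLimits.

(** * The oscillatory integral as a plane curve *)

Section ComplexIntegral.
Variable R : realType.
Implicit Types (f g h q phi F : R -> R) (x th t w p : R) (s N : nat).

Lemma osc_integralE f phi t :
  osc_integral f phi t = osc f phi 0 t +i* osc f phi (- (pi / 2)) t.
Proof.
rewrite /osc_integral /Cintegral; congr (_ +i* _); apply: eq_Rintegral => x _ /=.
  by rewrite mulr0 subr0 addr0.
by rewrite mulr0 add0r -/(_ - pi / 2) cosB cos_pihalf sin_pihalf mulr0 mulr1 add0r.
Qed.

Lemma osc_integral_shift f phi t w : continuous f -> continuous phi ->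
  compactly_supported phi -> let g x := f x - w in
  osc_integral f phi t = cis (t * w) * (osc g phi 0 t +i* osc g phi (- (pi / 2)) t).
Proof.
move=> cf cphi sphi g; rewrite osc_integralE (@osc_shift R f phi 0 t w cf cphi sphi) (@osc_shift R f phi (- (pi / 2)) t w cf cphi sphi) -/g.
rewrite addr0 -/(w * t - pi / 2) cosB sinB cos_pihalf sin_pihalf !mulr0 !mulr1 add0r sub0r.
by rewrite /cis; simpc; rewrite [t * w]mulrC; congr (_ +i* _); ring.
Qed.

Lemma normc_cis t : Normc.normc (cis t : R[i]) = 1.
Proof. by rewrite /cis /= cos2Dsin2 sqrtr1. Qed.

Lemma normc_ge0 (z : R[i]) : 0 <= Normc.normc z.
Proof. by case: z => a b; exact: sqrtr_ge0. Qed.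

Lemma normc_le (a b : R) : Normc.normc (a +i* b) <= `|a| + `|b|.
Proof.
have ab : 0 <= `|a| + `|b| by rewrite addr_ge0.
rewrite /= -(ger0_norm ab) -sqrtr_sqr ler_wsqrtr// sqrrD !real_normK ?num_real//.
by rewrite -addrA [_ *+ 2 + _]addrC addrA lerDl mulrn_wge0// mulr_ge0.
Qed.

Lemma sum_complex (r : seq nat) (a b x : nat -> R) :
  \sum_(j <- r) (a j +i* b j) * (x j)%:C =
  (\sum_(j <- r) a j * x j) +i* (\sum_(j <- r) b j * x j).
Proof.
elim: r => [|j r IH]; first by rewrite !big_nil.
by rewrite !big_cons IH; simpc.
Qed.

(** The rotation e^(i w t) has modulus 1, so the real and imaginary parts can be
    expanded separately. *)
Lemma asymptotic_expansion_of_expands f phi w s (a b : nat -> R) :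
  continuous f -> continuous phi -> compactly_supported phi -> (0 < s)%N ->
  let g x := f x - w in
  expands (osc g phi 0) s a -> expands (osc g phi (- (pi / 2))) s b ->
  asymptotic_expansion (osc_integral f phi) w s (fun j => a j +i* b j).
Proof.
move=> cf cphi sphi s0 g ha hb N; have sR : 0 < s%:R :> R by rewrite ltr0n.
have [C [C0 hC]] : exists C, 0 <= C /\ \forall t \near +oo,
    Normc.normc (osc_integral f phi t - cis (t * w) *
      \sum_(1 <= j < N.+1) (a j +i* b j) * (t `^ (- (j%:R / s%:R)))%:C) <= C * t `^ (- (N.+1%:R / s%:R)).
  have [Ca hCa] := ha N; have [Cb hCb] := hb N.
  exists (`|Ca| + `|Cb|); split; first by rewrite addr_ge0.
  near=> t; rewrite (osc_integral_shift t w)// -/g -mulrBr Normc.normcM normc_cis mul1r.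
  rewrite sum_complex; simpc; apply: le_trans (normc_le _ _) _.
  rewrite [leRHS]mulrDl; apply: lerD.
    apply: (@le_trans _ _ (Ca * t `^ (- (N.+1%:R / s%:R)))); first by near: t.
    by rewrite ler_wpM2r ?powR_ge0// ler_norm.
  apply: (@le_trans _ _ (Cb * t `^ (- (N.+1%:R / s%:R)))); first by near: t.
  by rewrite ler_wpM2r ?powR_ge0// ler_norm.
apply/cvgrPdist_le => e e0; near=> t.
have t0 : 0 < t by near: t; apply: nbhs_pinfty_gt; rewrite num_real.
have ht : C * t `^ (- s%:R^-1) <= e.
  apply: (@le_trans _ _ ((C + 1) * t `^ (- s%:R^-1))).
    by rewrite ler_wpM2r ?powR_ge0// lerDl.
  rewrite mulrC -ler_pdivlMr ?ltr_wpDl//; near: t; apply: near_powRN_le; first by rewrite invr_gt0.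
  by rewrite divr_gt0// ltr_wpDl.
rewrite sub0r normrN ger0_norm; last by rewrite mulr_ge0 ?powR_ge0// normc_ge0.
apply: le_trans ht.
have -> : C * t `^ (- s%:R^-1) = C * t `^ (- (N.+1%:R / s%:R)) * t `^ (N%:R / s%:R).
  rewrite -mulrA -powRD ?(gt_eqF t0) ?implybT//; congr (_ * _ `^ _).
  by rewrite -natr1 mulrDl mul1r opprD addrAC addNr add0r.
by apply: ler_wpM2r; [exact: powR_ge0|near: t].
Unshelve. all: by end_near. Qed.

Lemma polar_atan (A B : R) : 0 < A ->
  A = Num.sqrt (A ^+ 2 + B ^+ 2) * cos (atan (B / A)) /\
  B = Num.sqrt (A ^+ 2 + B ^+ 2) * sin (atan (B / A)).
Proof.
move=> A0; have An : A != 0 by rewrite gt_eqF.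
have cE : Num.sqrt (A ^+ 2 + B ^+ 2) * cos (atan (B / A)) = A.
  rewrite cos_atan (_ : A ^+ 2 + B ^+ 2 = A ^+ 2 * (1 + (B / A) ^+ 2)); last by field.
  rewrite sqrtrM ?sqr_ge0// sqrtr_sqr ger0_norm ?(ltW A0)// mulfK//.
  by rewrite gt_eqF// sqrtr_gt0 ltr_wpDr ?sqr_ge0.
split=> //; have cn : cos (atan (B / A)) != 0.
  by apply/eqP => c0; move: cE; rewrite c0 mulr0 => /esym/eqP; rewrite (negbTE An).
have := atanK (B / A); rewrite /tan => /(congr1 (fun z => z * cos (atan (B / A)))).
by rewrite divfK// => ->; rewrite mulrCA cE divfK.
Qed.

Lemma polar_inj rho drho Psi dPsi p c T t u : polar_curve rho drho Psi dPsi p c T ->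
  T <= t -> T <= u -> Psi t = Psi u -> t = u.
Proof.
move=> h; wlog tu : t u / t <= u => [H Tt Tu E|Tt Tu E].
  by have [/H|/ltW/H H'] := leP t u; [exact|apply/esym/H'].
apply: le_anti; rewrite tu/= leNgt; apply/negP => ltu.
have [|x /andP[tx _] Ex] := @mean_value R Psi dPsi t u tu.
  by move=> x /andP[tx _]; apply: (polar_Psi h); exact: le_trans tx.
have := polar_dPsi h (le_trans Tt tx); rewrite ltNge => /negP; apply.
move: Ex; rewrite E subrr => /esym/eqP; rewrite mulf_eq0 subr_eq0 [u == t]gt_eqF// orbF.
by move=> /eqP ->.
Qed.

(** With sg the sign of w, a negative frequency reflects the spiral in the
    horizontal axis. *)
Lemma curve_tail_spiral f phi w sg (T : R) drho dPsi p c : continuous f -> continuous phi ->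
  compactly_supported phi -> sg = 1 \/ sg = -1 -> w = sg * `|w| ->
  let g x := f x - w in
  let A := osc g phi 0 in let B := osc g phi (- (pi / 2)) in
  (forall t, T <= t -> 0 < A t) ->
  polar_curve (modulus A B) drho (phase `|w| sg A B) dPsi p c T ->
  exists2 rad, (forall t, T <= t -> rad (phase `|w| sg A B t) = modulus A B t) &
    forall tau0, T <= tau0 ->
      curve_tail (osc_integral f phi) tau0 = spiral rad sg (phase `|w| sg A B tau0).
Proof.
move=> cf cphi sphi sg1 wE g A B A0 P; pose Psi := phase `|w| sg A B.
have sgsg : sg * sg = 1 by case: sg1 => ->; ring.
(* Psi is injective beyond T *)
pose rad th := modulus A B (xget T [set t | T <= t /\ Psi t = th]).
have radE t : T <= t -> rad (Psi t) = modulus A B t.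
  move=> Tt; rewrite /rad; congr (modulus A B _); case: xgetP => [u _ [Tu Eu]|/(_ t)].
    exact: (polar_inj P Tu Tt Eu).
  by case.
exists rad => // tau0 Ttau.
have JE t : T <= t -> (complex.Re (osc_integral f phi t), complex.Im (osc_integral f phi t)) =
    (rad (Psi t) * cos (Psi t), sg * (rad (Psi t) * sin (Psi t))).
  move=> Tt; rewrite radE// (osc_integral_shift t w)// -/g -/A -/B.
  have [EA EB] := polar_atan (B t) (A0 t Tt).
  have E : t * w + atan (B t / A t) = sg * Psi t.
    by rewrite {1}wE /Psi /phase mulrDr !mulrA sgsg mul1r; congr (_ + _); ring.
  have cE : cos (t * w + atan (B t / A t)) = cos (Psi t).
    by rewrite E; case: sg1 => ->; rewrite ?mul1r ?mulN1r ?cosN.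
  have sE : sin (t * w + atan (B t / A t)) = sg * sin (Psi t).
    by rewrite E; case: sg1 => ->; rewrite ?mul1r ?mulN1r ?sinN.
  rewrite mulrCA -sE -cE cosD sinD /=.
  move: EA EB; rewrite -/(modulus A B t).
  move: (modulus A B t) (cos (atan _)) (sin (atan _)) => m ca sa -> ->.
  by congr (_, _); ring.
rewrite /curve_tail /spiral; apply/seteqP; split=> [_ [t /= tau0t <-]|_ [th /= th0 <-]].
  have Tt := le_trans Ttau tau0t; exists (Psi t); first exact: (polar_le P).
  by rewrite -JE.
have [t tau0t <-] := polar_surj P Ttau th0.
by exists t => //; rewrite JE// (le_trans Ttau).
Qed.

Lemma spiral_content_scaled (c w : R) s : 0 < c -> 0 < w -> (2 <= s)%N ->
  spiral_content s%:R^-1 (c * w `^ s%:R^-1) =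
  c `^ (2 * s%:R / (s%:R + 1)) * pi * (pi / (s%:R * w)) `^ (- (2 / (s%:R + 1))) *
  ((s%:R + 1) / (s%:R - 1)).
Proof.
move=> c0 w0 s2; have sR : 2 <= s%:R :> R by rewrite ler_nat.
rewrite /spiral_content; move: (s%:R) sR (@pi R) (pi_gt0 R) => {}s {}s2 pi pi0.
have s0 : 0 < s by clear - s2; lra.
have sn : s != 0 by rewrite gt_eqF.
have s1 : s + 1 != 0 by rewrite gt_eqF// addr_gt0.
have s1' : s - 1 != 0 by rewrite gt_eqF//; clear - s2; lra.
have -> : 2 / (1 + s^-1) = 2 * s / (s + 1) by field; rewrite s1 sn.
have -> : 2 * s^-1 / (1 + s^-1) = 2 / (s + 1) by field; rewrite s1 sn.
have -> : (1 + s^-1) / (1 - s^-1) = (s + 1) / (s - 1) by field; rewrite s1' sn.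
rewrite powRM ?powR_ge0 ?(ltW c0)// -powRrM.
have -> : s^-1 * (2 * s / (s + 1)) = 2 / (s + 1) by field; rewrite s1 sn.
have -> : pi / (s * w) = pi * s^-1 * w^-1 by rewrite invfM mulrA.
rewrite [in RHS]powRM ?mulr_ge0 ?invr_ge0 ?(ltW w0) ?(ltW s0) ?(ltW pi0)//.
rewrite powRN_inv//; ring.
Qed.

End ComplexIntegral.

Section LeadingCoefficient.
Variable R : realType.
Implicit Types (f g h q phi : R -> R) (s : nat) (c : R[i]).

Definition zero_order f s := [/\ (0 < s)%N,
  forall k, (0 < k < s)%N -> derive1n k f 0 = 0 & derive1n s f 0 != 0].

Lemma zero_order_unique f s s' : zero_order f s -> zero_order f s' -> s = s'.
Proof.
move=> [s0 hs ns] [s'0 hs' ns']; case: (ltngtP s s') => // ss'.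
  by move: ns; rewrite hs' ?eqxx// s0.
by move: ns'; rewrite hs ?eqxx// s'0.
Qed.

Definition has_lead f phi s c :=
  let g x := f x - f 0 in
  decays (fun t => osc g phi 0 t - complex.Re c * t `^ (- s%:R^-1)) (2 / s%:R) /\
  decays (fun t => osc g phi (- (pi / 2)) t - complex.Im c * t `^ (- s%:R^-1)) (2 / s%:R).

(** The leading coefficients of all the amplitudes with value v at 0. *)
Definition leading_set f (v : R) : set R[i] := [set c | exists phi s,
  [/\ zero_order f s, admissible (fun x => f x - f 0) phi, phi 0 = v & has_lead f phi s c]].

Definition leading_coefficient f (v : R) : R[i] := xget 0 (leading_set f v).

(** The difference of two amplitudes with the same value at 0 vanishes there,
    hence contributes O(t^(-2/s)). *)
Lemma leading_coefficientP f phi s c : smooth f -> zero_order f s ->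
  admissible (fun x => f x - f 0) phi -> has_lead f phi s c ->
  c = leading_coefficient f (phi 0).
Proof.
move=> sf fs A [hr hi]; have [s0 fk fn] := fs.
have sR : 0 < s%:R :> R by rewrite ltr0n.
have pr : s%:R^-1 < 2 / s%:R :> R by rewrite -[ltLHS]div1r ltr_pM2r ?invr_gt0// ltr1n.
rewrite /leading_coefficient; case: xgetP => [c' _ [psi [s' [fs' A' E [hr' hi']]]]|/(_ c) []]; last first.
  by exists phi, s.
have ss := zero_order_unique fs' fs; rewrite {s'}ss in fs' hr' hi'.
have [h [q P]] := phase_form_exists sf s0 fk fn.
have sg := phase_smooth P.
have AN : admissible (fun x => f x - f 0) (fun x => -1 * psi x).
  by have := admM A' (@smooth_cst R (-1)); congr admissible; apply/funext => x; rewrite mulrC.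
have same th (a b : R) : decays (fun t => osc (fun x => f x - f 0) phi th t - a * t `^ (- s%:R^-1)) (2 / s%:R) ->
   decays (fun t => osc (fun x => f x - f 0) psi th t - b * t `^ (- s%:R^-1)) (2 / s%:R) -> a = b.
  move=> ha hb; apply: (lead_unique pr ha).
  have D : decays (osc (fun x => f x - f 0) (fun x => phi x + -1 * psi x) th) (2 / s%:R).
    apply: (osc_lead0 th P); first exact: admD.
    by rewrite E mulN1r subrr.
  apply: decays_near (decaysD hb D); near=> t.
  rewrite adm_oscD// adm_oscZ//; ring.
case: c {hr hi} (same 0 _ _ hr hr') (same _ _ _ hi hi') => a b /= -> ->.
by case: c' {hr' hi'}.
Unshelve. all: by end_near. Qed.

End LeadingCoefficient.

Theorem theorem1 (R : realType) :
  exists c1 : (R -> R) -> R -> R[i],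
  forall (f phi : R -> R) (s : nat),
    standard_amplitude phi ->
    standard_phase f phi ->
    0 < phi 0 ->
    smooth f ->
    finite_order_on (supp phi) f ->
    f 0 != 0 ->
    (2 <= s)%N ->
    (forall k : nat, (0 < k < s)%N -> f^`(k) 0 = 0) ->
    f^`(s) 0 != 0 ->
    let J := osc_integral f phi in
    let X := fun tau : R => complex.Re (J tau) in
    let Y := fun tau : R => complex.Im (J tau) in
    let d' : R := (3 * s%:R - 1) / (2 * s%:R) in
    let d : R := (2 * s%:R) / (s%:R + 1) in
    [/\ has_oscillatory_dim X d', has_oscillatory_dim Y d',
        \forall t0 \near 0^'+, minkowski_nondegenerate (inv_graph X t0)
      & \forall t0 \near 0^'+, minkowski_nondegenerate (inv_graph Y t0)]
    /\
    exists C : nat -> R[i],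
      [/\ asymptotic_expansion J (f 0) s C,
          C 1%N = c1 f (phi 0),
          has_curve_dim J d,
          \forall tau0 \near +oo, minkowski_measurable (curve_tail J tau0)
        & \forall tau0 \near +oo,
            has_content d (curve_tail J tau0)
              (Normc.normc (C 1%N) `^ d * pi
               * (pi / (s%:R * `|f 0|)) `^ (- (2 / (s%:R + 1)))
               * ((s%:R + 1) / (s%:R - 1)))%:E].
Proof.
exists (@leading_coefficient R) => f phi s amp ph phi00 sf fin f0 s2 fk fs J X Y d' d.
have [sphi phi0 _ _] := amp.
have [_ _ crit] := ph.
have s0 : (0 < s)%N by exact: ltnW.
have sR : 0 < s%:R :> R by rewrite ltr0n.
have sR2 : 2 <= s%:R :> R by rewrite ler_nat.
have [h [q P]] := phase_form_exists sf s0 fk fs.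
have A := standard_admissible sf amp crit fin.
have cA := adm_compactly_supported A.
have cf := smooth_continuous sf; have cphi := smooth_continuous sphi.
pose p : R := s%:R^-1.
have p0 : 0 < p by rewrite invr_gt0.
have p1 : p < 1 by rewrite invf_lt1// (lt_le_trans _ sR2)// ltr1n.
have p01 : 0 < p < 1 by rewrite p0.
have pr : p < 2 / s%:R by rewrite /p -[ltLHS]div1r ltr_pM2r ?invr_gt0// ltr1n.
split.
  have graph th : \forall t0 \near 0^'+, tube_order (inv_graph (osc f phi th) t0) d'.
    have [M [m [L [t1 hZ]]]] := osc_chirp th P s2 sf f0 A phi0 phi00.
    have := chirp_tube_order hZ p01.
    have -> // : (3 - p) / 2 = d'.
    by rewrite /p /d'; clear - sR; field; rewrite gt_eqF.
  have d'0 : 0 <= d'.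
    by rewrite divr_ge0 ?mulr_ge0 ?(ltW sR)//; clear - sR2; lra.
  have XE : X = osc f phi 0 by apply/funext => t; rewrite /X /J osc_integralE.
  have YE : Y = osc f phi (- (pi / 2)) by apply/funext => t; rewrite /Y /J osc_integralE.
  rewrite /has_oscillatory_dim XE YE; split.
  - by apply: filterS (graph 0) => t0; exact: tube_order_box_dim.
  - by apply: filterS (graph (- (pi / 2))) => t0; exact: tube_order_box_dim.
  - by apply: filterS (graph 0) => t0; exact: tube_order_nondegenerate.
  - by apply: filterS (graph (- (pi / 2))) => t0; exact: tube_order_nondegenerate.
pose g x := f x - f 0.
have [Ca hCa] := osc_expands 0 P A; have [Cb hCb] := osc_expands (- (pi / 2)) P A.
have la := expands_lead s0 hCa; have lb := expands_lead s0 hCb.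
have a0 : 0 < Ca 1%N by exact: osc_lead_gt0 P s2 A phi0 phi00 la.
pose w := f 0; have w0 : 0 < `|w| by rewrite normr_gt0.
have [sg [sg1 wE]] : exists sg : R, (sg = 1 \/ sg = -1) /\ w = sg * `|w|.
  by case: (ltrgt0P w) f0 => // _ _; [exists 1|exists (-1)]; split;
    rewrite ?mul1r ?mulN1r ?opprK; [left| |right|].
have sgsg : sg * sg = 1 by case: sg1 => ->; ring.
pose A0 := osc g phi 0; pose B0 := osc g phi (- (pi / 2)).
have sgm := phase_smooth P.
have dlead th c : decays (fun t => osc g phi th t - c * t `^ (- p)) (2 / s%:R) ->
    t * osc g (fun x => g x * phi x) (th + pi / 2) t * t `^ p @[t --> +oo] --> - (p * c).
  move=> hc; apply: (decays_cvg pr).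
  have := decaysD (osc_derive_lead th P A) (decaysZ (- p) hc).
  apply: decays_near; near=> t; rewrite -/g -/p; ring.
pose c : R := Num.sqrt (Ca 1%N ^+ 2 + Cb 1%N ^+ 2).
have c0 : 0 < c by rewrite sqrtr_gt0 ltr_wpDr ?sqr_ge0// exprn_gt0.
have := @polar_of_limits R A0 B0 _ _ (Ca 1%N) (Cb 1%N) p `|w| sg a0 p0 w0
  (fun t => osc_is_derive 0 t sgm A) (fun t => osc_is_derive (- (pi / 2)) t sgm A)
  (decays_cvg pr la) (decays_cvg pr lb) (dlead _ _ la) (dlead _ _ lb) => /= hpolar.
have [T [AT hP]] := filter_ex hpolar.
have [rad hrad hcurve] := curve_tail_spiral cf cphi cA sg1 wE AT hP.
have cw0 : 0 < c * `|w| `^ p by rewrite mulr_gt0// powR_gt0.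
have p01' : 0 < p <= 1 by rewrite p0 ltW.
have dec := polar_decaying hP p01' cw0 hrad.
pose K : R := c `^ d * pi * (pi / (s%:R * `|w|)) `^ (- (2 / (s%:R + 1))) *
  ((s%:R + 1) / (s%:R - 1)).
have d0 : 0 <= d by rewrite divr_ge0 ?mulr_ge0 ?addr_ge0// ltW.
have K0 : 0 < K.
  have pi0 := pi_gt0 R.
  have s1 : 0 < s%:R - 1 :> R by clear - sR2; lra.
  rewrite /K; apply: mulr_gt0; last by apply: divr_gt0 => //; exact: addr_gt0.
  by rewrite !mulr_gt0 ?powR_gt0// divr_gt0// mulr_gt0.
have dE : 2 / (1 + p) = d.
  by rewrite /p /d; clear - sR; field; rewrite !gt_eqF// addr_gt0.
have tail : \forall tau0 \near +oo, tube_asymptotic (curve_tail J tau0) d K.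
  have [S [_ hS]] := spiral_tube_asymptotic sgsg p01 cw0 dec.
  have [t1 Tt1 St1] := polar_unbounded hP (S + 1).
  near=> tau0.
  have tau1 : t1 <= tau0 by near: tau0; apply: nbhs_pinfty_ge; rewrite num_real.
  have := hS (phase `|w| sg A0 B0 tau0).
  rewrite -hcurve ?(le_trans Tt1)// dE spiral_content_scaled//; apply.
  apply: (@lt_le_trans _ _ (S + 1)); first by rewrite ltrDl.
  by apply: le_trans St1 _; exact: (polar_le hP).
exists (fun j => Ca j +i* Cb j); split.
- exact: asymptotic_expansion_of_expands.
- by apply: (@leading_coefficientP R f phi s).
- apply: filterS tail => tau0 h0; apply: tube_order_box_dim => //.
  exact: tube_asymptotic_order h0.
- apply: filterS tail => tau0 h0; exists d, K%:E; split => //; split.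
    exact: tube_asymptotic_content.
  by rewrite lte_fin ltry.
- by apply: filterS tail => tau0; exact: tube_asymptotic_content.
Unshelve. all: by end_near. Qed.
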